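(* Let $\alpha\in(0,1)$ and $\epsilon>0$. For the sticky holding times $\{\bar e_i\}_{i\in\mathbb N_0}$ of $\bar X$ we have $\bar e_0=H_{e_0}$, $\bar e_i\stackrel{d}{=}H_{e_i}$ for $i\in\mathbb N$, and $\{\bar e_i\}_i$ are independent. If moreover $$\mathbf P_x(e_0>t)=e^{-t(\sigma/\eta)\,n(\mathfrak E)},\qquad t\ge 0,\quad\text{for all }x\in\partial\Omega,$$ then $\{\bar e_i\}_i$ are i.i.d. Mittag-Leffler random variables.
   Context: Setting: $\eta,\sigma,c$ are positive constants; $\Omega\subset\mathbb R^d$, $d>1$, is a bounded domain with $C^\infty$ boundary. $X^+$ is the reflecting Brownian motion on $\bar\Omega$ (generator: Neumann Laplacian $\Delta$) with boundary local time $\gamma^+_t=\lim_{\delta\downarrow0}\delta^{-1}\int_0^t\mathbf 1_{\{\operatorname{dist}(X^+_s,\partial\Omega)\le\delta\}}ds$. $X$ is the elastic sticky Brownian motion on $\bar\Omega$; it moves along the path of $X^+$ with the clock $V_t^{-1}$ inverse to $V_t=t+(\eta/\sigma)\gamma^+_t$. $H$ is an $\alpha$-stable subordinator, $\mathbf E_0[e^{-\lambda H_t}]=e^{-t\lambda^\alpha}$, independent of $X^+$. $Y\circ R_t$ means $Y_{R_t}$. All processes start on $\partial\Omega$. Sticky holding times of $X$: let $\Lambda_\epsilon=\{x\in\bar\Omega:\operatorname{dist}(x,\partial\Omega)<\epsilon\}$, $\tau^+_0(\Omega)=0$, $\tau^+_i(\Lambda_\epsilon)=\inf\{t>\tau^+_i(\Omega):X^+_t\notin\Lambda_\epsilon\}$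 for $i\in\mathbb{N}_0$, $\tau^+_i(\Omega)=\inf\{t>\tau^+_{i-1}(\Lambda_\epsilon):X^+_t\notin\Omega\}$ for $i\in\mathbb{N}$, and $\tau^+_\epsilon=\tau_0^+(\Lambda_\epsilon)$. The $i$-th sticky holding time $e_i$ of $X$ is the time $X$ spends on $\partial\Omega$ during the $i$-th visit to $\Lambda_\epsilon$, i.e. $e_i=(\eta/\sigma)\big(\gamma^+\circ\tau^+_i(\Lambda_\epsilon)-\gamma^+\circ\tau^+_i(\Omega)\big)$; in particular $e_0=(\eta/\sigma)\gamma^+\circ\tau^+_\epsilon$. Convention: the boundary points $x_i=X^+\circ\tau^+_i(\Omega)$ at which the visits start are regarded as given; given them, $\{e_i\}_i=\{e_i(x_i)\}_i$ is a sequence of independent random variables with $\mathbf P(e_i(x_i)>t)=\mathbf P_{x_i}((\eta/\sigma)\gamma^+\circ\tau_\epsilon^+>t)$. Process $\bar X$: it is the time change $\bar X_t=X^{el}\circ\bar V_t^{-1}$ of the elastic Brownian motion $X^{el}$ (where $\mathbf E_x[f(X^{el}_t)]=\mathbf E_x[f(X_t^+)e^{-(c/\sigma)\gamma_t^+}]$), with $\bar V_t=t+H\circ(\eta/\sigma)\gamma^+_t$ and $\bar V_t^{-1}=\inf\{s\ge 0:\bar V_s>t\}$; thus it moves along the path of $X^+$ with clock $\bar V^{-1}_t$. With $\bar\tau_0(\Omega)=0$, $\bar\tau_i(\Lambda_\epsilon)=\inf\{t>\bar\tau_i(\Omega):\bar X_t\notin\Lambda_\epsilon\}$, $\bar\tau_i(\Omega)=\inf\{t>\bar\tau_{i-1}(\Lambda_\epsilon):\bar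 X_t\notin\Omega\}$, the $i$-th sticky holding time $\bar e_i$ of $\bar X$ is the time $\bar X$ (started from $\partial\Omega$) spends on $\partial\Omega$ during its $i$-th visit to $\Lambda_\epsilon$, i.e. during $[\bar\tau_i(\Omega),\bar\tau_i(\Lambda_\epsilon)]$. Other notation: $\mathfrak E$ is the set of excursions of $X^+$ from $\partial\Omega$ that exit $\Lambda_\epsilon$, and $n(\mathfrak E)\in(0,\infty)$ is its Itô excursion measure, which is assumed in the second part not to depend on the starting point of the excursion. A Mittag-Leffler random variable is a positive random variable $\chi$ with $\mathbf P(\chi>t)=E_\alpha(-\kappa t^\alpha)$, $t\ge0$, for some constant $\kappa>0$, where $E_\alpha(z)=\sum_{j\ge0}z^j/\Gamma(\alpha j+1)$. *)

(* Defs.v *)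
From HB Require Import structures.
From mathcomp Require Export all_boot all_order all_algebra.
From mathcomp Require Export all_classical all_reals all_analysis.
From mathcomp Require Export measurable_realfun.
Export Order.TTheory GRing.Theory Num.Theory numFieldNormedType.Exports.

Set Implicit Arguments.
Unset Strict Implicit.
Unset Printing Implicit Defensive.

Local Open Scope classical_set_scope.
Local Open Scope ring_scope.

Section euclidean_domain.
Context {R : realType} {d : nat}.
Implicit Types (Omega A : set 'rV[R]_d) (f rho : 'rV[R]_d -> R)
  (x y p : 'rV[R]_d).

(* The library norm on 'rV is the sup norm, which is only used here for the
   topology; distances are Euclidean. *)
Definition enorm x : R := Num.sqrt (\sum_(j < d) x ord0 j ^+ 2).

Definition edist x A : R := inf [set enorm (x - y) | y in A].

Definition bdry A : set 'rV[R]_d := closure A `\` A°.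

Definition pderiv (j : 'I_d) f : 'rV[R]_d -> R :=
  fun x => 'D_(delta_mx ord0 j) f x.

Definition pderivs (js : seq 'I_d) f : 'rV[R]_d -> R := foldr pderiv f js.

Definition smooth f : Prop :=
  forall js : seq 'I_d, continuous (pderivs js f) /\
    forall (j : 'I_d) x, derivable (pderivs js f) x (delta_mx ord0 j).

Definition laplacian f x : R := \sum_(j < d) pderiv j (pderiv j f) x.

Definition grad_dot rho f p : R := \sum_(j < d) pderiv j rho p * pderiv j f p.

(* rho is positive exactly inside Omega near p; its gradient at a boundary
   point p is then a nonzero multiple of the inner unit normal. *)
Definition local_defining_function Omega p rho : Prop :=
  [/\ smooth rho, (exists j, pderiv j rho p != 0)
    & \forall x \near p, Omega x <-> 0 < rho x].

Definition bounded_smooth_domain Omega : Prop :=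
  [/\ open Omega, connected Omega, Omega !=set0, bounded_set Omega
    & forall p, bdry Omega p -> exists rho, local_defining_function Omega p rho].

(* Zero normal derivative on the boundary. *)
Definition neumann Omega f : Prop :=
  forall p rho, bdry Omega p -> local_defining_function Omega p rho ->
    grad_dot rho f p = 0.

Definition collar Omega (eps : R) : set 'rV[R]_d :=
  [set x | closure Omega x /\ edist x (bdry Omega) < eps].

End euclidean_domain.

Section paths.
Context {R : realType}.

(* Value at an extended time of a nondecreasing function on [0, +oo[. *)
Definition at_time (f : R -> R) (u : \bar R) : \bar R :=
  match u with
  | r%:E => (f r)%:E
  | +oo%E => ereal_sup [set (f t)%:E | t in `[0, +oo[ ]
  | -oo%E => (f 0)%:E
  end.

Definition right_inverse (V : R -> R) (t : R) : R :=
  inf [set s : R | 0 <= s /\ t < V s].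

Context {d : nat}.
Implicit Types (Omega A : set 'rV[R]_d) (y : R -> 'rV[R]_d).

Definition hit_after y (u : \bar R) A : \bar R :=
  ereal_inf [set t%:E | t in [set t : R | [/\ 0 <= t, (u < t%:E)%E & A (y t)]]].

(* visit_start i and visit_end i are tau_i(Omega) and tau_i(Lambda_eps). *)
Fixpoint visit_start Omega (eps : R) y (i : nat) : \bar R :=
  if i is j.+1 then
    hit_after y (hit_after y (visit_start Omega eps y j) (~` collar Omega eps))
      (~` Omega)
  else 0%E.

Definition visit_end Omega (eps : R) y (i : nat) : \bar R :=
  hit_after y (visit_start Omega eps y i) (~` collar Omega eps).

(* The path during the i-th visit, re-started at time 0 and stopped at the end
   of the visit. *)
Definition visit_path Omega (eps : R) y (i : nat) (s : R) : 'rV[R]_d :=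
  y (fine (Order.min (visit_start Omega eps y i + s%:E)%E
                     (visit_end Omega eps y i))).

Definition boundary_time Omega (eps : R) y (i : nat) : \bar R :=
  lebesgue_measure
    [set t : R | [/\ (visit_start Omega eps y i <= t%:E)%E,
                     (t%:E <= visit_end Omega eps y i)%E
                   & bdry Omega (y t)]].

End paths.

Section processes.
Context {R : realType} {disp : measure_display} {T : measurableType disp}.
Implicit Type P : probability T R.

Definition generated_by {I : Type} (D : set I) (Y : I -> T -> R)
  : set (set T) :=
  <<s [set A | exists2 i, D i &
    exists2 B : set R, measurable B & A = Y i @^-1` B] >>.

Definition independent_families P (F G : set (set T)) : Prop :=
  forall A B, F A -> G B -> P (A `&` B) = (P A * P B)%E.

Definition independent_seq P (Y : nat -> T -> \bar R) : Prop :=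
  (forall i, measurable_fun setT (Y i)) /\
  forall (n : nat) (A : nat -> set (\bar R)), (forall i, measurable (A i)) ->
    P (\bigcap_(i in `I_n) (Y i @^-1` A i)) =
    (\prod_(i < n) P (Y i @^-1` A i))%E.

Definition same_law P (Y Z : T -> \bar R) : Prop :=
  [/\ measurable_fun setT Y, measurable_fun setT Z
    & forall A, measurable A -> P (Y @^-1` A) = P (Z @^-1` A)].

Record stable_subordinator (alpha : R) (H : R -> T -> R) P : Prop := {
  subordinator_measurable : forall t : R, 0 <= t -> measurable_fun setT (H t);
  subordinator_start : forall w, H 0 w = 0;
  subordinator_nondecreasing : forall w (s t : R),
    0 <= s -> s <= t -> H s w <= H t w;
  subordinator_right_continuous : forall w (t : R),
    0 <= t -> H s w @[s --> t^'+] --> H t w;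
  subordinator_stationary : forall (s t : R) (B : set R),
    0 <= s -> 0 <= t -> measurable B ->
    P [set w | B (H (s + t) w - H s w)] = P [set w | B (H t w)];
  subordinator_independent : forall (s t : R) A (B : set R),
    0 <= s -> s <= t ->
    generated_by [set u : R | 0 <= u <= s] H A -> measurable B ->
    P (A `&` [set w | B (H t w - H s w)]) =
    (P A * P [set w | B (H t w - H s w)%R])%E;
  subordinator_laplace : forall lambda t : R, 0 <= lambda -> 0 <= t ->
    \int[P]_w expR (- (lambda * H t w)) = expR (- (t * lambda `^ alpha)) }.

End processes.

Section reflecting_brownian_motion.
Context {R : realType} {d : nat} {disp : measure_display}
  {T : measurableType disp}.
Implicit Types (Omega : set 'rV[R]_d) (P : 'rV[R]_d -> probability T R)
  (X : R -> T -> 'rV[R]_d) (gamma H : R -> T -> R).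

(* The sigma-algebra of the vector-valued process X on the time set D. *)
Definition path_sigma X (D : set R) : set (set T) :=
  generated_by [set tj : R * 'I_d | D tj.1] (fun tj w => X tj.1 w ord0 tj.2).

Definition semigroup P X (t : R) (f : 'rV[R]_d -> R) (x : 'rV[R]_d) : R :=
  \int[P x]_w f (X t w).

(* A continuous Feller process on the closure of Omega whose generator acts as
   the Laplacian on the smooth functions with zero normal derivative. These
   functions form a core of the Neumann Laplacian, so this identifies the
   generator. *)
Record reflecting_brownian_motion Omega P X : Prop := {
  rbm_continuous : forall w, {within `[0, +oo[, continuous (X ^~ w)};
  rbm_closure : forall w (t : R), 0 <= t -> closure Omega (X t w);
  rbm_measurable : forall (t : R) j, 0 <= t ->
    measurable_fun setT (fun w => X t w ord0 j);
  rbm_start : forall x : 'rV[R]_d,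
    closure Omega x -> P x [set w | X 0 w = x] = 1%E;
  rbm_feller : forall (t : R) f, 0 <= t ->
    {within closure Omega, continuous f} ->
    {within closure Omega, continuous (semigroup P X t f)};
  rbm_markov : forall (x : 'rV[R]_d) (s t : R) f A,
    closure Omega x -> 0 <= s -> 0 <= t ->
    {within closure Omega, continuous f} ->
    path_sigma X [set u : R | 0 <= u <= s] A ->
    \int[P x]_(w in A) f (X (s + t) w) =
    \int[P x]_(w in A) semigroup P X t f (X s w);
  rbm_generator : forall f, smooth f -> neumann Omega f ->
    forall e : R, 0 < e -> \forall t \near 0^'+, forall x : 'rV[R]_d,
      closure Omega x ->
      `|(semigroup P X t f x - f x) / t - laplacian f x| <= e }.

(* gamma is a version that is continuous and nondecreasing for every w. *)
Record boundary_local_time Omega X gamma (Q : probability T R) : Prop := {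
  local_time_measurable : forall t : R, 0 <= t -> measurable_fun setT (gamma t);
  local_time_start : forall w, gamma 0 w = 0;
  local_time_continuous : forall w,
    {within `[0, +oo[, continuous (gamma ^~ w)};
  local_time_nondecreasing : forall w (s t : R),
    0 <= s -> s <= t -> gamma s w <= gamma t w;
  local_time_limit : {ae Q, forall w, forall t : R, 0 <= t ->
    delta^-1 * (\int[lebesgue_measure]_(s in `[0, t])
      \1_[set x | edist x (bdry Omega) <= delta] (X s w))
    @[delta --> 0^'+] --> gamma t w} }.

Definition independent_subordinator X (alpha : R) H (Q : probability T R)
  : Prop :=
  stable_subordinator alpha H Q /\
  independent_families Q (path_sigma X [set u : R | 0 <= u])
                         (generated_by [set u : R | 0 <= u] H).

End reflecting_brownian_motion.

Section excursions.
Context {R : realType} {d : nat}.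
Implicit Types (Omega : set 'rV[R]_d) (y : R -> 'rV[R]_d).

(* An excursion has a (possibly infinite) lifetime zeta and is stopped there;
   it is extended to negative times by its starting point. *)
Definition is_excursion Omega y : Prop :=
  [/\ continuous y, (forall s : R, s <= 0 -> y s = y 0), bdry Omega (y 0)
    & exists zeta : \bar R, [/\ (0 < zeta)%E,
        (forall s : R, 0 < s -> (s%:E < zeta)%E -> Omega (y s))
      & (forall s : R, (zeta <= s%:E)%E ->
           bdry Omega (y s) /\ y s = y (fine zeta))]].

(* The cylinder sets are intersected with the set of excursions, which makes
   the latter measurable in the space of all functions. *)
Definition excursion_cylinders Omega : set (set (R -> 'rV[R]_d)) :=
  [set A | exists s j, exists2 B : set R, measurable B
    & A = [set y | is_excursion Omega y /\ B (y s ord0 j)]].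

Definition excursion_space Omega : measurableType _ :=
  g_sigma_algebraType (excursion_cylinders Omega).

Definition excursion_starts Omega y : set R :=
  [set g : R | [/\ 0 <= g, bdry Omega (y g)
             & (g%:E < hit_after y g%:E (bdry Omega))%E]].

Definition excursion_from Omega y (g : R) : R -> 'rV[R]_d :=
  fun s => y (fine (Order.min (g + Num.max 0 s)%:E
                              (hit_after y g%:E (bdry Omega)))).

Definition exiting_excursions Omega (eps : R) : set (R -> 'rV[R]_d) :=
  [set y | is_excursion Omega y /\ exists s, (~` collar Omega eps) (y s)].

Context {disp : measure_display} {T : measurableType disp}.
Implicit Types (P : 'rV[R]_d -> probability T R) (X : R -> T -> 'rV[R]_d)
  (gamma : R -> T -> R).

(* n x is the excursion measure at the boundary point x, normalised by gamma.
   The compensation formula is stated on the predictable rectangles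
   ]a, b] x A; the integral of n_{X_s}(C) over ]a, b] against d(gamma_s) is
   written with the change of variable s = right_inverse gamma u. *)
Record ito_excursion_measure Omega P X gamma
    (n : 'rV[R]_d -> {measure set (excursion_space Omega) -> \bar R})
  : Prop := {
  excursion_kernel : forall (C : set (excursion_space Omega))
      (B : set (\bar R)),
    measurable C -> measurable B ->
    <<s [set U | open U] >> (bdry Omega `&` [set x | B (n x C)]);
  excursion_sigma_finite : forall x : 'rV[R]_d,
    bdry Omega x -> sigma_finite setT (n x);
  excursion_carrier : forall x : 'rV[R]_d, bdry Omega x ->
    n x (~` [set y | is_excursion Omega y /\ y 0 = x]) = 0%E;
  excursion_compensation : forall (x : 'rV[R]_d) (a b : R) A
      (C : set (excursion_space Omega)),
    closure Omega x -> 0 <= a -> a < b ->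
    path_sigma X [set u : R | 0 <= u <= a] A -> measurable C ->
    ((\int[P x]_(w in A)
       \esum_(g in excursion_starts Omega (X ^~ w) `&` `]a, b])
         (\1_C (excursion_from Omega (X ^~ w) g))%:E) =
     (\int[P x]_(w in A)
       \int[lebesgue_measure]_(u in `]gamma a w, gamma b w[)
         n (X (right_inverse (gamma ^~ w) u) w) C))%E }.

End excursions.

Section killing_and_time_change.
Context {R : realType} {d : nat} {disp : measure_display}
  {T : measurableType disp}.

(* A process killed by a multiplicative functional: the path it moves along,
   and the conditional probability, given that path, of being alive. *)
Record killed_process := KilledProcess {
  kpath : R -> T -> 'rV[R]_d;
  kalive : R -> T -> R }.

(* E[f(Y_t)], where f vanishes at the cemetery. *)
Definition killed_expectation (P : probability T R) (Y : killed_process)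
    (f : 'rV[R]_d -> R) (t : R) : R :=
  \int[P]_w (f (kpath Y t w) * kalive Y t w).

Definition time_change (Y : killed_process) (S : R -> T -> R)
  : killed_process :=
  KilledProcess (fun t w => kpath Y (S t w) w) (fun t w => kalive Y (S t w) w).

Context (sigma eta c : R) (X : R -> T -> 'rV[R]_d) (gamma H : R -> T -> R).

Definition elastic : killed_process :=
  KilledProcess X (fun t w => expR (- (c / sigma * gamma t w))).

Definition bar_clock (s : R) (w : T) : R := s + H (eta / sigma * gamma s w) w.

Definition bar_process : killed_process :=
  time_change elastic (fun t w => right_inverse (bar_clock ^~ w) t).

Lemma elastic_expectation (P : probability T R) (f : 'rV[R]_d -> R) (t : R) :
  killed_expectation P elastic f t =
  \int[P]_w (f (X t w) * expR (- (c / sigma * gamma t w))).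
Proof. by []. Qed.

Context (Omega : set 'rV[R]_d) (eps : R).

(* e_i *)
Definition holding_time (i : nat) (w : T) : \bar R :=
  ((eta / sigma)%:E *
   (at_time (gamma ^~ w) (visit_end Omega eps (X ^~ w) i) -
    at_time (gamma ^~ w) (visit_start Omega eps (X ^~ w) i)))%E.

(* \bar e_i; the path of \bar X is that of X^+ run with the inverse clock, the
   killing being carried by the weight kalive. *)
Definition bar_holding_time (i : nat) (w : T) : \bar R :=
  boundary_time Omega eps (kpath bar_process ^~ w) i.

(* H_{e_i} *)
Definition subordinated_holding_time (i : nat) (w : T) : \bar R :=
  at_time (H ^~ w) (holding_time i w).

(* Q is the law given the points x i at which the visits to the collar start:
   every visit is a visit of the reflecting Brownian motion started from x i,
   and the holding times are independent, e_i being distributed as the boundary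
   time before exiting the collar under P (x i). Q is not the
   conditional law of P (x 0) given the whole sequence x, under which the law of
   e_i would in general also depend on x i.+1. *)
Record law_given_starts (P : 'rV[R]_d -> probability T R)
    (x : nat -> 'rV[R]_d) (Q : probability T R) : Prop := {
  given_boundary : forall i, bdry Omega (x i);
  given_starts : forall i, {ae Q, forall w,
    (visit_start Omega eps (X ^~ w) i < +oo)%E /\
    X (fine (visit_start Omega eps (X ^~ w) i)) w = x i};
  given_visits : forall (i n : nat) (s : 'I_n -> R) (B : 'I_n -> 'I_d -> set R),
    (forall k, 0 <= s k) -> (forall k j, measurable (B k j)) ->
    Q [set w | forall k j,
         B k j (visit_path Omega eps (X ^~ w) i (s k) ord0 j)] =
    P (x i) [set w | forall k j,
         B k j (visit_path Omega eps (X ^~ w) 0 (s k) ord0 j)];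
  given_independent : independent_seq Q holding_time;
  given_holding_law : forall (i : nat) (t : R), 0 <= t ->
    Q [set w | (t%:E < holding_time i w)%E] =
    P (x i) [set w | (t%:E < (eta / sigma)%:E *
      at_time (gamma ^~ w) (visit_end Omega eps (X ^~ w) 0))%E] }.

End killing_and_time_change.

Section mittag_leffler.
Context {R : realType}.

Definition Gamma (a : R) : R :=
  \int[lebesgue_measure]_(x in `]0, +oo[) (x `^ (a - 1) * expR (- x)).

Definition mittag_leffler (alpha z : R) : R :=
  limn (series (fun j : nat => z ^+ j / Gamma (alpha * j%:R + 1))).

Context {disp : measure_display} {T : measurableType disp}.

Definition mittag_leffler_rv (P : probability T R) (alpha kappa : R)
    (Y : T -> \bar R) : Prop :=
  [/\ measurable_fun setT Y, {ae P, forall w, (0 < Y w)%E}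
    & forall t : R, 0 <= t ->
        P [set w | (t%:E < Y w)%E] =
        (mittag_leffler alpha (- (kappa * t `^ alpha)))%:E].

End mittag_leffler.

(* Main.v *)
From HB Require Import structures.
Require Import Defs.
From mathcomp Require Import ring lra.
Set Implicit Arguments.
Unset Strict Implicit.
Unset Printing Implicit Defensive.
Local Open Scope classical_set_scope.
Local Open Scope ring_scope.

(** Write k for eta / sigma, V_s = s + H (k gamma_s) for the clock of the
    time-changed process and r for its inverse.

    Pathwise, r is continuous, and V_s - s is constant while X^+ is away from
    the boundary, because the local time is the limit of the occupation times
    of thin collars. Just before it returns to the boundary, and just before it
    leaves the collar, the path is inside; so V is continuous at the times S_i
    and T_i at which the i-th visit of X^+ starts and ends, and V maps them to
    the corresponding times of the time-changed path ([visits_time_change]). The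
    existence of the local time also forces X^+ to spend no time on the boundary
    ([null_boundary_occupation]). The time-changed path hence spends
    T_i - S_i of the interval from V S_i to V T_i off the boundary, and what
    remains of its length, H (k gamma_(T_i)) - H (k gamma_(S_i)), on it
    ([boundary_time_time_change]). So the i-th sticky holding time is the
    increment of H over an interval of length e_i, which starts at 0 when
    i = 0.

    The endpoints of these intervals are functionals of the path of X^+, which
    is independent of H. Given the path, the stationary and independent
    increments of H make the holding times independent, the i-th one being
    distributed as H at the frozen time e_i ([subordinator_independent_times]).
    Averaging over the path gives the law of H_(e_i), and, as the e_i are
    independent, the independence of the holding times.

    If the e_i are exponential with parameter lambda, the survival function of a
    holding time has the Laplace transform
    s^alpha / s / (s^alpha + lambda), by the Laplace exponent of H and Fubini's
    theorem. The function E_alpha (- lambda t^alpha) has the same transform for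
    large s, by term-by-term integration ([relaxation_laplace]). Both functions
    are right-continuous, so they agree by the uniqueness of Laplace transforms
    ([laplace_eq0]), which is proved by approximating indicators of half-lines
    by polynomials in exp (- t). *)

(** * Euclidean distance *)

Section euclidean_distance.
Context {R : realType} {d : nat}.
Implicit Types (x y z : 'rV[R]_d) (A : set 'rV[R]_d).

Lemma cauchy_schwarz x y :
  (\sum_j x ord0 j * y ord0 j) ^+ 2 <=
  (\sum_j x ord0 j ^+ 2) * (\sum_j y ord0 j ^+ 2).
Proof.
pose Sxx := \sum_j x ord0 j ^+ 2; pose Syy := \sum_j y ord0 j ^+ 2.
pose Sxy := \sum_j x ord0 j * y ord0 j.
(* Lagrange's identity *)
have h : 0 <= \sum_i \sum_j (x ord0 i * y ord0 j - x ord0 j * y ord0 i) ^+ 2.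
  by apply: sumr_ge0 => i _; apply: sumr_ge0 => j _; exact: sqr_ge0.
suff E : \sum_i \sum_j (x ord0 i * y ord0 j - x ord0 j * y ord0 i) ^+ 2 =
    2 * (Sxx * Syy - Sxy ^+ 2).
  by move: h; rewrite E pmulr_rge0// subr_ge0.
have -> : \sum_i \sum_j (x ord0 i * y ord0 j - x ord0 j * y ord0 i) ^+ 2 =
    \sum_i (x ord0 i ^+ 2 * Syy + y ord0 i ^+ 2 * Sxx
            - (2 * (x ord0 i * y ord0 i)) * Sxy).
  apply: eq_bigr => i _; rewrite /Syy /Sxx /Sxy !mulr_sumr -big_split/=.
  by rewrite -sumrB; apply: eq_bigr => j _; ring.
rewrite sumrB big_split/= -!mulr_suml -!mulr_sumr -/Sxx -/Syy -/Sxy; ring.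
Qed.

Lemma enorm_ge0 x : 0 <= enorm x. Proof. exact: sqrtr_ge0. Qed.

Lemma enorm_triangle x y : enorm (x + y) <= enorm x + enorm y.
Proof.
have S0 z : 0 <= \sum_j z ord0 j ^+ 2 by apply: sumr_ge0 => j _; exact: sqr_ge0.
rewrite -[leRHS]ger0_norm ?addr_ge0 ?enorm_ge0// -sqrtr_sqr ler_wsqrtr//.
rewrite sqrrD !sqr_sqrtr//.
have -> : \sum_j (x + y) ord0 j ^+ 2 = \sum_j x ord0 j ^+ 2 +
    (\sum_j x ord0 j * y ord0 j) *+ 2 + \sum_j y ord0 j ^+ 2.
  rewrite -sumrMnl -!big_split/=; apply: eq_bigr => j _.
  by rewrite mxE; ring.
rewrite lerD2r lerD2l lerMn2r/= /enorm -sqrtrM//.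
by rewrite (le_trans (ler_norm _))// -sqrtr_sqr ler_wsqrtr// cauchy_schwarz.
Qed.

Lemma enorm_coord x j : `|x ord0 j| <= enorm x.
Proof.
rewrite -sqrtr_sqr ler_wsqrtr// (bigD1 j)//= lerDl.
by apply: sumr_ge0 => i _; exact: sqr_ge0.
Qed.

Lemma norm_le_enorm x : `|x| <= enorm x.
Proof.
rewrite [leLHS]/Num.Def.normr/= mx_normrE.
apply/bigmax_leP; split => [|[i j] _]; first exact: enorm_ge0.
by rewrite ord1; exact: enorm_coord.
Qed.

Lemma enorm_le_norm x : enorm x <= Num.sqrt d%:R * `|x|.
Proof.
rewrite -[X in _ * X]ger0_norm// -sqrtr_sqr -sqrtrM// ler_wsqrtr//.
rewrite -[X in X%:R * _](card_ord d) mulr_natl -sumr_const ler_sum// => j _.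
rewrite -real_normK ?num_real// ler_sqr ?nnegrE//.
rewrite [leRHS]/Num.Def.normr/= mx_normrE.
exact: (le_bigmax _ (fun ij : 'I_1 * 'I_d => `|x ij.1 ij.2|) (ord0, j)).
Qed.

Lemma edist_ge0 x A : 0 <= edist x A.
Proof.
rewrite /edist; have [->|/set0P[y Ay]] := eqVneq A set0.
  by rewrite image_set0 inf0.
by apply: lb_le_inf => [|_ [z _ <-]]; [exists (enorm (x - y)), y|
  exact: enorm_ge0].
Qed.

Lemma edist_le x y A : A y -> edist x A <= enorm (x - y).
Proof.
move=> Ay; apply: ge_inf; last by exists y.
by exists 0 => _ [z _ <-]; exact: enorm_ge0.
Qed.

Lemma edist_triangle x y A : A !=set0 ->
  edist x A <= enorm (x - y) + edist y A.
Proof.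
move=> A0; rewrite -lerBlDl; apply: lb_le_inf.
  by case: A0 => z Az; exists (enorm (y - z)), z.
move=> _ [z Az <-]; rewrite lerBlDl (le_trans (edist_le _ Az))//.
by rewrite (_ : x - z = (x - y) + (y - z)) ?enorm_triangle// addrA subrK.
Qed.

Lemma edist_continuous A : A !=set0 -> continuous (edist ^~ A).
Proof.
move=> A0 x; apply/(cvgrPdist_lt (FF := nbhs_filter x)) => e e0.
pose c : R := Num.sqrt d%:R + 1.
have c0 : 0 < c by rewrite ltr_wpDl// sqrtr_ge0.
apply/nbhs_ballP; exists (e / c) => [|t]/=; rewrite ?divr_gt0//.
rewrite -ball_normE/= ltr_pdivlMr// => xt.
have h y z : edist y A - edist z A <= Num.sqrt d%:R * `|y - z|.
  by rewrite lerBlDr (le_trans (edist_triangle y z A0))// lerD2r enorm_le_norm.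
rewrite (@le_lt_trans _ _ (`|x - t| * c))// ler_norml lerNl opprB.
have le z : Num.sqrt d%:R * `|z| <= `|z| * c :> R.
  by rewrite mulrC ler_wpM2l// lerDl.
by rewrite !(le_trans (h _ _))// ?(le_trans _ (le _))// distrC.
Qed.

Lemma edist0P x A : A !=set0 -> edist x A = 0 <-> closure A x.
Proof.
move=> A0; split => [x0 B|cx].
  move=> /nbhs_ballP[e /= e0 eB].
  have [|_ [y Ay <-] yx] := @inf_adherent _ [set enorm (x - y) | y in A] _ e0.
    split; first by case: A0 => z Az; exists (enorm (x - z)), z.
    by exists 0 => _ [z _ <-]; exact: enorm_ge0.
  exists y; split => //; apply: eB; rewrite -ball_normE/= (le_lt_trans (norm_le_enorm _))//.
  by rewrite (lt_le_trans yx)// -/(edist x A) x0 add0r.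
apply/eqP; rewrite eq_le edist_ge0 andbT leNgt; apply/negP => x0.
have /cx[y [Ay /=]] : nbhs x [set y | 0 < edist y A].
  exact: (edist_continuous A0 (x := x) (lt_nbhsr x0)).
have -> : edist y A = 0; last by rewrite ltxx.
apply/eqP; rewrite eq_le edist_ge0 andbT (le_trans (edist_le y Ay))// subrr.
by rewrite /enorm big1 ?sqrtr0// => j _; rewrite mxE expr0n.
Qed.

Lemma bdry_closed A : closed (bdry A).
Proof. by apply: closedI; [exact: closed_closure|apply: open_closedC; exact: open_interior]. Qed.

Lemma edist_bdry0P Omega x : bdry Omega !=set0 ->
  edist x (bdry Omega) = 0 <-> bdry Omega x.
Proof.
by move=> b0; rewrite edist0P// -(closure_id (bdry Omega)).1//; exact: bdry_closed.
Qed.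

End euclidean_distance.

(** * Measurability of continuous functions of a random vector *)

Section random_vector.
Context {R : realType} {d : nat} {disp : measure_display}
  {T : measurableType disp}.

(** An open set of R^d is a countable union of open boxes with rational centre
    and radius, so the coordinates already generate the Borel sets. *)
Lemma measurable_continuous_vector (f : 'rV[R]_d -> R) (Y : T -> 'rV[R]_d) :
  continuous f -> (forall j, measurable_fun setT (fun w => Y w ord0 j)) ->
  measurable_fun setT (f \o Y).
Proof.
move=> cf mY; apply: (measurability _ (RGenInftyO.measurableE R)) => _ [_ [a ->] <-].
rewrite setTI.
pose q (c : 'rV[rat]_d) : 'rV[R]_d := map_mx ratr c.
pose good (cr : 'rV[rat]_d * rat) :=
  [set w | [/\ 0 < ratr cr.2 :> R, forall x, ball (q cr.1) (ratr cr.2) x -> f x < a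
    & forall j, `|q cr.1 ord0 j - Y w ord0 j| < ratr cr.2]].
have ballE (c y : 'rV[R]_d) (r : R) : 0 < r ->
    (forall j, `|c ord0 j - y ord0 j| < r) -> ball c r y.
  by move=> r0 h; rewrite -ball_normE/= /Num.Def.normr/= mx_normrE;
    apply/bigmax_ltP; split => [//|[i j] _]; rewrite ord1 !mxE.
have -> : (f \o Y) @^-1` `]-oo, a[ = \bigcup_cr good cr.
  apply/seteqP; split => [w|w [[c r] _ /= [r0 h hw]]]; last first.
    by rewrite /= in_itv/=; apply: h; exact: ballE.
  rewrite /= in_itv/= => fa.
  have : \forall y \near Y w, f y < a by exact: (cf _ _ (lt_nbhsl fa)).
  move=> /nbhs_ballP[e /= e0 eB].
  have [r re] : exists r : rat, 0 < (ratr r : R) < e / 2.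
    have [r] := @rat_in_itvoo R 0 (e / 2) (divr_gt0 e0 (@ltr0Sn R 1)).
    by rewrite in_itv/= => h; exists r.
  have /andP[r0 r2] := re.
  have /choice[c hc] : forall j, exists c : rat,
      `|ratr c - Y w ord0 j| < (ratr r : R).
    move=> j; have [|c] := @rat_in_itvoo R (Y w ord0 j - ratr r) (Y w ord0 j + ratr r).
      by rewrite ltrBlDr -addrA ltr_pwDr// addr_gt0.
    by rewrite in_itv/= => h; exists c; rewrite ltr_distl.
  exists (\row_j c j, r) => //; split => //=.
  - move=> y qy; apply: eB; rewrite [e]splitr.
    apply: (@ball_triangle _ _ (q (\row_j c j))).
      apply: ballE => [|j]; first by rewrite divr_gt0.
      by rewrite !mxE distrC (lt_trans (hc j)).
    by apply: le_ball qy; exact: ltW.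
  - by move=> j; rewrite !mxE.
apply: countable_bigcupT_measurable => [|[c r]]; first exact: countableP.
have [r0|r0] := boolP (0 < ratr r :> R); last first.
  by rewrite (_ : good _ = set0)// -subset0 => w [/=]; rewrite (negbTE r0).
have [cr|cr] := pselect (forall x, ball (q c) (ratr r) x -> f x < a); last first.
  by rewrite (_ : good _ = set0)// -subset0 => w [/=].
have -> : good (c, r) =
    \big[setI/setT]_j [set w | `|q c ord0 j - Y w ord0 j| < ratr r].
  rewrite -bigcap_seq; apply/seteqP; split => [w [_ _ h] j _|w h]; first exact: h.
  by split => // j; apply: h => /=; rewrite mem_index_enum.
apply: bigsetI_measurable => j _; rewrite -[X in measurable X]setTI.
apply: measurable_fun_ltr => //; apply: measurableT_comp => //.
exact: measurable_funB.
Qed.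

End random_vector.

(** * Measurability of hitting times and of boundary times *)

Section measurable_processes.
Context {R : realType} {disp : measure_display} {T : measurableType disp}.

Lemma measurable_condition (P : Prop) (A : set T) :
  measurable A -> measurable [set w | P /\ A w].
Proof.
move=> mA; have [p|np] := pselect P.
  by rewrite (_ : mkset _ = A)//; apply/seteqP; split => w //= -[].
by rewrite (_ : mkset _ = set0)// -subset0 => w [].
Qed.

Lemma measurable_sublevel (f g : T -> \bar R) : measurable_fun setT f ->
  measurable_fun setT g -> measurable [set w | (f w <= g w)%E].
Proof. by move=> mf mg; rewrite -[X in measurable X]setTI; exact: measurable_lee. Qed.

Lemma measurable_strict_sublevel (f g : T -> \bar R) : measurable_fun setT f ->
  measurable_fun setT g -> measurable [set w | (f w < g w)%E].
Proof. by move=> mf mg; rewrite -[X in measurable X]setTI; exact: measurable_lte. Qed.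

(** Time is rounded up to the next multiple of 1/(n+1); rounding up strictly
    makes right-continuity at the original time applicable. *)
Lemma right_continuous_jointly_measurable (E : R -> T -> R) :
  (forall t, measurable_fun setT (E t)) ->
  (forall w t, E s w @[s --> t^'+] --> E t w) ->
  measurable_fun setT (fun p : measurableTypeR R * T => E p.1 p.2).
Proof.
move=> mE rcE.
pose g (n : nat) (t : R) : R := (Num.floor (n.+1%:R * t) + 1)%:~R / n.+1%:R.
apply: (@measurable_fun_cvg _ _ _ _ (fun n p => E (g n p.1) p.2)); last first.
  move=> [t w] _ /=; have /cvg_at_rightP := rcE w t; apply; split => [n|].
    by rewrite /g ltr_pdivlMr// mulrC floorD1_gt.
  apply/(@squeeze_cvgr _ _ _ _ (cst t) (fun n => t + n.+1%:R^-1)).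
  - apply: nearW => n; rewrite /g /= ler_pdivlMr// mulrC ltW ?floorD1_gt//=.
    rewrite ler_pdivrMr// mulrDl mulVf// intrD lerD2r mulrC.
    exact: floor_le.
  - exact: cvg_cst.
  - rewrite -[X in _ --> X]addr0; apply: cvgD; first exact: cvg_cst.
    exact: cvg_harmonic.
move=> n _ B mB; rewrite setTI.
pose c (k : int) : R := (k + 1)%:~R / n.+1%:R.
have -> : (fun p : measurableTypeR R * T => E (g n p.1) p.2) @^-1` B =
    \bigcup_k ([set t | Num.floor (n.+1%:R * t) = k] `*` (E (c k) @^-1` B)).
  apply/seteqP; split => [[t w] /= Bw|[t w] [k _ [/= <-]]//].
  by exists (Num.floor (n.+1%:R * t)).
apply: countable_bigcupT_measurable => [|k]; first exact: countableP.
apply: measurableX; last by rewrite -[X in measurable X]setTI; exact: mE.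
have -> : [set t : R | Num.floor (n.+1%:R * t) = k] =
    `[k%:~R / n.+1%:R, (k + 1)%:~R / n.+1%:R[%classic.
  apply/seteqP; split => t /=; rewrite in_itv/= ler_pdivrMr// ltr_pdivlMr// mulrC.
    by move=> <-; rewrite floor_le floorD1_gt.
  by move=> /andP[a b]; apply/eqP; rewrite floor_eq// a b.
exact: measurable_itv.
Qed.

Lemma continuous_jointly_measurable (E : R -> T -> R) :
  (forall t, measurable_fun setT (E t)) -> (forall w, continuous (E ^~ w)) ->
  measurable_fun setT (fun p : measurableTypeR R * T => E p.1 p.2).
Proof.
move=> mE cE; apply: right_continuous_jointly_measurable => // w t.
by apply: cvg_at_right_filter; exact: cE.
Qed.

Lemma measurable_process_at (E : R -> T -> R) (u : T -> R) :
  measurable_fun setT (fun p : measurableTypeR R * T => E p.1 p.2) ->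
  measurable_fun setT u -> measurable_fun setT (fun w => E (u w) w).
Proof.
move=> mE mu.
apply: (measurableT_comp (f := fun p : measurableTypeR R * T => E p.1 p.2)
  (g := fun w => (u w, w))) => //.
exact: measurable_fun_pair.
Qed.

End measurable_processes.

Section nonneg_times.
Context {R : realType}.

(** Only the values at nonnegative times matter; freezing the path before time
    0 makes it a continuous function on the whole line. *)
Lemma continuous_frozen {V : topologicalType} (f : R -> V) :
  {within `[0, +oo[, continuous f} -> continuous (fun t : R => f (Num.max 0 t)).
Proof.
move=> /subspace_continuousP cf t.
have h0 s : `[0, +oo[%classic (Num.max 0 s : R).
  by rewrite /= in_itv/= andbT le_max lexx.
apply: cvg_comp (cf _ (h0 t)) => A /=.
rewrite /within/= => hA.
have cm : {for t, continuous ((cst 0 : R -> R^o) \max id)}.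
  by apply: continuous_max; [exact: cst_continuous|move=> A0; exact].
have {}cm : nbhs t ((cst 0 \max id) @^-1` _) := cm _ hA.
by apply: (filterS (F := nbhs t)) cm => s /= /(_ (h0 s)).

Qed.

End nonneg_times.

Section hitting_times.
Context {R : realType} {d : nat}.
Implicit Types (y : R -> 'rV[R]_d) (A : set 'rV[R]_d).

Lemma hit_after_ge y u A : (u <= hit_after y u A)%E.
Proof. by apply: le_ereal_inf_tmp => _ [t [_ /ltW ut _] <-]. Qed.

Lemma hit_after_ge0 y u A : (0 <= hit_after y u A)%E.
Proof. by apply: le_ereal_inf_tmp => _ [t [t0 _ _] <-]. Qed.

Lemma hit_after_lt y u A (b : \bar R) : (hit_after y u A < b)%E <->
  exists t : R, [/\ 0 <= t, (u < t%:E)%E, A (y t) & (t%:E < b)%E].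
Proof.
split=> [/ereal_inf_lt[_ [t [t0 ut At] <-] tb]|[t [t0 ut At tb]]].
  by exists t.
by apply: le_lt_trans tb; apply: ereal_inf_lbound; exists t.
Qed.

Lemma visit_start_ge0 Omega eps y i : (0 <= visit_start Omega eps y i)%E.
Proof. by case: i => [|i] //=; exact: hit_after_ge0. Qed.

Lemma visit_start_end Omega eps y i :
  (visit_start Omega eps y i <= visit_end Omega eps y i)%E.
Proof. exact: hit_after_ge. Qed.

Lemma visit_end_start Omega eps y i :
  (visit_end Omega eps y i <= visit_start Omega eps y i.+1)%E.
Proof. exact: hit_after_ge. Qed.

Context {disp : measure_display} {T : measurableType disp}.

(** The debut of a closed set by a continuous path: by compactness, the path
    meets {E <= 0} in [p, q] if and only if, for every k, it meets {E < 1/k}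
    there at a rational time. *)
Lemma measurable_hit_after (Y : R -> T -> 'rV[R]_d) (E : R -> T -> R) A
    (u : T -> \bar R) :
  (forall t, measurable_fun setT (E t)) -> (forall w, continuous (E ^~ w)) ->
  (forall w t, 0 <= t -> A (Y t w) <-> E t w <= 0) ->
  measurable_fun setT u -> (forall w, (0 <= u w)%E) ->
  measurable_fun setT (fun w => hit_after (Y ^~ w) (u w) A).
Proof.
move=> mE cE AE mu u0; apply: (measurability _ (ErealGenInftyO.measurableE R)).
move=> _ [_ [b ->] <-]; rewrite setTI.
pose C (p q : rat) := \bigcap_k \bigcup_(r : rat)
  [set w | (ratr p : R) <= ratr r <= (ratr q : R) /\ E (ratr r) w < k.+1%:R^-1].
have -> : (fun w => hit_after (Y ^~ w) (u w) A) @^-1` `]-oo, b%:E[ =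
    \bigcup_(pq : rat * rat)
     [set w | ((0 : R) <= ratr pq.1 <= (ratr pq.2 : R) /\ ratr pq.2 < b) /\
       ([set w | (u w < (ratr pq.1)%:E)%E] `&` C pq.1 pq.2) w].
  apply/seteqP; split => [w|w [[p q] _ /= [[/andP[p0 pq] qb] [up Cw]]]];
      last first.
    rewrite /= in_itv/=; apply/hit_after_lt.
    have [c] := EVT_min pq (continuous_subspaceT (cE w)).
    rewrite in_itv/= => /andP[pc cq] cmin.
    have c0 : 0 <= c by exact: le_trans pc.
    exists c; split => //; first exact: lt_le_trans up _.
      apply/AE => //; rewrite leNgt; apply/negP => Ec0.
      have [N _ /(_ N (leqnn N)) /= NE] := near_infty_natSinv_lt (PosNum Ec0).
      have [r _ [rpq Er]] := Cw N I.
      have := lt_trans Er NE.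
      by rewrite ltNge cmin// in_itv.
    by rewrite lte_fin (le_lt_trans cq).
  rewrite /= in_itv/= => /hit_after_lt[t [t0 ut At tb]].
  have [p [p0 up pt]] : exists p : rat, [/\ 0 <= (ratr p : R),
      (u w < (ratr p)%:E)%E & ratr p < t].
    have [s uE] : exists s, u w = s%:E.
      by move: ut (u0 w); case: (u w) => // s _ _; exists s.
    move: (u0 w) ut; rewrite uE lee_fin lte_fin => s0 /rat_in_itvoo[p].
    rewrite in_itv/= => /andP[sp pt]; exists p.
    by rewrite lte_fin; split => //; exact: le_trans (ltW sp).
  have [q] := rat_in_itvoo tb; rewrite in_itv/= => /andP[tq qb].
  exists (p, q) => //; split => /=.
    by split => //; rewrite p0/= (le_trans (ltW pt))// ltW.
  split => // k _.
  have Et : E t w < k.+1%:R^-1.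
    by rewrite (@le_lt_trans _ _ 0)//; exact/AE.
  have [e /= e0 eE] : \forall s \near t, E s w < k.+1%:R^-1.
    exact: (cE w t _ (lt_nbhsl Et)).
  have [|r] := @rat_in_itvoo R (Num.max (ratr p) (t - e)) t.
    by rewrite gt_max pt/= ltrBlDr ltrDl.
  rewrite in_itv/= gt_max => /andP[/andP[pr er] rt].
  exists r => //; split; first by rewrite (ltW pr)/= (le_trans (ltW rt))// ltW.
  by apply: eE; rewrite /= ger0_norm ?subr_ge0 1?ltW// ltrBlDl -ltrBlDr.
apply: countable_bigcupT_measurable => [|[p q]]; first exact: countableP.
apply: measurable_condition; apply: measurableI.
  exact: measurable_strict_sublevel.
apply: bigcapT_measurable => k.
apply: countable_bigcupT_measurable => [|r]; first exact: countableP.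
apply: measurable_condition; rewrite -[X in measurable X]setTI.
exact: measurable_fun_ltr.
Qed.

Section visits.
Variables (Omega : set 'rV[R]_d) (eps : R) (Y : R -> T -> 'rV[R]_d)
  (D : R -> T -> R).
Hypotheses (mD : forall t, measurable_fun setT (D t))
  (cD : forall w, continuous (D ^~ w))
  (D_collar : forall w t, 0 <= t -> (~` collar Omega eps) (Y t w) <-> eps <= D t w)
  (D_Omega : forall w t, 0 <= t -> (~` Omega) (Y t w) <-> D t w <= 0)
  (D_bdry : forall w t, 0 <= t -> bdry Omega (Y t w) <-> D t w <= 0).

Lemma measurable_exit (u : T -> \bar R) :
  measurable_fun setT u -> (forall w, (0 <= u w)%E) ->
  measurable_fun setT
    (fun w => hit_after (Y ^~ w) (u w) (~` collar Omega eps)).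
Proof.
apply: (measurable_hit_after (E := fun t w => eps - D t w)).
- by move=> t; apply: measurable_funB.
- by move=> w t; apply: cvgB; [exact: cvg_cst|exact: cD].
- by move=> w t t0; rewrite subr_le0; exact: D_collar.
Qed.

Lemma measurable_visit_start i :
  measurable_fun setT (fun w => visit_start Omega eps (Y ^~ w) i).
Proof.
elim: i => [|i ih] /=; first exact: measurable_cst.
apply: (measurable_hit_after (E := D)) => // [|w]; last exact: hit_after_ge0.
by apply: measurable_exit => // w; exact: visit_start_ge0.
Qed.

Lemma measurable_visit_end i :
  measurable_fun setT (fun w => visit_end Omega eps (Y ^~ w) i).
Proof.
apply: measurable_exit; first exact: measurable_visit_start.
by move=> w; exact: visit_start_ge0.
Qed.

Lemma measurable_occupation (u v : T -> \bar R) (E : R -> T -> R) :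
  measurable_fun setT u -> measurable_fun setT v ->
  (forall t, measurable_fun setT (E t)) -> (forall w, continuous (E ^~ w)) ->
  measurable_fun setT (fun w => lebesgue_measure
    [set t : R | [/\ (u w <= t%:E)%E, (t%:E <= v w)%E & E t w <= 0]]).
Proof.
move=> mu mv mE cE.
pose A := [set p : measurableTypeR R * T |
  [/\ (u p.2 <= p.1%:E)%E, (p.1%:E <= v p.2)%E & E p.1 p.2 <= 0]].
have mA : measurable A.
  rewrite /A (_ : mkset _ = [set p | (u p.2 <= p.1%:E)%E] `&`
    [set p | (p.1%:E <= v p.2)%E] `&` [set p | ((E p.1 p.2)%:E <= 0)%E]).
    have mfst : measurable_fun setT (fun p : measurableTypeR R * T => p.1%:E).
      by apply/measurable_EFinP; exact: measurable_fst.
    apply: measurableI; first apply: measurableI.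
    - by apply: measurable_sublevel => //; apply: (measurableT_comp mu);
        exact: measurable_snd.
    - by apply: measurable_sublevel => //; apply: (measurableT_comp mv);
        exact: measurable_snd.
    - apply: measurable_sublevel; last exact: measurable_cst.
      by apply/measurable_EFinP; exact: continuous_jointly_measurable.
  apply/seteqP; split => -[t w] /=; rewrite lee_fin; first by case.
  by case=> -[].
have := measurable_fun_ysection lebesgue_measure mA.
apply: eq_measurable_fun => w _ /=; congr (lebesgue_measure _).
by apply/seteqP; split => t; [move/ysectionP|move=> ?; apply/ysectionP].
Qed.

Lemma measurable_boundary_time i :
  measurable_fun setT (fun w => boundary_time Omega eps (Y ^~ w) i).
Proof.
have := measurable_occupation (measurable_visit_start i)
  (measurable_visit_end i) mD cD.
apply: eq_measurable_fun => w _ /=; congr (lebesgue_measure _).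
by apply/seteqP; split => t /= [st te]; (have t0 : 0 <= t by
  rewrite -lee_fin (le_trans _ st)// visit_start_ge0) => /(D_bdry w t0).
Qed.

End visits.

End hitting_times.

(** * The clock of the time-changed process *)

Section lebesgue_translation.
Context {R : realType}.

Lemma lebesgue_measure_translation (c : R) (A : set R) : measurable A ->
  lebesgue_measure ((fun t => t - c) @^-1` A) = lebesgue_measure A.
Proof.
move=> mA; have mf : measurable_fun setT (fun t : measurableTypeR R => t - c).
  exact: measurable_funB.
transitivity (pushforward lebesgue_measure
  (fun t : measurableTypeR R => (t - c : measurableTypeR R)) A) => //.
apply/esym/lebesgue_measure_unique => //= _ [[a b]] _ <-.
rewrite /pushforward (_ : _ @^-1` _ = `]a + c, b + c]%classic); last first.
  by apply/seteqP; split => t /=; rewrite !in_itv/= ltrBrDr lerBlDr.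
rewrite /= !lebesgue_measure_itv/= !lte_fin ltrD2r; case: ifP => // _.
by rewrite -!EFinB opprD addrACA subrr addr0.
Qed.

End lebesgue_translation.

Definition clock {R : realType} (K : R -> R) (s : R) : R := s + K s.

Section clock.
Context {R : realType}.
Variable K : R -> R.
Hypotheses (K0 : K 0 = 0)
  (Kmono : forall s t, 0 <= s -> s <= t -> K s <= K t)
  (Krc : forall t, 0 <= t -> K s @[s --> t^'+] --> K t).

Local Notation V := (clock K).
Local Notation r := (right_inverse (clock K)).

Lemma clock_increment s t : 0 <= s -> s <= t -> V s + (t - s) <= V t.
Proof.
move=> s0 st; rewrite /clock addrAC (addrC s) subrK lerD2l; exact: Kmono.
Qed.

Lemma clock_lt s t : 0 <= s -> s < t -> V s < V t.
Proof. by move=> s0 st; rewrite ltr_leD// Kmono// ltW. Qed.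

Lemma clock_ge s : 0 <= s -> s <= V s.
Proof. by move=> s0; rewrite lerDl -K0 Kmono. Qed.

Lemma clock_inverse_ge0 t : 0 <= r t.
Proof.
apply: lb_le_inf => [|s []//].
exists (Num.max 0 t + 1); split; first by rewrite addr_ge0// le_max lexx.
rewrite (lt_le_trans _ (clock_ge _)) ?addr_ge0 ?le_max ?lexx//.
by rewrite ltr_pwDr// le_max lexx orbT.
Qed.

(** The Galois connection between the clock and its inverse, from which all
    properties of the inverse follow. *)
Lemma clock_inverse_le t b : 0 <= b -> (r t <= b) = (t <= V b).
Proof.
move=> b0; apply/idP/idP => [rb|tb].
  rewrite leNgt; apply/negP => Vbt.
  have [s [bs Vs]] : exists s, b < s /\ V s < t.
    have : \forall s \near b^'+, K s < t - b - (t - V b) / 2.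
      apply: (cvgr_lt (K b)); first exact: Krc.
      by rewrite /clock in Vbt *; lra.
    move=> nK.
    have : \forall s \near b^'+, s < b + (t - V b) / 2.
      by apply: nbhs_right_lt; rewrite ltrDl divr_gt0// subr_gt0.
    move=> nb; near (b^'+) => s; exists s; split => //.
    have : K s < t - b - (t - V b) / 2 by near: s.
    have : s < b + (t - V b) / 2 by near: s.
    by rewrite [V s]/clock; lra.
  have : s <= r t.
    apply: lb_le_inf => [|s' [s'0 ts']].
      exists (Num.max 0 t + 1); split; first by rewrite addr_ge0// le_max lexx.
      rewrite (lt_le_trans _ (clock_ge _)) ?addr_ge0 ?le_max ?lexx//.
      by rewrite ltr_pwDr// le_max lexx orbT.
    rewrite leNgt; apply/negP => /(clock_lt s'0) /(lt_trans ts').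
    by rewrite ltNge (ltW Vs).
  by move/(lt_le_trans bs); rewrite ltNge rb.
apply/ler_addgt0Pr => e e0; apply: ge_inf; first by exists 0 => ? [].
split; first by rewrite addr_ge0// ltW.
by apply: le_lt_trans tb _; apply: clock_lt => //; rewrite ltrDl.
Unshelve. all: by end_near. Qed.

Lemma clock_inverseK s : 0 <= s -> r (V s) = s.
Proof.
move=> s0; apply/eqP; rewrite eq_le clock_inverse_le// lexx/= leNgt.
apply/negP => /(clock_lt (clock_inverse_ge0 _)); rewrite ltNge.
by rewrite -clock_inverse_le ?lexx// clock_inverse_ge0.
Qed.

(** The clock runs at least at unit speed, so its inverse runs at most at unit
    speed and turns the jumps of the clock into constancy intervals. *)
Lemma clock_inverse_lipschitz t t' : t <= t' -> r t <= r t' <= r t + (t' - t).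
Proof.
move=> tt'; have r0 := clock_inverse_ge0.
apply/andP; split.
  by rewrite clock_inverse_le// (le_trans tt')// -clock_inverse_le.
rewrite clock_inverse_le; last by rewrite addr_ge0// subr_ge0.
have {1}-> : t' = t + (t' - t) by lra.
apply: (@le_trans _ _ (V (r t) + (t' - t))).
  by rewrite lerD2r -clock_inverse_le.
have := @clock_increment (r t) (r t + (t' - t)) (r0 t).
rewrite (_ : r t + (t' - t) - r t = t' - t); last by lra.
by apply; lra.
Qed.

Lemma clock_inverse_continuous : continuous r.
Proof.
move=> t; apply/cvgrPdist_le => e e0.
exists e => //= t' /= tt'; apply: le_trans (ltW tt'); rewrite ler_norml.
have [/clock_inverse_lipschitz|/ltW/clock_inverse_lipschitz] := leP t t' => /andP[h1 h2].
  by rewrite ler0_norm ?subr_le0//; lra.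
by rewrite ger0_norm ?subr_ge0//; lra.
Qed.

Lemma clock_inverse_itv a b : 0 <= a -> 0 <= b ->
  r @^-1` `]a, b] = `]V a, V b]%classic.
Proof.
move=> a0 b0; apply/seteqP; split => t /=;
  by rewrite !in_itv/= clock_inverse_le// !ltNge clock_inverse_le.
Qed.

(** Where K is constant, the clock is a translation. *)
Lemma clock_inverse_flat_cell p q (B : set R) : 0 <= p ->
  (forall s, p <= s <= q -> K s = K p) -> B `<=` `]p, q] -> measurable B ->
  lebesgue_measure (r @^-1` B) = lebesgue_measure B.
Proof.
move=> p0 flat Bpq mB; rewrite -(lebesgue_measure_translation (K p) mB).
congr (lebesgue_measure _).
have rV s : p < s <= q -> r (s + K p) = s.
  move=> /andP[ps sq]; rewrite -(flat s) ?(ltW ps)// clock_inverseK//.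
  exact: le_trans (ltW ps).
apply/seteqP; split => t /= Bt; last first.
  have := Bpq _ Bt; rewrite /= in_itv/= => /rV; rewrite subrK => ->; exact: Bt.
have := Bpq _ Bt; rewrite /= in_itv/= => /andP[pt tq].
have q0 : 0 <= q by rewrite (le_trans p0)// (le_trans (ltW pt)).
have pq : p <= q by rewrite (le_trans (ltW pt)).
move: pt tq; rewrite ltNge !clock_inverse_le// -ltNge /clock (flat q) ?pq ?lexx// => pt tq.
have : r (t - K p + K p) = t - K p by apply: rV; lra.
by rewrite subrK => <-.
Qed.

Section occupation.
Variable D : R -> R.
Hypotheses (cD : continuous D)
  (flat : forall a b, 0 <= a -> a <= b -> (forall s, a <= s <= b -> 0 < D s) ->
     K a = K b).

(** {D > 0} is a countable union of rational cells on which the clock is a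
    translation; they are made disjoint before adding up. *)
Lemma clock_inverse_off_boundary (B : set R) : measurable B ->
  (forall s, B s -> 0 < s /\ 0 < D s) ->
  lebesgue_measure (r @^-1` B) = lebesgue_measure B.
Proof.
move=> mB BD.
pose good (p q : R) := 0 <= p /\ forall s, p <= s <= q -> 0 < D s.
pose cell (n : nat) : set R := if unpickle n is Some (p, q) then
  [set s | good (ratr p) (ratr q) /\ ratr p < s <= ratr q] else set0.
pose F n := B `&` cell n.
have mcell n : measurable (cell n).
  rewrite /cell; case: unpickle => // -[p q].
  apply: measurable_condition.
  rewrite (_ : (fun s => _) = `]ratr p, ratr q]%classic)//.
have mF n : measurable (F n) by exact: measurableI.
have BF : B = \bigcup_n (seqDU F n).
  rewrite -seqDU_bigcup_eq -setI_bigcupr; apply/seteqP; split => [s Bs|s []//].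
  split => //; have [s0 Ds] := BD _ Bs.
  have [e /= e0 eD] : \forall t \near s, 0 < D t := cD (lt_nbhsr Ds).
  have [|p] := @rat_in_itvoo R (Num.max 0 (s - e)) s.
    by rewrite gt_max s0/= ltrBlDr ltrDl.
  rewrite in_itv/= gt_max => /andP[/andP[p0 ep] ps].
  have [|q] := @rat_in_itvoo R s (s + e); first by rewrite ltrDl.
  rewrite in_itv/= => /andP[sq qe].
  exists (pickle (p, q)); [exact: I|rewrite /cell pickleK; split].
    split; first exact: ltW.
    by move=> t /andP[pt tq]; apply: eD; rewrite /= ltr_norml; lra.
  by rewrite ps ltW.
have Fcell n : seqDU F n `<=` cell n.
  by move=> s [[]].
have mr : measurable_fun setT r.
  exact: continuous_measurable_fun clock_inverse_continuous.
have mDU n : measurable (seqDU F n).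
  by apply: measurableD => //; exact: bigsetU_measurable.
rewrite BF preimage_bigcup !measure_bigcup//; last 3 first.
- by move=> n _; exact: mDU.
- by move=> n _; rewrite -[X in measurable X]setTI; exact: mr.
- by move=> i j _ _ [t [ti tj]]; apply: (@trivIset_seqDU _ F) => //; exists (r t).
apply: eq_eseriesr => n _.
move: (Fcell n) (mDU n); rewrite /cell.
case: unpickle => [[p q]|]; last first.
  by rewrite subset0 => ->; rewrite preimage_set0.
move=> h mn.
have [->|/set0P[s0 /h[[p0 gD] _]]] := eqVneq (seqDU F n) set0.
  by rewrite preimage_set0.
apply: (@clock_inverse_flat_cell (ratr p) (ratr q)) => //.
  move=> s /andP[ps sq]; apply/esym/flat => // t /andP[pt ts].
  by apply: gD; rewrite pt (le_trans ts).
by move=> s /h[_]; rewrite /= in_itv.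
Qed.

(** The clock runs at unit speed off the boundary, so during [S, T] the rest of
    its increment is spent on the boundary. *)
Lemma clock_boundary_occupation S T : 0 <= S -> S <= T ->
  lebesgue_measure [set s | 0 <= s /\ D s <= 0] = 0%E ->
  lebesgue_measure [set t | [/\ V S <= t, t <= V T & D (r t) <= 0]] =
  (K T - K S)%:E.
Proof.
move=> S0 ST nullD; have T0 := le_trans S0 ST.
have mD : measurable_fun setT D by exact: continuous_measurable_fun.
have mr : measurable_fun setT r.
  exact: continuous_measurable_fun clock_inverse_continuous.
have mDr : measurable_fun setT (D \o r) by exact: measurableT_comp.
pose P := `]S, T] `&` [set s | 0 < D s].
have mpos (f : R -> R) : measurable_fun setT f -> measurable [set s | 0 < f s].
  by move=> mf; rewrite -[X in measurable X]setTI; exact: measurable_fun_ltr.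
have mneg (f : R -> R) : measurable_fun setT f -> measurable [set s | f s <= 0].
  by move=> mf; rewrite -[X in measurable X]setTI; exact: measurable_fun_le.
have mP : measurable P by apply: measurableI => //; exact: mpos.
have LP : lebesgue_measure P = (T - S)%:E.
  have <- : lebesgue_measure (`]S, T]%classic : set R) = (T - S)%:E.
    rewrite lebesgue_measure_itv/= lte_fin; case: ltP => // TS.
    by rewrite (_ : T = S) ?subrr//; apply/eqP; rewrite eq_le TS.
  rewrite -(setIT `]S, T]%classic) -(setUv [set s | 0 < D s]) setIUr measureU//.
  - rewrite [X in (_ + X)%E](_ : _ = 0%E) ?adde0//.
    apply: (subset_measure0 _ _ _ nullD) => //.
    + by apply: measurableI => //; apply: measurableC; exact: mpos.
    + apply: measurableI; last exact: mneg.
      rewrite (_ : (fun s => _) = `[0, +oo[%classic)//.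
      by apply/funext => s; rewrite /= in_itv/= andbT.
    + move=> s [] /=; rewrite in_itv/= => /andP[Ss _] /negP; rewrite -leNgt.
      by split => //; rewrite (le_trans S0)// ltW.
  - by apply: measurableI => //; apply: measurableC; exact: mpos.
  - by rewrite -setIIr setICr setI0.
have LrP : lebesgue_measure (r @^-1` P) = (T - S)%:E.
  rewrite clock_inverse_off_boundary// => s [] /=; rewrite in_itv/= => /andP[Ss _].
  by split => //; exact: le_lt_trans Ss.
have VST : V S <= V T by move: (clock_increment S0 ST); lra.
have LW : lebesgue_measure (`[V S, V T]%classic : set R) = (V T - V S)%:E.
  rewrite lebesgue_measure_itv/= lte_fin; case: ltP => // TS.
  by rewrite (_ : V T = V S) ?subrr//; apply/eqP; rewrite eq_le TS.
have mrP : measurable (r @^-1` P) by rewrite -[X in measurable X]setTI; exact: mr.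
have rPW : r @^-1` P `<=` `[V S, V T].
  rewrite preimage_setI clock_inverse_itv// => t [+ _] /=.
  by rewrite !in_itv/= => /andP[/ltW VSt tVT]; rewrite VSt.
transitivity (lebesgue_measure (`[V S, V T] `\` r @^-1` P)); last first.
  rewrite measureD//; last by rewrite [ltLHS]LW ltry.
  rewrite setIidr// [X in (X - _)%E]LW [X in (_ - X)%E]LrP -EFinB.
  by congr _%:E; rewrite /clock; lra.
set A := mkset _; set A' := _ `\` _.
have mA : measurable A.
  rewrite (_ : A = `[V S, V T] `&` [set t | D (r t) <= 0]).
    by apply: measurableI => //; exact: mneg.
  apply/seteqP; split => t /=; rewrite in_itv/=; first by case=> -> ->.
  by case=> /andP[].
have mA' : measurable A' by exact: measurableD.
have AA' : A `<=` A'.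
  move=> t [St tT Dt]; split; first by rewrite /= in_itv/= St.
  by case=> _ /=; rewrite ltNge Dt.
have A'A : A' `\` A `<=` [set V S].
  move=> t [[/=]]; rewrite in_itv/= => /andP[St tT] nP nA /=.
  apply/eqP; rewrite eq_le St andbT leNgt; apply/negP => Slt; apply: nP.
  split; first by rewrite -[_ (r t)]/((r @^-1` `]S, T]) t) clock_inverse_itv//= in_itv/= Slt.
  by rewrite /= ltNge; apply/negP => Dt; exact: nA.
rewrite -(setDKU AA') measureU//; last 2 first.
- by apply: measurableD.
- by rewrite setDKI.
rewrite [X in (X + _)%E](_ : _ = 0%E) ?add0e//.
have nullVS : lebesgue_measure [set V S] = 0%E by exact: lebesgue_measure_set1.
apply: (@subset_measure0 _ _ _ lebesgue_measure _ [set V S]) => //.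
exact: measurableD.
Qed.

End occupation.

End clock.

(** * Local time as a limit of occupation times *)

Definition occupation {R : realType} (E : R -> R) (delta t : R) : \bar R :=
  lebesgue_measure
    [set s : R | [/\ (0%:E <= s%:E)%E, (s%:E <= t%:E)%E & E s - delta <= 0]].

Section local_time.
Context {R : realType}.
Variables (E g : R -> R).
Hypotheses (cE : continuous E)
  (gE : forall t, 0 <= t ->
    delta^-1 * fine (occupation E delta t) @[delta --> 0^'+] --> g t).

Lemma occupation_set_measurable (delta t : R) : measurable
  [set s : R | [/\ (0%:E <= s%:E)%E, (s%:E <= t%:E)%E & E s - delta <= 0]].
Proof.
rewrite (_ : mkset _ = `[0, t] `&` [set s | E s <= delta]).
  apply: measurableI => //; rewrite -[X in measurable X]setTI.
  by apply: measurable_fun_le => //; exact: continuous_measurable_fun.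
apply/seteqP; split => s /=; rewrite in_itv/= !lee_fin subr_le0.
  by move=> [-> ->].
by move=> [/andP[-> ->]].
Qed.

Lemma occupation_fin (delta t : R) : occupation E delta t \is a fin_num.
Proof.
rewrite ge0_fin_numE//.
apply: (@le_lt_trans _ _ (lebesgue_measure (`[0, t]%classic : set R))).
  rewrite le_measure ?inE//; first exact: occupation_set_measurable.
  by move=> s [/=]; rewrite in_itv/= !lee_fin => -> ->.
by rewrite lebesgue_measure_itv/=; case: ifP => _; rewrite ltry.
Qed.

(** The difference quotients converge to a finite limit, so the occupation time
    of a collar of width delta is of order delta. *)
Lemma null_boundary_occupation :
  lebesgue_measure [set s | 0 <= s /\ E s <= 0] = 0%E.
Proof.
have mA := occupation_set_measurable 0.
have null t : 0 <= t -> occupation E 0 t = 0%E.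
  move=> t0; apply/eqP; rewrite eq_le measure_ge0 andbT.
  have hd : delta * (delta^-1 * fine (occupation E delta t)) @[delta --> 0^'+] --> (0 : R).
    have id0 : delta @[delta --> 0^'+] --> (0 : R).
      by apply: cvg_at_right_filter; exact: cvg_id.
    by have := cvgM id0 (gE t0); rewrite mul0r; apply.
  rewrite -(fineK (occupation_fin 0 t)) lee_fin.
  apply: (cvgr_to_ge hd); near=> delta.
  have delta0 : 0 < delta by near: delta; exact: nbhs_right_gt.
  rewrite mulVKf ?gt_eqF// fine_le ?occupation_fin//.
  rewrite le_measure ?inE//; [exact: mA|exact: occupation_set_measurable|].
  by move=> s [? ?]; rewrite subr0 => Es; split => //; lra.
rewrite (_ : mkset _ = \bigcup_n [set s : R | [/\ (0%:E <= s%:E)%E, (s%:E <= n%:R%:E)%E & E s - 0 <= 0]]).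
  apply/negligibleP; first by apply: bigcupT_measurable => n; exact: mA.
  apply: negligible_bigcup => n; apply/negligibleP; first exact: mA.
  exact: null.
apply/seteqP; split => [s /= [s0 Es]|s [n _ /= []]].
  exists (Num.truncn s).+1 => //=; rewrite !lee_fin subr0; split => //.
  by rewrite ltW// truncnS_gt.
by rewrite !lee_fin subr0.
Unshelve. all: by end_near. Qed.

(** Off the boundary the occupation times of thin collars do not grow. *)
Lemma local_time_flat_closed a b : 0 <= a -> a <= b ->
  (forall s, a <= s <= b -> 0 < E s) -> g a = g b.
Proof.
move=> a0 ab Epos.
have [c cab cmin] := EVT_min ab (continuous_subspaceT cE).
have Ec : 0 < E c by apply: Epos; move: cab; rewrite in_itv.
have ga := gE a0; have gb := gE (le_trans a0 ab).
suff : delta^-1 * fine (occupation E delta a) @[delta --> 0^'+] --> g b.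
  exact: cvg_unique ga.
apply: cvg_trans gb; apply: near_eq_cvg; near=> delta.
have dc : delta < E c by near: delta; exact: nbhs_right_lt.
congr (_ * fine (lebesgue_measure _)); apply/seteqP; split => s /= [s0].
  move=> sb Es; split => //; rewrite leNgt; apply/negP; rewrite lte_fin => as_.
  move: Es; rewrite subr_le0 leNgt (lt_le_trans dc)// cmin// in_itv/=.
  by rewrite (ltW as_); rewrite lee_fin in sb.
by move=> sa Es; split => //; rewrite (le_trans sa)// lee_fin.
Unshelve. all: by end_near. Qed.

(** By continuity of g the path may be on the boundary at the time b itself, as
    it is when b is a return time. *)
Lemma local_time_flat a b : {within `[0, +oo[, continuous g} ->
  0 <= a -> a <= b -> (forall s, a <= s -> s < b -> 0 < E s) -> g a = g b.
Proof.
move=> /continuous_frozen cg a0; rewrite le_eqVlt => /predU1P[->//|ab Epos].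
have gb : g (Num.max 0 s) @[s --> b^'-] --> g b.
  rewrite -[in X in _ --> X](@max_r _ _ 0 b) ?(le_trans a0) ?ltW//.
  by apply: cvg_at_left_filter; exact: cg.
apply: cvg_unique gb => //; apply: cvg_near_cst; near=> s.
have as_ : a <= s by near: s; exact: nbhs_left_ge.
rewrite max_r ?(le_trans a0)//; apply/esym/local_time_flat_closed => //.
move=> t /andP[at_ ts]; apply: Epos => //; rewrite (le_lt_trans ts)//.
Unshelve. all: by end_near. Qed.

End local_time.

(** * Visits of the time-changed path *)

Section hitting_after_time_change.
Context {R : realType} {d : nat}.
Implicit Types (y : R -> 'rV[R]_d) (A : set 'rV[R]_d).

Lemma hit_after_attained y A (E : R -> R) (u : R) :
  continuous E -> (forall t, 0 <= t -> A (y t) <-> E t <= 0) ->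
  0 <= u -> ~ A (y u) -> (hit_after y u%:E A < +oo)%E ->
  exists T, [/\ hit_after y u%:E A = T%:E, u < T, A (y T)
    & forall s, u < s -> s < T -> ~ A (y s)].
Proof.
move=> cE AE u0 nAu hfin.
have uh := hit_after_ge y u%:E A.
have [T hT] : exists T, hit_after y u%:E A = T%:E.
  by move: hfin uh; case: hit_after => // T _ _; exists T.
rewrite hT lee_fin in uh; have T0 := le_trans u0 uh.
have no s : u < s -> s < T -> ~ A (y s).
  move=> us sT As; have : (hit_after y u%:E A < T%:E)%E.
    by apply/hit_after_lt; exists s; rewrite !lte_fin; split => //; lra.
  by rewrite hT ltxx.
have AT : A (y T).
  apply/AE => //; rewrite leNgt; apply/negP => ET.
  have [e /= e0 eE] : \forall t \near T, 0 < E t := cE _ _ (lt_nbhsr ET).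
  have : (hit_after y u%:E A < (T + e)%:E)%E by rewrite hT lte_fin ltrDl.
  move=> /hit_after_lt[t [t0]]; rewrite !lte_fin => ut At tT.
  have Tt : T <= t by rewrite leNgt; apply/negP => /(no _ ut).
  have : 0 < E t by apply: eE; rewrite /= ltr_norml; lra.
  by rewrite ltNge; apply/negP/negPn/AE.
exists T; split => //; rewrite lt_neqAle uh andbT.
by apply/eqP => uT; apply: nAu; rewrite uT.
Qed.

Section path.
Variable K : R -> R.
Hypotheses (K0 : K 0 = 0)
  (Kmono : forall s t, 0 <= s -> s <= t -> K s <= K t)
  (Krc : forall t, 0 <= t -> K s @[s --> t^'+] --> K t).

Local Notation V := (clock K).
Local Notation r := (right_inverse (clock K)).

(** The clock may jump while the path is on the boundary; it is continuous at a
    hitting time T because K is constant just before T. *)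
Lemma hit_after_time_change y A (u T a : R) :
  0 <= u -> u < T -> 0 <= a -> a < T -> (forall s, a <= s <= T -> K s = K T) ->
  ~ A (y u) -> A (y T) -> (forall s, u < s -> s < T -> ~ A (y s)) ->
  hit_after (y \o r) (V u)%:E A = (V T)%:E.
Proof.
move=> u0 uT a0 aT flat nAu AT no; have T0 := ltW (le_lt_trans u0 uT).
apply/eqP; rewrite eq_le; apply/andP; split.
  apply: ereal_inf_lbound; exists (V T) => //; split => /=.
  - by rewrite (le_trans T0)// (clock_ge K0 Kmono).
  - by rewrite lte_fin (clock_lt Kmono).
  - by rewrite (clock_inverseK K0 Kmono Krc).
apply: le_ereal_inf_tmp => _ [t [t0 ut /= At] <-]; rewrite lee_fin.
rewrite lte_fin in ut.
have ur : u <= r t.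
  rewrite leNgt; apply/negP => /ltW.
  by rewrite (clock_inverse_le K0 Kmono Krc)// leNgt ut.
have {}ur : u < r t.
  by rewrite lt_neqAle ur andbT; apply/eqP => ur'; apply: nAu; rewrite ur'.
have Tr : T <= r t by rewrite leNgt; apply/negP => /(no _ ur).
rewrite leNgt; apply/negP => tVT.
have sT : Num.max a (T - (V T - t) / 2) < T by rewrite gt_max aT/=; lra.
have : r t <= Num.max a (T - (V T - t) / 2).
  rewrite (clock_inverse_le K0 Kmono Krc) ?le_max ?a0// /clock.
  rewrite (flat (Num.max _ _)); last by rewrite le_max lexx/= ltW.
  have : T - (V T - t) / 2 <= Num.max a (T - (V T - t) / 2).
    by rewrite le_max lexx orbT.
  have -> : V T = T + K T by [].
  by rewrite /clock in tVT *; lra.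
by rewrite leNgt (lt_le_trans sT).
Qed.

Variables (Omega : set 'rV[R]_d) (eps : R) (y : R -> 'rV[R]_d) (D : R -> R).
Hypotheses (eps0 : 0 < eps) (cD : continuous D) (D0 : D 0 <= 0)
  (D_collar : forall t, 0 <= t -> (~` collar Omega eps) (y t) <-> eps <= D t)
  (D_Omega : forall t, 0 <= t -> (~` Omega) (y t) <-> D t <= 0)
  (D_bdry : forall t, 0 <= t -> bdry Omega (y t) <-> D t <= 0)
  (finite : forall i, (visit_start Omega eps y i < +oo)%E)
  (flat : forall a b, 0 <= a -> a <= b ->
     (forall s, a <= s -> s < b -> 0 < D s) -> K a = K b).

(** One step of the recursion over the visits, common to the exits from the
    collar and to the returns to the boundary: the last hypothesis says that the
    path is off the boundary just before it hits A. *)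
Lemma visit_step A (E : R -> R) (u : R) : continuous E ->
  (forall t, 0 <= t -> A (y t) <-> E t <= 0) -> 0 <= u -> ~ A (y u) ->
  (hit_after y u%:E A < +oo)%E ->
  (forall T, u < T -> A (y T) -> (forall s, u < s -> s < T -> ~ A (y s)) ->
    exists2 a, a < T & forall s, u < s -> a < s -> s < T -> 0 < D s) ->
  exists T, [/\ hit_after y u%:E A = T%:E,
    hit_after (y \o r) (V u)%:E A = (V T)%:E, u <= T & A (y T)].
Proof.
move=> cE AE u0 nAu hfin before.
have [T [hT uT AT no]] := hit_after_attained cE AE u0 nAu hfin.
have T0 := ltW (le_lt_trans u0 uT).
exists T; split => //; last exact: ltW.
have [a aT Dpos] := before _ uT AT no.
pose b := (Num.max u a + T) / 2.
have [ub bT ab] : [/\ u < b, b < T & a < b].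
  have h : Num.max u a < T by rewrite gt_max uT.
  have : u <= Num.max u a /\ a <= Num.max u a by rewrite !le_max !lexx orbT.
  by rewrite /b; case=> ? ?; split; lra.
apply: (@hit_after_time_change _ _ _ _ b) => //; first by lra.
move=> s /andP[bs sT]; apply: flat => //; first lra.
by move=> t st tT; apply: Dpos => //; lra.
Qed.

(** While the path travels from the exit of the collar back to the boundary,
    and just before it exits the collar, it is inside, where K is constant. *)
Lemma visits_time_change i : exists S T,
  [/\ visit_start Omega eps y i = S%:E, visit_end Omega eps y i = T%:E,
    visit_start Omega eps (y \o r) i = (V S)%:E &
    visit_end Omega eps (y \o r) i = (V T)%:E] /\
  [/\ 0 <= S, S <= T, D S <= 0 & eps <= D T].
Proof.
have finite_end j : (visit_end Omega eps y j < +oo)%E.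
  exact: le_lt_trans (visit_end_start _ _ _ _) (finite j.+1).
have exit j S : visit_start Omega eps y j = S%:E ->
    visit_start Omega eps (y \o r) j = (V S)%:E -> 0 <= S -> D S <= 0 ->
    exists T, [/\ visit_end Omega eps y j = T%:E,
      visit_end Omega eps (y \o r) j = (V T)%:E, S <= T & eps <= D T].
  move=> yS zS S0 DS.
  have before T : S < T -> (~` collar Omega eps) (y T) ->
      exists2 a, a < T & forall s, S < s -> a < s -> s < T -> 0 < D s.
    move=> ST /(D_collar (ltW (le_lt_trans S0 ST))) DT.
    have [e /= e0 eD] : \forall t \near T, 0 < D t.
      exact: (cD (lt_nbhsr (lt_le_trans eps0 DT))).
    exists (T - e); first by rewrite ltrBlDr ltrDl.
    by move=> s _ es sT; apply: eD; rewrite /= ltr_norml; lra.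
  have [||||T [hT zT ST AT]] := @visit_step (~` collar Omega eps)
      (fun t => eps - D t) S _ _ S0 _ _ (fun T ST AT _ => before T ST AT).
  - by move=> t; apply: cvgB; [exact: cvg_cst|exact: cD].
  - by move=> t t0; rewrite subr_le0; exact: D_collar.
  - by move=> /(D_collar S0); rewrite leNgt (le_lt_trans DS).
  - by rewrite -yS; exact: finite_end.
  - exists T.
    rewrite /visit_end yS zS hT zT; split => //.
    by apply/D_collar => //; exact: le_trans ST.
have start j T : visit_end Omega eps y j = T%:E ->
    visit_end Omega eps (y \o r) j = (V T)%:E -> 0 <= T -> eps <= D T ->
    exists S, [/\ visit_start Omega eps y j.+1 = S%:E,
      visit_start Omega eps (y \o r) j.+1 = (V S)%:E, T <= S & D S <= 0].
  move=> yT zT T0 DT.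
  have [||||S [hS zS TS AS]] := @visit_step (~` Omega) D T cD D_Omega.
  - exact: T0.
  - by move=> /(D_Omega T0); rewrite leNgt (lt_le_trans eps0).
  - by rewrite -yT; exact: (finite j.+1).
  - move=> S TS _ no; exists T => // s Ts _ sS.
    by rewrite ltNge; apply/negP => Ds; apply: (no s Ts sS); apply/D_Omega => //; lra.
  - exists S.
    rewrite /= -!/(visit_end _ _ _ _) yT zT hS zS; split => //.
    by apply/D_Omega => //; exact: le_trans TS.
elim: i => [|i [S [T [[_ yT _ zT] [S0 ST _ DT]]]]].
  have V0 : V 0 = 0 by rewrite /clock K0 addr0.
  have [|T [yT zT T0 DT]] := @exit 0%N 0 erefl _ (lexx 0) D0.
    by rewrite /= V0.
  by exists 0, T; rewrite V0.
have [S' [yS' zS' TS' DS']] := start _ _ yT zT (le_trans S0 ST) DT.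
have S'0 : 0 <= S' by rewrite (le_trans _ TS')// (le_trans S0).
have [T' [yT' zT' ST' DT']] := exit _ _ yS' zS' S'0 DS'.
by exists S', T'.
Qed.

Lemma boundary_time_time_change i :
  lebesgue_measure [set s | 0 <= s /\ D s <= 0] = 0%E ->
  boundary_time Omega eps (y \o r) i =
  (K (fine (visit_end Omega eps y i)) - K (fine (visit_start Omega eps y i)))%:E.
Proof.
move=> null; have [S [T [[-> -> VS VT] [S0 ST _ _]]]] := visits_time_change i.
have flat_closed a b : 0 <= a -> a <= b ->
    (forall s, a <= s <= b -> 0 < D s) -> K a = K b.
  move=> a0 ab Dpos; apply: flat => // s as_ sb.
  by apply: Dpos; rewrite as_ ltW.
rewrite /boundary_time VS VT -(clock_boundary_occupation K0 Kmono Krc cD flat_closed S0 ST null).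
congr (lebesgue_measure _); have r0 := clock_inverse_ge0 K0 Kmono.
by apply/seteqP; split => t /= [+ + /(D_bdry (r0 t))]; rewrite !lee_fin.
Qed.

End path.

End hitting_after_time_change.

(** * Independence *)

Section product_law.
Context {R : realType} {disp d1 d2 : measure_display} {T : measurableType disp}
  {T1 : measurableType d1} {T2 : measurableType d2}.
Variable Q : probability T R.

(** The law of an independent pair is the product of the marginal laws. *)
Lemma integral_independent_pair (U : T -> T1) (W : T -> T2)
    (f : T1 * T2 -> \bar R) :
  measurable_fun setT U -> measurable_fun setT W ->
  (forall A B, measurable A -> measurable B ->
     Q (U @^-1` A `&` W @^-1` B) = (Q (U @^-1` A) * Q (W @^-1` B))%E) ->
  measurable_fun setT f -> (forall p, (0 <= f p)%E) ->
  (\int[Q]_w f (U w, W w) = \int[Q]_w \int[Q]_w' f (U w, W w'))%E.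
Proof.
move=> mU mW indep mf f0.
have mUW : measurable_fun setT (fun w => (U w, W w)) by exact: measurable_fun_pair.
pose U' : {mfun T >-> T1} := HB.pack U (isMeasurableFun.Build _ _ _ _ _ mU).
pose W' : {mfun T >-> T2} := HB.pack W (isMeasurableFun.Build _ _ _ _ _ mW).
pose UW' : {mfun T >-> (T1 * T2)%type} :=
  HB.pack (fun w => (U w, W w)) (isMeasurableFun.Build _ _ _ _ _ mUW).
transitivity (\int[distribution Q UW']_p f p)%E.
  by rewrite ge0_integral_distribution.
transitivity (\int[distribution Q U' \x distribution Q W']_p f p)%E.
  apply: eq_measure_integral => A mA _; apply/esym.
  by apply: product_measure_unique => // B C mB mC; exact: indep.
rewrite fubini_tonelli1// ge0_integral_distribution//; first last.
- by move=> u; apply: integral_ge0.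
- exact: measurable_fun_fubini_tonelli_F.
apply: eq_integral => w _ /=; rewrite /fubini_F ge0_integral_distribution//.
exact: measurableT_comp.
Qed.

(** Layer-cake: a nonnegative number is the integral of the indicator of the
    levels below it. *)
Lemma layer_cake (r : \bar R) : (0 <= r)%E ->
  (\int[lebesgue_measure]_t (\1_[set t : R | 0 <= t /\ (t%:E < r)%E] t)%:E = r)%E.
Proof.
case: r => [r| |//] r0.
  have -> : [set t : R | 0 <= t /\ (t%:E < r%:E)%E] = `[0, r[%classic.
    by apply/seteqP; split => t /=; rewrite in_itv/= lte_fin => /andP.
  transitivity (lebesgue_measure (`[0, r[%classic : set R)).
    by rewrite integral_indic// setIT.
  rewrite lebesgue_measure_itv/= lte_fin sube0.
  case: ltP => // r0'; congr _%:E; apply/eqP; rewrite eq_le r0'.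
  by rewrite andbT -lee_fin.
have -> : [set t : R | 0 <= t /\ (t%:E < +oo)%E] = `[0, +oo[%classic.
  apply/seteqP; split => t /=; rewrite in_itv/= andbT ltry; first by case.
  by [].
transitivity (lebesgue_measure (`[0, +oo[%classic : set R)).
  by rewrite integral_indic// setIT.
by rewrite lebesgue_measure_itv/= ltry.
Qed.

(** One step of the replacement of indicators by functions in a product of
    independent factors: by the layer-cake formula it suffices to know the
    weighted law of Y. *)
Lemma integral_weighted_law (W : T -> \bar R) (c : \bar R) (Y : T -> T1)
    (f : T1 -> \bar R) :
  measurable_fun setT W -> (forall w, (0 <= W w)%E) -> (0 <= c)%E ->
  measurable_fun setT Y ->
  (forall A, measurable A ->
     \int[Q]_w (W w * (\1_A (Y w))%:E) = c * Q (Y @^-1` A))%E ->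
  measurable_fun setT f -> (forall y, (0 <= f y)%E) ->
  (\int[Q]_w (W w * f (Y w)) = c * \int[Q]_w f (Y w))%E.
Proof.
move=> mW W0 c0 mY law mf f0.
pose S := [set p : T * measurableTypeR R | 0 <= p.2 /\ (p.2%:E < f (Y p.1))%E].
have msnd : measurable_fun setT (fun p : T * measurableTypeR R => p.2%:E).
  by apply/measurable_EFinP; exact: measurable_snd.
have mS : measurable S.
  rewrite (_ : S = [set p : T * measurableTypeR R | (0 <= p.2%:E)%E] `&`
    [set p | (p.2%:E < f (Y p.1))%E])//.
  apply: measurableI; first exact: measurable_sublevel.
  apply: measurable_strict_sublevel => //.
  apply: (measurableT_comp mf); apply: (measurableT_comp mY).
  exact: measurable_fst.
have mS1 : measurable_fun setT (fun p => (\1_S p : R)%:E).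
  by apply/measurable_EFinP; exact: measurable_indic.
have fE w : f (Y w) = (\int[lebesgue_measure]_t (\1_S (w, t))%:E)%E.
  by rewrite -[LHS]layer_cake.
have lawS t : (\int[Q]_w (W w * (\1_S (w, t))%:E) =
    c * \int[Q]_w (\1_S (w, t))%:E)%E.
  pose A := [set y | 0 <= t /\ (t%:E < f y)%E].
  have mA : measurable A.
    by apply: measurable_condition; exact: measurable_strict_sublevel.
  have mYA : measurable (Y @^-1` A) by rewrite -[X in measurable X]setTI; exact: mY.
  rewrite [RHS](_ : _ = c * Q (Y @^-1` A))%E; first exact: law.
  by congr (c * _)%E; rewrite -[X in Q X]setIT -integral_indic.
transitivity (\int[Q]_w \int[lebesgue_measure]_t (W w * (\1_S (w, t))%:E))%E.
  apply: eq_integral => w _; rewrite fE ge0_integralZl//.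
  exact: (measurable_fun_pair2 w mS1).
rewrite (fubini_tonelli (fun p => W p.1 * (\1_S p)%:E)%E); first last.
- by move=> p; rewrite mule_ge0// lee_fin.
- apply: emeasurable_funM => //.
  by apply: (measurableT_comp mW); exact: measurable_fst.
transitivity (\int[lebesgue_measure]_t (c * \int[Q]_w (\1_S (w, t))%:E))%E.
  by apply: eq_integral => t _; exact: lawS.
rewrite ge0_integralZl//; first last.
- by move=> t _; apply: integral_ge0 => w _; rewrite lee_fin.
- apply: (@measurable_fun_fubini_tonelli_G _ _ _ _ _ Q (fun p => (\1_S p)%:E)) => //.
congr (c * _)%E.
rewrite -(fubini_tonelli (fun p => (\1_S p)%:E))//.
by apply: eq_integral => w _; rewrite fE.
Qed.

End product_law.

Section product_expectation.
Context {R : realType} {disp : measure_display} {T : measurableType disp}.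
Variables (Q : probability T R) (Y : nat -> T -> \bar R).
Hypothesis indY : independent_seq Q Y.

Lemma emeasurable_prod (I : Type) (s : seq I) (p : pred I)
    (h : I -> T -> \bar R) :
  (forall i, measurable_fun setT (h i)) ->
  measurable_fun setT (fun w => \prod_(i <- s | p i) h i w)%E.
Proof.
move=> mh; elim: s => [|i s ih].
  by under eq_fun do rewrite big_nil; exact: measurable_cst.
case pi: (p i); under eq_fun do rewrite big_cons pi; last exact: ih.
by apply: emeasurable_funM.
Qed.

(** The indicators in the definition of independence are replaced by general
    functions one index after the other. *)
Lemma independent_expectation n (f : nat -> \bar R -> \bar R) :
  (forall i, measurable_fun setT (f i)) -> (forall i y, (0 <= f i y)%E) ->
  (\int[Q]_w \prod_(i < n) f i (Y i w) = \prod_(i < n) \int[Q]_w f i (Y i w))%E.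
Proof.
have [mY indep] := indY.
suff h m (g : nat -> \bar R -> \bar R) :
    (forall i, measurable_fun setT (g i)) -> (forall i y, (0 <= g i y)%E) ->
    (forall i, (m <= i)%N ->
      exists2 A, measurable A & g i = EFin \o (\1_A : _ -> R)) ->
    (\int[Q]_w \prod_(i < n) g i (Y i w) = \prod_(i < n) \int[Q]_w g i (Y i w))%E.
  move=> mf f0; pose g i := if (i < n)%N then f i else EFin \o \1_setT.
  have := h n g; rewrite (eq_bigr (fun i : 'I_n => \int[Q]_w f i (Y i w))%E); last first.
    by move=> i _; rewrite /g ltn_ord.
  move=> <-.
  - by apply: eq_integral => w _; apply: eq_bigr => i _; rewrite /g ltn_ord.
  - move=> i; rewrite /g; case: ifP => // _.
    by apply/measurable_EFinP; exact: measurable_indic.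
  - by move=> i y; rewrite /g; case: ifP => // _; rewrite lee_fin.
  - by move=> i ni; exists setT => //; rewrite /g ltnNge ni.
have mgY (h : nat -> \bar R -> \bar R) i : measurable_fun setT (h i) ->
    measurable_fun setT (fun w => h i (Y i w)).
  by move=> mg; apply: (measurableT_comp mg); exact: mY.
elim: m g => [g mg g0 ind|m ih g mg g0 ind].
  have /choice[A hA] : forall i, exists A, measurable A /\ g i = EFin \o \1_A.
    by move=> i; have [A mA ->] := ind i isT; exists A.
  have mA i := (hA i).1.
  have mYA i : measurable (Y i @^-1` A i).
    by rewrite -[X in measurable X]setTI; exact: mY.
  rewrite [RHS](_ : _ = \prod_(i < n) Q (Y i @^-1` A i))%E; last first.
    apply: eq_bigr => i _; rewrite -[X in Q X]setIT -integral_indic//.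
    by apply: eq_integral => w _; rewrite (hA i).2.
  rewrite -indep// -[X in Q X]setIT -integral_indic//; last first.
    by apply: bigcap_measurableType => // i _; exact: mYA.
  apply: eq_integral => w _.
  have [h|/existsNP[i /not_implyP[ni nA]]] :=
      pselect (forall i, `I_n i -> A i (Y i w)).
    rewrite big1 => [|i _]; last first.
      by rewrite (hA i).2 /= indicE mem_set//; apply: h => /=.
    by rewrite indicE mem_set.
  rewrite (bigD1 (Ordinal ni))//= (hA i).2 /= indicE memNset// mul0e.
  by rewrite indicE memNset// => /(_ i ni).
pose gA (A : set (\bar R)) i := if i == m then EFin \o \1_A else g i.
have gAih A : measurable A -> (\int[Q]_w \prod_(i < n) gA A i (Y i w) =
    \prod_(i < n) \int[Q]_w gA A i (Y i w))%E.
  move=> mA; apply: ih.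
  - move=> i; rewrite /gA; case: ifP => // _.
    by apply/measurable_EFinP; exact: measurable_indic.
  - by move=> i y; rewrite /gA; case: ifP => // _; rewrite lee_fin.
  - move=> i mi; rewrite /gA; case: eqP => [_|/eqP im]; first by exists A.
    by apply: ind; rewrite ltn_neqAle eq_sym im.
have [nm|mn] := leqP n m.
  have gE (i : 'I_n) : gA setT i = g i by rewrite /gA ltn_eqF// (leq_trans _ nm).
  have := gAih _ measurableT.
  under eq_integral do under eq_bigr do rewrite gE.
  by under [in RHS]eq_bigr do rewrite gE.
pose k := Ordinal mn.
rewrite (bigD1 k)//=.
under eq_integral do rewrite (bigD1 k)//= muleC.
rewrite muleC.
have mW : measurable_fun setT (fun w => \prod_(i < n | i != k) g i (Y i w))%E.
  by apply: emeasurable_prod => i; exact: mgY.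
have W0 w : (0 <= \prod_(i < n | i != k) g i (Y i w))%E.
  by apply: prode_ge0 => i _.
have c0 : (0 <= \prod_(i < n | i != k) \int[Q]_w g i (Y i w))%E.
  by apply: prode_ge0 => i _; exact: integral_ge0.
apply: (integral_weighted_law mW W0 c0 (mY m) _ (mg m) (g0 m)).
move=> A mA.
have gE (i : 'I_n) : i != k -> gA A i = g i.
  by move=> ik; rewrite /gA; case: eqP => // im; move: ik; rewrite -val_eqE/= im eqxx.
have gAm : gA A m = EFin \o \1_A by rewrite /gA eqxx.
transitivity (\int[Q]_w \prod_(i < n) gA A i (Y i w))%E.
  apply: eq_integral => w _; rewrite [RHS](bigD1 k)//= muleC gAm; congr (_ * _)%E.
  by apply: eq_bigr => i ik; rewrite gE.
rewrite gAih// (bigD1 k)//= muleC; congr (_ * _)%E.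
  by apply: eq_bigr => i ik; rewrite gE.
rewrite gAm -[X in Q X]setIT -integral_indic//.
by rewrite -[X in measurable X]setTI; exact: mY.
Qed.

End product_expectation.

(** * The subordinator at independent times *)

Section cylinders.
Context {R : realType} {disp : measure_display} {T : measurableType disp}.

Definition process_cylinders {I : Type} (D : set I) (Y : I -> T -> R)
  : set (set T) :=
  [set A | exists2 i, D i & exists2 B : set R, measurable B & A = Y i @^-1` B].

(** The underlying type is T itself; the identity of T thus plays the role of the
    map sending a sample point to the path of the process. *)
Definition process_space {I : Type} (D : set I) (Y : I -> T -> R)
  : measurableType _ := g_sigma_algebraType (process_cylinders D Y).

Lemma measurable_coordinate {I : Type} (D : set I) (Y : I -> T -> R) i : D i ->
  measurable_fun setT (Y i : process_space D Y -> R).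
Proof.
by move=> Di _ B mB; rewrite setTI; apply: sub_sigma_algebra; exists i => //; exists B.
Qed.

Lemma measurable_process_id {I : Type} (D : set I) (Y : I -> T -> R) :
  (forall i, D i -> measurable_fun setT (Y i)) ->
  measurable_fun setT (id : T -> process_space D Y).
Proof.
move=> mY; apply: (@measurability _ _ T (process_space D Y) setT id
  (process_cylinders D Y) erefl) => _ [_ [i Di [B mB ->]] <-].
by rewrite setTI -[X in measurable X]setTI; exact: mY.
Qed.

End cylinders.

Section subordinator.
Context {R : realType} {disp : measure_display} {T : measurableType disp}.
Variables (alpha : R) (H : R -> T -> R) (Q : probability T R).
Hypothesis sH : stable_subordinator alpha H Q.

Definition subordinator_law (B : set R) (t : R) : R :=
  fine (Q [set w | B (H (Num.max 0 t) w)]).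

Local Notation TH := (process_space [set u : R | 0 <= u] H).

(** Joint measurability is needed for the sigma-algebra generated by H alone,
    the one that is independent of the path of X. *)
Lemma subordinator_jointly_measurable :
  measurable_fun setT (fun p : measurableTypeR R * TH => H (Num.max 0 p.1) p.2).
Proof.
apply: (@right_continuous_jointly_measurable R _ TH (fun t w => H (Num.max 0 t) w)).
  move=> t; apply: measurable_coordinate.
  by rewrite /= le_max lexx.
move=> w t /=; have [t0|t0] := leP 0 t.
  have := subordinator_right_continuous sH (w := w) t0.
  apply: cvg_trans; apply: near_eq_cvg; near=> s.
  by rewrite max_r// (le_trans t0)//; near: s; exact: nbhs_right_ge.
apply: cvg_near_cst; near=> s; rewrite max_l//.
by near: s; exact: nbhs_right_ltW.
Unshelve. all: by end_near. Qed.

Lemma measurable_subordinator t : 0 <= t -> measurable_fun setT (H t).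
Proof. exact: (subordinator_measurable sH). Qed.

Lemma subordinator_jointly_measurableT :
  measurable_fun setT (fun p : measurableTypeR R * T => H (Num.max 0 p.1) p.2).
Proof.
apply: (measurableT_comp (f := fun p : measurableTypeR R * TH => H (Num.max 0 p.1) p.2)
  (g := fun p : measurableTypeR R * T => (p.1, (id p.2 : TH)))).
  exact: subordinator_jointly_measurable.
apply: measurable_fun_pair; first exact: measurable_fst.
apply: (measurableT_comp (f := id : T -> TH)); last exact: measurable_snd.
by apply: measurable_process_id => t; exact: measurable_subordinator.
Qed.

Lemma measurable_subordinator_law B : measurable B ->
  measurable_fun setT (subordinator_law B).
Proof.
move=> mB; have mA : measurable [set p : measurableTypeR R * T | B (H (Num.max 0 p.1) p.2)].
  by rewrite -[X in measurable X]setTI; exact: subordinator_jointly_measurableT.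
have := measurable_fun_xsection Q mA.
move=> /(measurableT_comp (@fine_measurable R setT measurableT)).
apply: eq_measurable_fun => t _ /=; congr (fine (Q _)).
by apply/seteqP; split => w; [move/xsectionP|move=> ?; apply/xsectionP].
Qed.

Lemma subordinator_law_ge0 B t : 0 <= subordinator_law B t.
Proof. by rewrite fine_ge0. Qed.

Lemma subordinator_lawE B t : measurable B -> 0 <= t ->
  (subordinator_law B t)%:E = Q [set w | B (H t w)].
Proof.
move=> mB t0; rewrite /subordinator_law max_r// fineK// fin_num_measure//.
by rewrite -[X in measurable X]setTI; exact: (subordinator_measurable sH).
Qed.

Lemma subordinator_increments n (a b : nat -> R) (B : nat -> set R) :
  (forall i, measurable (B i)) -> (forall i, 0 <= a i) ->
  (forall i, a i <= b i) -> (forall i, b i <= a i.+1) ->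
  Q [set w | forall i, (i < n)%N -> B i (H (b i) w - H (a i) w)] =
  (\prod_(i < n) (subordinator_law (B i) (b i - a i))%:E)%E.
Proof.
move=> mB a0 ab ba; elim: n => [|n ih].
  rewrite big_ord0 (_ : mkset _ = setT) ?probability_setT//.
  by apply/seteqP; split => // w _ i.
rewrite big_ord_recr/= -ih.
have b0 i : 0 <= b i by exact: le_trans (ab i).
set S := [set w | forall i, (i < n)%N -> _].
have -> : [set w | forall i, (i < n.+1)%N -> B i (H (b i) w - H (a i) w)] =
    S `&` [set w | B n (H (b n) w - H (a n) w)].
  apply/seteqP; split => w /=.
    by move=> h; split => [i ni|]; apply: h => //; exact: ltnW.
  by move=> [h1 h2] i; rewrite ltnS leq_eqVlt => /predU1P[->//|]; exact: h1.
rewrite (subordinator_independent sH (a0 n) (ab n))//; last first.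
  have bn i : (i < n)%N -> b i <= a n.
    move=> /subnK <-; elim: (n - _)%N => [|k ik]; first by rewrite add0n.
    by rewrite addSn (le_trans ik)// (le_trans (ab _)).
  pose TS := process_space [set u : R | 0 <= u <= a n] H.
  have mS : measurable (S : set TS).
    rewrite (_ : S = \bigcap_(i in `I_n) ((fun w => H (b i) w - H (a i) w) @^-1` B i))//.
    apply: bigcap_measurableType => // i /= ni.
    rewrite -[X in measurable X]setTI.
    have : measurable_fun setT (fun w : TS => H (b i) w - H (a i) w).
      apply: measurable_funB; apply: measurable_coordinate => /=.
        by rewrite b0 bn.
      by rewrite a0/= (le_trans (ab i))// bn.
    by apply.
  exact: mS.
congr (_ * _)%E; rewrite subordinator_lawE ?subr_ge0//.
have := subordinator_stationary sH (a0 n) (_ : 0 <= b n - a n) (mB n).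
by rewrite subr_ge0 addrC subrK; apply.
Qed.

End subordinator.

Section independent_times.
Context {R : realType} {d : nat} {disp : measure_display}
  {T : measurableType disp}.
Variables (X : R -> T -> 'rV[R]_d) (alpha : R) (H : R -> T -> R)
  (Q : probability T R).
Hypotheses (mX : forall t j, 0 <= t -> measurable_fun setT (fun w => X t w ord0 j))
  (indH : independent_subordinator X alpha H Q).

Let sH : stable_subordinator alpha H Q := indH.1.

Definition path_space := process_space [set tj : R * 'I_d | 0 <= tj.1]
  (fun tj w => X tj.1 w ord0 tj.2).

Local Notation TH := (process_space [set u : R | 0 <= u] H).

Lemma measurable_path_id : measurable_fun setT (id : T -> path_space).
Proof. by apply: measurable_process_id => -[t j] /= t0; exact: mX. Qed.

Lemma measurable_path_fun {d' : measure_display} {U : measurableType d'}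
    (f : path_space -> U) :
  measurable_fun setT f -> measurable_fun setT (f : T -> U).
Proof. by move=> mf; apply: (measurableT_comp mf); exact: measurable_path_id. Qed.

(** Given the path of X, the times a i and b i are constants. *)
Lemma subordinator_independent_times n (a b : nat -> path_space -> R)
    (B : nat -> set R) :
  (forall i, measurable (B i)) ->
  (forall i, measurable_fun setT (a i)) ->
  (forall i, measurable_fun setT (b i)) ->
  {ae Q, forall w : T, forall i, [/\ 0 <= a i w, a i w <= b i w & b i w <= a i.+1 w]} ->
  Q [set w | forall i, (i < n)%N ->
      B i (H (Num.max 0 (b i w)) w - H (Num.max 0 (a i w)) w)] =
  (\int[Q]_w \prod_(i < n) (subordinator_law H Q (B i) (b i w - a i w))%:E)%E.
Proof.
move=> mB ma mb ab.
pose S := [set p : path_space * TH | forall i, (i < n)%N ->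
  B i (H (Num.max 0 (b i p.1)) p.2 - H (Num.max 0 (a i p.1)) p.2)].
have mS : measurable S.
  rewrite (_ : S = \bigcap_(i in `I_n) ((fun p => H (Num.max 0 (b i p.1)) p.2 -
    H (Num.max 0 (a i p.1)) p.2) @^-1` B i))//.
  apply: bigcap_measurableType => // i _; rewrite -[X in measurable X]setTI.
  have mH (c : path_space -> R) : measurable_fun setT c ->
      measurable_fun setT (fun p : path_space * TH => H (Num.max 0 (c p.1)) p.2).
    move=> mc; apply: (measurableT_comp
      (f := fun p : measurableTypeR R * TH => H (Num.max 0 p.1) p.2)
      (g := fun p : path_space * TH => (c p.1, p.2))).
      exact: (subordinator_jointly_measurable sH).
    apply: measurable_fun_pair; last exact: measurable_snd.
    by apply: (measurableT_comp mc); exact: measurable_fst.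
  have : measurable_fun setT (fun p : path_space * TH =>
    H (Num.max 0 (b i p.1)) p.2 - H (Num.max 0 (a i p.1)) p.2).
    by apply: measurable_funB; exact: mH.
  by apply.
have mTH : measurable_fun setT (id : T -> TH).
  by apply: measurable_process_id => t; exact: (subordinator_measurable sH).
have mSd : measurable [set w : T | S (w, w)].
  have := measurable_fun_pair measurable_path_id mTH.
  by move=> /(_ measurableT _ mS); rewrite setTI.
transitivity (\int[Q]_w (\1_S ((w : path_space), (w : TH)))%:E)%E.
  rewrite (_ : (fun w => _) = fun w => (\1_[set w : T | S (w, w)] w)%:E); last first.
    by apply/funext => w; rewrite !indicE; congr (_%:R%:E); apply/idP/idP; rewrite !inE.
  by rewrite integral_indic// setIT.
have -> := @integral_independent_pair _ _ _ _ _ _ _ Q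
  (id : T -> path_space) (id : T -> TH) (EFin \o \1_S)
  measurable_path_id mTH.
- have mS1 : measurable_fun setT (EFin \o (\1_S : _ -> R)).
    by apply/measurable_EFinP; exact: measurable_indic.
  apply: ge0_ae_eq_integral => //.
  + apply: measurable_path_fun.
    pose f (p : path_space * T) := (\1_S (p.1, (p.2 : TH)) : R)%:E.
    have mf : measurable_fun setT f.
      apply: (measurableT_comp mS1).
      apply: measurable_fun_pair; first exact: measurable_fst.
      by apply: (measurableT_comp mTH); exact: measurable_snd.
    apply: (@measurable_fun_fubini_tonelli_F _ _ path_space T R Q f) => //.
    by move=> p; rewrite lee_fin.
  + apply: emeasurable_prod => i; apply/measurable_EFinP.
    apply: measurable_path_fun.
    apply: (measurableT_comp (measurable_subordinator_law sH (mB i))).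
    by apply: measurable_funB.
  + by move=> w _; apply: integral_ge0 => w' _; rewrite lee_fin.
  + by move=> w _; apply: prode_ge0 => i _; rewrite lee_fin subordinator_law_ge0.
  + apply: filterS ab => w abw _.
    have a0 i : 0 <= a i w by case: (abw i).
    have b0 i : 0 <= b i w by case: (abw i) => _ + _; exact: le_trans.
    have abw1 i : a i w <= b i w by case: (abw i).
    have abw2 i : b i w <= a i.+1 w by case: (abw i).
    rewrite -(subordinator_increments sH n mB a0 abw1 abw2).
    rewrite (_ : (fun w' => _) = fun w' => (\1_[set w' : T | S (w, w')] w')%:E); last first.
      by apply/funext => w' /=; rewrite !indicE; congr (_%:R%:E); apply/idP/idP; rewrite !inE.
    rewrite integral_indic// ?setIT.
      congr (Q _); apply/seteqP; split => w' h i ni; have /= := h i ni;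
        by rewrite !max_r.
    have mSw := measurable_xsection (w : path_space) mS.
    have := mTH measurableT _ mSw; rewrite setTI; congr (measurable _).
    by apply/seteqP; split => w'; [move/xsectionP|move=> ?; apply/xsectionP].
- by move=> A C mA mC; exact: indH.2.
- by apply/measurable_EFinP; exact: measurable_indic.
- by move=> p; rewrite lee_fin.
Qed.

End independent_times.

(** * Holding times *)

Section composition.
Context {R : realType}.

Lemma right_continuous_comp (h g : R -> R) (t : R) : 0 <= t ->
  (forall u, 0 <= u -> h s @[s --> u^'+] --> h u) ->
  {within `[0, +oo[, continuous g} ->
  (forall s u, 0 <= s -> s <= u -> g s <= g u) -> 0 <= g t ->
  h (g s) @[s --> t^'+] --> h (g t).
Proof.
move=> t0 hrc /continuous_frozen cg gmono gt0.
have gcvg : g s @[s --> t^'+] --> g t.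
  have h1 : g (Num.max 0 s) @[s --> t^'+] --> g (Num.max 0 t).
    by apply: cvg_at_right_filter; exact: cg.
  rewrite max_r// in h1; apply: cvg_trans h1; apply: near_eq_cvg; near=> s.
  by rewrite max_r// (le_trans t0)//; near: s; exact: nbhs_right_ge.
apply/cvgrPdist_lt => e e0.
have /cvgrPdist_lt/(_ e e0)[delta /= delta0 hd] := hrc _ gt0.
near=> s.
have gs : g t <= g s by apply: gmono => //; near: s; exact: nbhs_right_ge.
move: gs; rewrite le_eqVlt => /predU1P[<-|gs]; first by rewrite subrr normr0.
apply: hd => //=; near: s.
by move/cvgrPdist_lt : gcvg => /(_ _ delta0).
Unshelve. all: by end_near. Qed.

End composition.

Section at_time.
Context {R : realType} {disp : measure_display} {T : measurableType disp}.

Lemma at_time_mono (f : R -> R) (u v : \bar R) :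
  (forall s t, 0 <= s -> s <= t -> f s <= f t) -> (0 <= u)%E -> (u <= v)%E ->
  (at_time f u <= at_time f v)%E.
Proof.
move=> fmono; case: u => [u| |//]; case: v => [v| |]//=.
- by rewrite !lee_fin; exact: fmono.
- by move=> u0 _; apply: ereal_sup_ubound; exists u => //=; rewrite in_itv/= andbT.
Qed.

Lemma measurable_at_time (H : R -> T -> R) (u : T -> \bar R) :
  measurable_fun setT (fun p : measurableTypeR R * T => H (Num.max 0 p.1) p.2) ->
  (forall w s t, 0 <= s -> s <= t -> H s w <= H t w) ->
  measurable_fun setT u -> (forall w, u w = -oo%E \/ (0 <= u w)%E) ->
  measurable_fun setT (fun w => at_time (H ^~ w) (u w)).
Proof.
move=> mH Hmono mu u0.
have mHt t : measurable_fun setT (fun w => H (Num.max 0 t) w).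
  exact: (measurable_fun_pair2 (t : measurableTypeR R) mH).
pose Hoo w := ereal_sup (range (fun n : nat => (H n%:R w)%:E)).
have mHoo : measurable_fun setT Hoo.
  apply: (emeasurable_fun_cvg (fun n w => (H n%:R w)%:E)) => [n|w _].
    by apply/measurable_EFinP; have := mHt n%:R; rewrite max_r.
  apply: ereal_nondecreasing_cvgn => m n mn.
  by rewrite lee_fin Hmono// ler_nat.
have -> : (fun w => at_time (H ^~ w) (u w)) = (fun w =>
    if u w == +oo%E then Hoo w else (H (Num.max 0 (fine (u w))) w)%:E).
  apply/funext => w; have [uoo|uoo|u0'] : [\/ u w = +oo%E, u w = -oo%E |
      exists2 r, u w = r%:E & 0 <= r].
    have [->|] := u0 w; first by constructor 2.
    by case: (u w) => [r| |]// r0; [constructor 3; exists r|constructor 1].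
  - rewrite uoo eqxx /=; apply/eqP; rewrite eq_le; apply/andP; split.
      apply: ge_ereal_sup => _ [t /= + <-]; rewrite in_itv/= andbT => t0.
      apply: (@le_trans _ _ (H (Num.truncn t).+1%:R w)%:E).
        by rewrite lee_fin Hmono// ltW// truncnS_gt.
      by apply: ereal_sup_ubound; exists (Num.truncn t).+1.
    apply: ge_ereal_sup => _ [k _ <-]; apply: ereal_sup_ubound.
    by exists k%:R => //=; rewrite in_itv/= andbT.
  - by rewrite uoo /= maxxx.
  - by case: u0' => r -> r0 /=; rewrite max_r.
apply: measurable_fun_ifT => //; first exact: measurable_fun_eqe.
apply/measurable_EFinP.
apply: (measurable_process_at (E := fun t w => H (Num.max 0 t) w)) => //.
by apply: measurableT_comp.
Qed.

End at_time.

Section almost_everywhere_equal_sets.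
Context {R : realType} {disp : measure_display} {T : measurableType disp}.

Lemma ae_eq_probability (Q : probability T R) (A B : set T) :
  measurable A -> measurable B -> {ae Q, forall w, A w <-> B w} -> Q A = Q B.
Proof.
move=> mA mB AB; rewrite -[A]setIT -[B]setIT -!integral_indic//.
apply: ge0_ae_eq_integral => //.
- by apply/measurable_EFinP; exact: measurable_indic.
- by apply/measurable_EFinP; exact: measurable_indic.
- apply: filterS AB => w ABw _; have [Aw|nAw] := pselect (A w).
    by rewrite !indicE !mem_set//; exact/ABw.
  by rewrite !indicE !memNset// => /ABw.
Qed.

End almost_everywhere_equal_sets.

Section holding_times.
Context {R : realType} {d : nat} {disp : measure_display}
  {T : measurableType disp}.
Variables (eta sigma c alpha eps : R) (Omega : set 'rV[R]_d)
  (X : R -> T -> 'rV[R]_d) (gamma H : R -> T -> R) (Q : probability T R).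
Hypotheses (eta0 : 0 < eta) (sigma0 : 0 < sigma) (eps0 : 0 < eps)
  (oOmega : open Omega) (bOmega : bdry Omega !=set0)
  (cX : forall w, {within `[0, +oo[, continuous (X ^~ w)})
  (clX : forall w t, 0 <= t -> closure Omega (X t w))
  (mX : forall t j, 0 <= t -> measurable_fun setT (fun w => X t w ord0 j))
  (gammaQ : boundary_local_time Omega X gamma Q)
  (indH : independent_subordinator X alpha H Q).

Let sH : stable_subordinator alpha H Q := indH.1.
Local Notation TX := (path_space X).
Local Notation k := (eta / sigma).

Let D (t : R) (w : T) : R := edist (X (Num.max 0 t) w) (bdry Omega).

Let k0 : 0 < k. Proof. by rewrite divr_gt0. Qed.

Let cD w : continuous (D ^~ w).
Proof.
move=> t; have h := @continuous_frozen _ _ _ (@cX w) t.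
apply: (@cvg_comp _ _ _ (fun s => X (Num.max 0 s) w) (edist ^~ (bdry Omega))
  _ _ _ h).
exact: edist_continuous.
Qed.

Let mDX t : measurable_fun setT (D t : TX -> R).
Proof.
apply: (@measurable_continuous_vector _ _ _ TX (edist ^~ (bdry Omega))
  (X (Num.max 0 t)) (edist_continuous bOmega)) => j.
 apply: (@measurable_coordinate _ _ _ _ _ _ (Num.max 0 t, j)).
by rewrite /= le_max lexx.
Qed.

Let mD t : measurable_fun setT (D t).
Proof. exact: (measurable_path_fun mX (mDX t)). Qed.

Let D_collar w t : 0 <= t -> (~` collar Omega eps) (X t w) <-> eps <= D t w.
Proof.
move=> t0; rewrite /D max_r// /collar /setC/= leNgt; split => [h|/negP h].
  by apply/negP => De; apply: h; split => //; exact: clX.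
by case.
Qed.

Let D_bdry w t : 0 <= t -> bdry Omega (X t w) <-> D t w <= 0.
Proof.
move=> t0; rewrite /D max_r// -edist_bdry0P//; split => [->//|h].
by apply/eqP; rewrite eq_le h edist_ge0.
Qed.

Let D_Omega w t : 0 <= t -> (~` Omega) (X t w) <-> D t w <= 0.
Proof.
have oi : Omega° = Omega by exact/interior_id.
move=> t0; rewrite -D_bdry// /bdry oi.
by split => [h|[]//]; split => //; exact: clX.
Qed.

Let K (w : T) (s : R) : R := H (k * gamma s w) w.

Let gamma_ge0 w t : 0 <= t -> 0 <= gamma t w.
Proof.
by move=> t0; rewrite -(local_time_start gammaQ w) (local_time_nondecreasing gammaQ).
Qed.

Let K0 w : K w 0 = 0.
Proof. by rewrite /K (local_time_start gammaQ) mulr0 (subordinator_start sH). Qed.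

Let Kmono w s t : 0 <= s -> s <= t -> K w s <= K w t.
Proof.
move=> s0 st; apply: (subordinator_nondecreasing sH).
  by rewrite mulr_ge0 ?gamma_ge0// ltW.
by rewrite ler_pM2l// (local_time_nondecreasing gammaQ).
Qed.

Let Krc w t : 0 <= t -> K w s @[s --> t^'+] --> K w t.
Proof.
move=> t0; apply: (@right_continuous_comp _ (H ^~ w) (fun s => k * gamma s w)) => //.
- by move=> u u0; exact: (subordinator_right_continuous sH (w := w)).
- move=> s; apply: cvgM; first exact: cvg_cst.
  exact: (local_time_continuous gammaQ).
- by move=> s u s0 su; rewrite ler_pM2l// (local_time_nondecreasing gammaQ).
- by rewrite mulr_ge0 ?gamma_ge0// ltW.
Qed.

Let mH (u : T -> R) : measurable_fun setT u ->
  measurable_fun setT (fun w => H (Num.max 0 (u w)) w).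
Proof.
exact: (measurable_process_at (E := fun t w => H (Num.max 0 t) w)
  (subordinator_jointly_measurableT sH)).
Qed.

Let r (t : R) (w : T) : R := right_inverse (clock (K w)) t.

Let r_ge0 t w : 0 <= r t w. Proof. exact: (clock_inverse_ge0 (K0 w) (@Kmono w)). Qed.

Let r_le w t b : 0 <= b -> (r t w <= b) = (t <= clock (K w) b).
Proof. exact: (clock_inverse_le (K0 w) (@Kmono w) (@Krc w)). Qed.

Let mr t : measurable_fun setT (r t).
Proof.
apply: (measurability _ (RGenOInfty.measurableE R)) => _ [_ [b ->] <-].
rewrite setTI.
have [b0|b0] := leP 0 b; last first.
  rewrite (_ : _ @^-1` _ = setT)//; apply/seteqP; split => // w _ /=.
  by rewrite in_itv/= andbT (lt_le_trans b0).
rewrite (_ : _ @^-1` _ = [set w | clock (K w) b < t]); last first.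
  have E w : (r t w \in `]b, +oo[) = (clock (K w) b < t).
    by rewrite in_itv/= andbT ltNge r_le// -ltNge.
  by apply/seteqP; split => w; have := E w => /= ->.
rewrite -[X in measurable X]setTI; apply: measurable_fun_ltr => //.
apply: measurable_funD => //.
have mg : measurable_fun setT (fun w => k * gamma b w).
  by apply: measurable_funM => //; exact: (local_time_measurable gammaQ).
have := mH mg.
apply: eq_measurable_fun => w _.
by rewrite /K max_r// mulr_ge0 ?gamma_ge0// ltW.
Qed.

Let Xbar t w := X (r t w) w.
Let Dbar t w := D (r t w) w.

Lemma measurable_bar_holding_time i :
  measurable_fun setT (bar_holding_time sigma eta c X gamma H Omega eps i).
Proof.
apply: (@measurable_boundary_time _ _ _ _ Omega eps Xbar Dbar).
- move=> t; apply: measurable_process_at; last exact: mr.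
  by apply: continuous_jointly_measurable; [exact: mD|exact: cD].
- move=> w t.
  have h := clock_inverse_continuous (K0 w) (@Kmono w) (@Krc w) (x := t).
  by apply: (@cvg_comp _ _ _ (r ^~ w) (D ^~ w) _ _ _ h); exact: cD.
- by move=> w t t0; exact: D_collar.
- by move=> w t t0; exact: D_Omega.
- by move=> w t t0; exact: D_bdry.
Qed.

(** The local time at the random time u. The given version of the local time
    need not be a functional of the path of X, on which the independence from H
    relies; the limit of occupation times is one, and is almost surely the same. *)
Let path_gamma (u : T -> \bar R) (w : T) : \bar R :=
  limn_esup (fun n => (n.+1%:R%:E * lebesgue_measure
    [set s : R | [/\ (0%:E <= s%:E)%E, (s%:E <= u w)%E
                   & (D s w - n.+1%:R^-1 <= 0)%R]])%E).

Let measurable_path_gamma (u : TX -> \bar R) : measurable_fun setT u ->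
  measurable_fun setT (path_gamma u : TX -> _).
Proof.
move=> mu; apply: measurable_fun_limn_esup => n.
apply: emeasurable_funM => //.
apply: (@measurable_occupation _ _ _ (cst 0%:E) u (fun s (w : TX) => D s w - n.+1%:R^-1)) => //.
- by move=> t; apply: measurable_funB.
- by move=> w t; apply: cvgB; [exact: cD|exact: cvg_cst].
Qed.

Let path_gammaE (u : T -> \bar R) w :
  (forall t, 0 <= t ->
     delta^-1 * fine (occupation (D ^~ w) delta t) @[delta --> 0^'+] --> gamma t w) ->
  (0 <= u w)%E -> u w \is a fin_num ->
  path_gamma u w = (gamma (fine (u w)) w)%:E.
Proof.
move=> lim u0 ufin.
have fu0 : 0 <= fine (u w) by rewrite fine_ge0.
pose f n := n.+1%:R * fine (occupation (D ^~ w) n.+1%:R^-1 (fine (u w))).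
have fcvg : f n @[n --> \oo] --> gamma (fine (u w)) w.
  have /cvg_at_rightP h := lim _ fu0.
  have := h (fun n => n.+1%:R^-1) (conj _ cvg_harmonic).
  under eq_fun do rewrite invrK.
  by apply => n; rewrite invr_gt0.
transitivity (limn_esup (EFin \o f)).
  congr limn_esup; apply/funext => n /=.
  rewrite EFinM fineK ?occupation_fin//.
  by rewrite /occupation fineK.
have fcvg' : EFin \o f @ \oo --> (gamma (fine (u w)) w)%:E.
  by apply: cvg_EFin => //; apply: nearW.
rewrite is_cvg_limn_esupE; first exact: cvg_lim fcvg'.
by apply/cvg_ex; eexists; exact: fcvg'.
Qed.

Let start i w := visit_start Omega eps (X ^~ w) i.
Let stop i w := visit_end Omega eps (X ^~ w) i.

Let at_start i w : R := k * fine (path_gamma (start i) w).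
Let at_stop i w : R := k * fine (path_gamma (stop i) w).

Let measurable_at_start i : measurable_fun setT (at_start i : TX -> R).
Proof.
apply: measurable_funM => //; apply: (measurableT_comp (@fine_measurable R setT measurableT)).
apply: measurable_path_gamma.
exact: (@measurable_visit_start _ _ _ TX Omega eps X D mDX cD D_collar D_Omega i).
Qed.

Let measurable_at_stop i : measurable_fun setT (at_stop i : TX -> R).
Proof.
apply: measurable_funM => //; apply: (measurableT_comp (@fine_measurable R setT measurableT)).
apply: measurable_path_gamma.
exact: (@measurable_visit_end _ _ _ TX Omega eps X D mDX cD D_collar D_Omega i).
Qed.

Hypothesis starts : forall i, {ae Q, forall w, (start i w < +oo)%E /\
  bdry Omega (X (fine (start i w)) w)}.

Local Notation e := (holding_time sigma eta X gamma Omega eps).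
Local Notation ebar := (bar_holding_time sigma eta c X gamma H Omega eps).
Local Notation He := (subordinated_holding_time sigma eta X gamma H Omega eps).

(** The pathwise description of the holding times: the endpoints, on the clock
    of H, are functionals of the path of X, and they are ordered. *)
Lemma holding_times_path : {ae Q, forall w : T, forall i,
  [/\ ebar i w =
        (H (Num.max 0 (at_stop i w)) w - H (Num.max 0 (at_start i w)) w)%:E,
      e i w = (at_stop i w - at_start i w)%:E, at_start 0 w = 0 &
      [/\ 0 <= at_start i w, at_start i w <= at_stop i w
        & at_stop i w <= at_start i.+1 w]]}.
Proof.
have starts' := ae_foralln starts.
have lim := local_time_limit gammaQ.
apply: filterS2 starts' lim => w start_w lim_w.
have {}lim_w t : 0 <= t ->
    delta^-1 * fine (occupation (D ^~ w) delta t) @[delta --> 0^'+] --> gamma t w.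
  move=> t0; apply: cvg_trans (lim_w t t0); apply: near_eq_cvg; near=> delta.
  congr (_ * _); rewrite /Rintegral.
  pose A := [set s : R | [/\ (0%:E <= s%:E)%E, (s%:E <= t%:E)%E & D s w - delta <= 0]].
  have mA : measurable A by apply: (occupation_set_measurable (@cD w)).
  congr fine; rewrite integral_mkcond.
  transitivity (\int[lebesgue_measure]_s (\1_A s)%:E)%E; last first.
    by rewrite integral_indic// setIT.
  apply: eq_integral => s _; rewrite patchE /=; case: ifPn => [|]; rewrite ?inE ?notin_setE/= in_itv/=.
    move=> /andP[s0 st]; have De : D s w = edist (X s w) (bdry Omega).
      by rewrite /D max_r.
    have [Ds|Ds] := boolP (D s w <= delta).
      by rewrite !indicE !mem_set//= -?De// /A/= !lee_fin subr_le0.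
    rewrite !indicE !memNset//=; last by rewrite -De; exact/negP.
    by rewrite /A/= subr_le0 => -[_ _]; exact/negP.
  move=> h; rewrite indicE memNset// => -[]; rewrite !lee_fin => s0 st _.
  by apply: h; rewrite s0.
have null := null_boundary_occupation (@cD w) lim_w.
have D0 : D 0 w <= 0.
  have [_] := start_w 0%N; rewrite /start /=; exact: (D_bdry w (lexx 0)).1.
have flat a b : 0 <= a -> a <= b -> (forall s, a <= s -> s < b -> 0 < D s w) ->
    K w a = K w b.
  move=> a0 ab Dpos; rewrite /K.
  by rewrite (local_time_flat (@cD w) lim_w (@local_time_continuous _ _ _ _ _ _ _ _ gammaQ w) a0 ab Dpos).
have finite i : (visit_start Omega eps (X ^~ w) i < +oo)%E by case: (start_w i).
have visit := visits_time_change (K0 w) (@Kmono w) (@Krc w) eps0 (@cD w) D0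
  (D_collar w) (D_Omega w) finite flat.
have gE (u : T -> \bar R) t : u w = t%:E -> 0 <= t ->
    k * fine (path_gamma u w) = k * gamma t w.
  by move=> uE t0; rewrite path_gammaE// uE.
move=> i; have [S [U [[SE UE _ _] [S0 SU _ _]]]] := visit i.
have [S' [_ [[SE' _ _ _] _]]] := visit i.+1.
have U0 := le_trans S0 SU.
have US' : U <= S'.
  by have := visit_end_start Omega eps (X ^~ w) i; rewrite UE SE' lee_fin.
have aE : at_start i w = k * gamma S w by exact: gE.
have bE : at_stop i w = k * gamma U w by exact: gE.
have aE' : at_start i.+1 w = k * gamma S' w by apply: gE => //; exact: le_trans US'.
have ka t : 0 <= t -> 0 <= k * gamma t w by move=> t0; rewrite mulr_ge0 ?gamma_ge0// ltW.
split.
- rewrite aE bE !max_r ?ka//.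
  have := boundary_time_time_change (K0 w) (@Kmono w) (@Krc w) eps0 (@cD w) D0
    (D_collar w) (D_Omega w) (D_bdry w) finite flat i null.
  by rewrite UE SE /=; apply.
- by rewrite /holding_time UE SE /= aE bE -EFinB -EFinM mulrBr.
- by rewrite /at_start (gE (start 0%N) 0)// (local_time_start gammaQ) mulr0.
- by split; rewrite ?aE ?bE ?aE' ?ka// ler_pM2l// (local_time_nondecreasing gammaQ).
Unshelve. all: by end_near. Qed.

(** The law of H at the time u; at u = e i it is the conditional law of the i-th
    holding time given the path of X. *)
Definition mixed_law (A : set (\bar R)) (u : \bar R) : \bar R :=
  (subordinator_law H Q (EFin @^-1` A) (fine u))%:E.

Let mB (A : set (\bar R)) : measurable A -> measurable (EFin @^-1` A : set R).
Proof. by move=> mA; rewrite -[X in measurable X]setTI; exact: EFin_measurable. Qed.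

Lemma measurable_mixed_law A : measurable A -> measurable_fun setT (mixed_law A).
Proof.
move=> mA; apply/measurable_EFinP.
apply: (measurableT_comp (measurable_subordinator_law sH (mB mA))).
exact: fine_measurable.
Qed.

Lemma mixed_law_ge0 A u : (0 <= mixed_law A u)%E.
Proof. by rewrite lee_fin subordinator_law_ge0. Qed.

(** Conditioning on the path of X freezes the endpoints a i and b i. They are
    arbitrary functionals of the path, so that the lemma applies both to the
    holding times of the time-changed process and to H at a holding time of X. *)
Let increments_law n (Z : nat -> T -> \bar R) (a b : nat -> TX -> R)
    (A : nat -> set (\bar R)) :
  (forall i, measurable (A i)) -> (forall i, measurable_fun setT (Z i)) ->
  (forall i, measurable_fun setT (a i)) -> (forall i, measurable_fun setT (b i)) ->
  {ae Q, forall w : T, forall i,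
    [/\ 0 <= a i w, a i w <= b i w & b i w <= a i.+1 w]} ->
  {ae Q, forall w : T, forall i, (i < n)%N ->
    Z i w = (H (Num.max 0 (b i w)) w - H (Num.max 0 (a i w)) w)%:E} ->
  Q (\bigcap_(i in `I_n) (Z i @^-1` A i)) =
  (\int[Q]_w \prod_(i < n) mixed_law (A i) (b i w - a i w)%:E)%E.
Proof.
move=> mA mZ ma mb ab ZE.
rewrite -(subordinator_independent_times mX indH n (fun i => mB (mA i)) ma mb ab).
apply: ae_eq_probability.
- apply: bigcap_measurableType => i _.
  by rewrite -[X in measurable X]setTI; exact: mZ.
- rewrite (_ : mkset _ = \bigcap_(i in `I_n) ((fun w => H (Num.max 0 (b i w)) w -
    H (Num.max 0 (a i w)) w) @^-1` (EFin @^-1` A i)))//.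
  apply: bigcap_measurableType => i _; rewrite -[X in measurable X]setTI.
  have : measurable_fun setT (fun w : T =>
      H (Num.max 0 (b i w)) w - H (Num.max 0 (a i w)) w).
    by apply: measurable_funB; apply: mH; exact: (measurable_path_fun mX).
  by apply => //; exact: mB.
- apply: filterS ZE => w ZEw; split => h i ni; have := h i ni; rewrite /= ZEw//.
Qed.

Let he := holding_times_path.

Lemma bar_holding_times_law n (A : nat -> set (\bar R)) :
  (forall i, measurable (A i)) ->
  Q (\bigcap_(i in `I_n) (ebar i @^-1` A i)) =
  (\int[Q]_w \prod_(i < n) mixed_law (A i) (at_stop i w - at_start i w)%:E)%E.
Proof.
move=> mA; apply: increments_law => [//|i|i|i||].
- exact: measurable_bar_holding_time.
- exact: measurable_at_start.
- exact: measurable_at_stop.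
- by apply: filterS he => w h i; have [_ _ _] := h i.
- by apply: filterS he => w h i _; have [] := h i.
Qed.

Lemma bar_holding_time_law i (A : set (\bar R)) : measurable A ->
  Q (ebar i @^-1` A) =
  (\int[Q]_w mixed_law A (at_stop i w - at_start i w)%:E)%E.
Proof.
move=> mA.
have := @increments_law 1 (fun j => ebar (i + j)) (fun j => at_start (i + j))
  (fun j => at_stop (i + j)) (fun=> A) (fun=> mA).
rewrite (_ : \bigcap_(j in `I_1) _ = ebar i @^-1` A); last first.
  apply/seteqP; split => w; first by move=> /(_ 0%N isT); rewrite addn0.
  by move=> h [|//] _; rewrite addn0.
under eq_integral do rewrite big_ord1 addn0.
move=> h; apply: h => [j|j|j||].
- exact: measurable_bar_holding_time.
- exact: measurable_at_start.
- exact: measurable_at_stop.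
- by apply: filterS he => w h j; have [_ _ _] := h (i + j)%N; rewrite addnS.
- by apply: filterS he => w h j _; have [] := h (i + j)%N.
Qed.

(** A visit starting at time +oo has holding time (+oo) - (+oo) = -oo. *)
Lemma holding_time_ge0 i w : e i w = -oo%E \/ (0 <= e i w)%E.
Proof.
rewrite /holding_time.
set S := visit_start _ _ _ _; set U := visit_end _ _ _ _.
have SU : (at_time (gamma ^~ w) S <= at_time (gamma ^~ w) U)%E.
  apply: at_time_mono; last exact: visit_start_end.
    by move=> s t; exact: (local_time_nondecreasing gammaQ).
  exact: visit_start_ge0.
have [->|Sfin] := eqVneq (at_time (gamma ^~ w) S) +oo%E.
  by left; rewrite addeNy gt0_muleNy ?lte_fin.
right; apply: mule_ge0; first by rewrite lee_fin ltW.
rewrite sube_ge0//; apply/orP; left.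
have : (0 <= at_time (gamma ^~ w) S)%E.
  rewrite [leLHS](_ : _ = at_time (gamma ^~ w) 0%:E).
    apply: at_time_mono => //; last exact: visit_start_ge0.
    by move=> s t; exact: (local_time_nondecreasing gammaQ).
  by rewrite /= (local_time_start gammaQ).
by move: Sfin; case: at_time.
Qed.

Lemma measurable_subordinated i : measurable_fun setT (e i) ->
  measurable_fun setT (He i).
Proof.
move=> me; apply: measurable_at_time => //.
- exact: (subordinator_jointly_measurableT sH).
- by move=> w s t; exact: (subordinator_nondecreasing sH).
- exact: holding_time_ge0.
Qed.

Lemma subordinated_holding_time_law i (A : set (\bar R)) : measurable A ->
  measurable_fun setT (e i) ->
  Q (He i @^-1` A) =
  (\int[Q]_w mixed_law A (at_stop i w - at_start i w)%:E)%E.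
Proof.
move=> mA me; pose len w : R := at_stop i w - at_start i w.
have mlen : measurable_fun setT (len : TX -> R) by exact: measurable_funB.
have := @increments_law 1 (fun=> He i) (fun j w => if j is 0%N then 0 else len w)
  (fun=> len) (fun=> A) (fun=> mA).
rewrite (_ : \bigcap_(j in `I_1) _ = He i @^-1` A); last first.
  by apply/seteqP; split => w h; [exact: (h 0%N isT)|move=> j _].
under eq_integral do rewrite big_ord1 subr0.
have len0 : {ae Q, forall w : T, 0 <= len w}.
  by apply: filterS he => w h; have [_ _ _ [_ + _]] := h i; rewrite subr_ge0.
move=> h; apply: h => [_|j|_||].
- exact: measurable_subordinated.
- by case: j => [|j] //; exact: measurable_cst.
- exact: mlen.
- by apply: filterS len0 => w l0 [|j].
- apply: filterS2 he len0 => w h l0 [|//] _; have [_ ew _ _] := h i.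
  rewrite /subordinated_holding_time ew /= maxxx (subordinator_start sH) subr0.
  by rewrite max_r.
Qed.

Hypothesis ind_e : independent_seq Q e.

Let measurable_mixed_increment i A : measurable A ->
  measurable_fun setT (fun w : T => mixed_law A (at_stop i w - at_start i w)%:E).
Proof.
move=> mA; apply: (measurableT_comp (measurable_mixed_law mA)).
apply/measurable_EFinP; apply: measurable_funB; exact: (measurable_path_fun mX).
Qed.

Let measurable_mixed_holding i A : measurable A ->
  measurable_fun setT (fun w : T => mixed_law A (e i w)).
Proof.
by move=> mA; apply: (measurableT_comp (measurable_mixed_law mA)); exact: ind_e.1.
Qed.

Lemma bar_holding_time_mixture i A : measurable A ->
  Q (ebar i @^-1` A) = (\int[Q]_w mixed_law A (e i w))%E.
Proof.
move=> mA; rewrite bar_holding_time_law//; apply: ge0_ae_eq_integral => //.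
- exact: measurable_mixed_increment.
- exact: measurable_mixed_holding.
- by move=> w _; exact: mixed_law_ge0.
- by move=> w _; exact: mixed_law_ge0.
- by apply: filterS he => w h _; have [_ -> _ _] := h i.
Qed.

Theorem bar_holding_times_independent : independent_seq Q ebar.
Proof.
split=> [i|n A mA]; first exact: measurable_bar_holding_time.
rewrite bar_holding_times_law//.
transitivity (\int[Q]_w \prod_(i < n) mixed_law (A i) (e i w))%E.
  apply: ge0_ae_eq_integral => //.
  - by apply: emeasurable_prod => i; exact: measurable_mixed_increment.
  - by apply: emeasurable_prod => i; exact: measurable_mixed_holding.
  - by move=> w _; apply: prode_ge0 => i _; exact: mixed_law_ge0.
  - by move=> w _; apply: prode_ge0 => i _; exact: mixed_law_ge0.
  - apply: filterS he => w h _; apply: eq_bigr => i _.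
    by have [_ -> _ _] := h i.
rewrite (independent_expectation ind_e n (f := fun i => mixed_law (A i))).
- by apply: eq_bigr => i _; rewrite bar_holding_time_mixture.
- by move=> i; exact: measurable_mixed_law.
- by move=> i y; exact: mixed_law_ge0.
Qed.

Theorem bar_holding_time_same_law i : same_law Q (ebar i) (He i).
Proof.
split.
- exact: measurable_bar_holding_time.
- by apply: measurable_subordinated; exact: ind_e.1.
- by move=> A mA; rewrite bar_holding_time_law// subordinated_holding_time_law//; exact: ind_e.1.
Qed.

Theorem bar_holding_time0 : {ae Q, forall w, ebar 0 w = He 0 w}.
Proof.
apply: filterS he => w h; have [-> ew a0 [h1 h2 _]] := h 0%N.
rewrite /subordinated_holding_time ew a0 subr0 /= maxxx (subordinator_start sH).
by rewrite subr0 max_r// (le_trans h1).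
Qed.

End holding_times.

(** * Laplace transforms *)

Section laplace_integrals.
Context {R : realType}.
Local Notation mu := (@lebesgue_measure R).

Lemma ge0_integral_scaling (s : R) (f : R -> \bar R) : 0 < s ->
  measurable_fun setT f -> (forall t, (0 <= f t)%E) ->
  (\int[mu]_t f t = s%:E * \int[mu]_t f (s * t)%R)%E.
Proof.
move=> s0 mf f0.
pose m (t : measurableTypeR R) : measurableTypeR R := s * t.
have mm : measurable_fun setT m by exact: measurable_funM.
pose s' : {nonneg R} := NngNum (ltW s0).
rewrite [X in (_ * X)%E](_ : _ = \int[mu]_(t in m @^-1` setT) (f \o m) t)%E//.
rewrite -(ge0_integral_pushforward mm mu measurableT mf)//.
rewrite -[s]/(s'%:num) -ge0_integral_mscale//.
apply: eq_measure_integral => A mA _; apply: lebesgue_measure_unique => //=.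
move=> _ [[a b]] _ <-; rewrite /mscale/= /pushforward.
rewrite (_ : _ @^-1` _ = `](s^-1 * a), (s^-1 * b)]%classic); last first.
  by apply/seteqP; split => t /=;
    rewrite !in_itv/= /m ltr_pdivrMl// ler_pdivlMl.
rewrite !lebesgue_measure_itv/= !lte_fin ltr_pM2l ?invr_gt0//.
case: ifP => _; last by rewrite mule0.
by rewrite -!EFinB -EFinM -mulrBr mulrA divff ?mul1r// gt_eqF.
Qed.

Lemma measurable_expR_linear (s : R) D :
  measurable_fun D (fun t : R => (expR (- (s * t)))%:E).
Proof.
apply/measurable_EFinP; apply: measurable_funTS.
apply: (measurableT_comp (@measurable_expR R)); apply: measurable_funN.
exact: measurable_funM.
Qed.

Lemma integral_expR_itv (s y : R) : 0 < s -> 0 <= y ->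
  (\int[mu]_(t in `[0%R, y[) (expR (- (s * t)))%:E =
   ((1 - expR (- (s * y))) / s)%:E)%E.
Proof.
move=> s0; rewrite le_eqVlt => /predU1P[<-|y0].
  rewrite (_ : `[0, 0[%classic = set0) ?integral_set0.
    by rewrite mulr0 oppr0 expR0 subrr mul0r.
  by rewrite -subset0 => t /=; rewrite in_itv/=; lra.
rewrite integral_itv_bndo_bndc; last exact: measurable_expR_linear.
have := exponential_prob_itv0c s y0; rewrite /exponential_prob.
have -> : (\int[mu]_(t in `[0%R, y]) (exponential_pdf s t)%:E =
    \int[mu]_(t in `[0%R, y]) (s%:E * (expR (- (s * t)))%:E))%E.
  apply: eq_integral => t; rewrite inE/= in_itv/= => /andP[t0 _].
  by rewrite exponential_pdfE// mulNr.
rewrite ge0_integralZl_EFin//=; [|exact: measurable_expR_linear|exact: ltW].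
move=> h; rewrite mulrC EFinM EFinB -mulNr -h muleA -EFinM mulVf ?mul1e//.
by rewrite gt_eqF.
Qed.

Lemma integral_expR (s : R) : 0 < s ->
  (\int[mu]_(t in `[0%R, +oo[) (expR (- (s * t)))%:E = (s^-1)%:E)%E.
Proof.
move=> s0; have := integral_exponential_pdf s0.
rewrite (_ : (fun x => _) =
    (fun t => s%:E * (expR (- (s * t)))%:E)%E \_ `[0%R, +oo[); last first.
  apply/funext => t; rewrite /exponential_pdf !patchE.
  by case: ifPn => // _; rewrite mulNr.
rewrite -integral_mkcond ge0_integralZl_EFin//=; [|exact: measurable_expR_linear|exact: ltW].
move=> h; rewrite -[RHS]mule1 -h muleA -EFinM mulVf ?mul1e//.
by rewrite gt_eqF.
Qed.

(** Gamma integrals converge since t^a is dominated by exp (t / 2). *)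
Lemma powR_le_expR (a : R) : 0 <= a ->
  exists2 C : R, 0 <= C & forall t, 0 <= t -> t `^ a <= C * expR (t / 2).
Proof.
move=> a0; pose n := Num.truncn a; exists (1 + 2 ^+ n.+1 * n.+1`!%:R).
  by rewrite addr_ge0// mulr_ge0// exprn_ge0.
move=> t t0.
have e1 : 1 <= expR (t / 2) by rewrite -expR0 ler_expR divr_ge0.
have an : a <= n.+1%:R by rewrite ltW// truncnS_gt.
have e0 := expR_ge0 (t / 2).
rewrite mulrDl mul1r.
have [t1|t1] := leP t 1.
  rewrite (@le_trans _ _ 1)//.
    have -> : 1 = 1 `^ a :> R by rewrite powR1.
    by apply: ge0_ler_powR; rewrite ?nnegrE.
  by rewrite (le_trans e1)// lerDl !mulr_ge0// ?exprn_ge0.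
rewrite (@le_trans _ _ (t ^+ n.+1))//.
  by rewrite -powR_mulrn// ler_powR// ltW.
rewrite (@le_trans _ _ (2 ^+ n.+1 * n.+1`!%:R * expR (t / 2)))//; last first.
  by rewrite lerDr.
have t20 : 0 <= t / 2 by rewrite divr_ge0.
have := @expR_ge1Dxn R (t / 2) n t20.
have f0 : 0 < n.+1`!%:R :> R by rewrite ltr0n fact_gt0.
move=> h; have {}h : (t / 2) ^+ n.+1 / n.+1`!%:R <= expR (t / 2).
  by rewrite (le_trans _ h)// lerDr.
move: h; rewrite ler_pdivrMr// expr_div_n ler_pdivrMr ?exprn_gt0//.
by rewrite mulrC (mulrC (expR _)) mulrA.
Qed.

Definition gamma_integrand (a : R) (t : R) : R := t `^ a * expR (- t).

Lemma measurable_gamma_integrand a D :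
  measurable_fun D (EFin \o gamma_integrand a).
Proof.
apply/measurable_EFinP; apply: measurable_funTS; apply: measurable_funM.
  exact: measurable_powR.
by apply: (measurableT_comp (@measurable_expR R)); exact: measurable_funN.
Qed.

Lemma gamma_integrand_ge0 a t : 0 <= gamma_integrand a t.
Proof. by rewrite mulr_ge0 ?powR_ge0 ?expR_ge0. Qed.

Lemma gamma_integral_lty (a : R) : 0 <= a ->
  (\int[mu]_(t in `[0%R, +oo[) (gamma_integrand a t)%:E < +oo)%E.
Proof.
move=> /powR_le_expR[C C0 aC].
apply: (@le_lt_trans _ _
    (\int[mu]_(t in `[0%R, +oo[) (C%:E * (expR (- (2^-1 * t)))%:E))%E).
  apply: ge0_le_integral => //.
  - by move=> t _; rewrite lee_fin gamma_integrand_ge0.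
  - exact: measurable_gamma_integrand.
  - by apply: emeasurable_funM => //; exact: measurable_expR_linear.
  - move=> t /=; rewrite in_itv/= andbT => t0; rewrite -EFinM lee_fin.
    have -> : - (2^-1 * t) = t / 2 - t by lra.
    by rewrite expRD mulrA ler_wpM2r ?expR_ge0// aC.
rewrite ge0_integralZl_EFin//; last exact: measurable_expR_linear.
by rewrite integral_expR// -EFinM ltry.
Qed.

Lemma Gamma1_integral (a : R) : 0 <= a ->
  (\int[mu]_(t in `[0%R, +oo[) (gamma_integrand a t)%:E = (Gamma (a + 1))%:E)%E.
Proof.
move=> a0; rewrite /Gamma /Rintegral addrK.
rewrite integral_itv_obnd_cbnd; last exact: measurable_gamma_integrand.
rewrite fineK// ge0_fin_numE ?gamma_integral_lty//.
by apply: integral_ge0 => t _; rewrite lee_fin gamma_integrand_ge0.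
Qed.

Lemma Gamma1_gt0 (a : R) : 0 <= a -> 0 < Gamma (a + 1).
Proof.
move=> a0; rewrite -lte_fin -Gamma1_integral//.
apply: (@lt_le_trans _ _ (\int[mu]_(t in `[1%R, 2%R]) (expR (- 2))%:E)%E).
  rewrite integral_cst//= lebesgue_measure_itv/= lte_fin ltr1n -EFinB -EFinM.
  by rewrite lte_fin mulr_gt0 ?expR_gt0// subr_gt0 ltr1n.
apply: (@le_trans _ _
    (\int[mu]_(t in `[1%R, 2%R]) (gamma_integrand a t)%:E)%E).
  apply: ge0_le_integral => //.
  - exact: measurable_gamma_integrand.
  - move=> t /=; rewrite in_itv/= => /andP[t1 t2].
    rewrite lee_fin -[leLHS]mul1r ler_pM ?expR_ge0// ?ler_expR ?lerN2//.
    by rewrite -[leLHS](powRr0 t) ler_powR.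
apply: ge0_subset_integral => //.
- exact: measurable_gamma_integrand.
- by move=> t _; rewrite lee_fin gamma_integrand_ge0.
- move=> t /=; rewrite !in_itv/= andbT => /andP[t1 _].
  exact: le_trans t1.
Qed.

Lemma Gamma1 : Gamma (1 : R) = 1.
Proof.
apply/eqP; rewrite -eqe -[X in Gamma X]add0r -Gamma1_integral//.
apply/eqP; transitivity ((1^-1 : R)%:E); last by rewrite invr1.
rewrite -integral_expR//; by apply: eq_integral => t _; rewrite /gamma_integrand powRr0 !mul1r.
Qed.

(** The substitution t := s t in the Gamma integral. *)
Lemma laplace_powR (a s : R) : 0 <= a -> 0 < s ->
  (\int[mu]_(t in `[0%R, +oo[) (t `^ a * expR (- (s * t)))%:E =
   (Gamma (a + 1) / s `^ (a + 1))%:E)%E.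
Proof.
move=> a0 s0; rewrite EFinM -Gamma1_integral//.
rewrite integral_mkcond [in RHS]integral_mkcond.
rewrite [in RHS](ge0_integral_scaling s0); first last.
- by apply: erestrict_ge0 => t _; rewrite lee_fin gamma_integrand_ge0.
- by apply/(measurable_restrictT _ _).1 => //; exact: measurable_gamma_integrand.
have sa : s `^ (a + 1) = s `^ a * s.
  by rewrite powRD ?powRr1 ?ltW// (gt_eqF s0)/= implybT.
have sa0 : 0 < s `^ a by rewrite powR_gt0.
rewrite [X in (s%:E * X)%E](_ : _ = \int[mu]_t ((s `^ a)%:E *
    ((fun t => (t `^ a * expR (- (s * t)))%:E) \_ `[0%R, +oo[) t))%E; last first.
  apply: eq_integral => t _; rewrite !patchE.
  have [t0|t0] := leP 0 t.
    rewrite !ifT; last 2 first.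
    - by rewrite inE/= in_itv/= t0.
    - by rewrite inE/= in_itv/= mulr_ge0// ltW.
    rewrite -EFinM /gamma_integrand.
    by rewrite (powRM _ (ltW s0) t0) mulrA.
  rewrite !ifF ?mule0//; apply/negbTE; rewrite notin_setE/= in_itv/= andbT.
    by apply/negP; rewrite -ltNge.
  by apply/negP; rewrite -ltNge pmulr_rlt0.
rewrite ge0_integralZl_EFin//; last 3 first.
- by move=> t _; apply: erestrict_ge0 => {}t _; rewrite lee_fin mulr_ge0 ?powR_ge0 ?expR_ge0.
- apply/(measurable_restrictT _ _).1 => //; apply/measurable_EFinP.
  apply: measurable_funTS; apply: measurable_funM; first exact: measurable_powR.
  by apply/measurable_EFinP; exact: measurable_expR_linear.
- exact: ltW.
rewrite sa muleA -EFinM muleAC -EFinM.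
rewrite (_ : s * s `^ a / _ = 1) ?mul1e//.
by field; rewrite !gt_eqF.
Qed.

End laplace_integrals.

(** * Uniqueness of Laplace transforms *)

Section laplace_uniqueness.
Context {R : realType}.
Local Notation mu := (@lebesgue_measure R).
Local Notation D := (`[(0:R), +oo[%classic).

Lemma bernoulli_inequality (y : R) k : 0 <= y <= 1 -> 1 - k%:R * y <= (1 - y) ^+ k.
Proof.
move=> /andP[y0 y1]; elim: k => [|k ih]; first by rewrite mul0r subr0 expr0.
rewrite exprS (@le_trans _ _ ((1 - y) * (1 - k%:R * y)))//.
  rewrite -natr1; have : 0 <= k%:R * y * y by rewrite !mulr_ge0.
  lra.
by rewrite ler_wpM2l// subr_ge0.
Qed.

Lemma expRN_le (z : R) : 0 <= z -> expR (- z) <= (1 + z)^-1.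
Proof.
move=> z0; rewrite expRN lef_pV2 ?posrE ?expR_gt0 ?ltr_wpDr//.
exact: expR_ge1Dx.
Qed.

Lemma cvg_inv_linear (c : R) : 0 < c -> (1 + n%:R * c)^-1 @[n --> \oo] --> (0 : R).
Proof.
move=> c0; apply/cvgrPdist_le => e e0; near=> n.
have p0 : 0 < 1 + n%:R * c by rewrite ltr_wpDr// mulr_ge0// ltW.
have p0' : 0 <= (1 + n%:R * c)^-1 by rewrite invr_ge0 ltW.
rewrite sub0r normrN ger0_norm// -[leRHS]invrK lef_pV2 ?posrE ?invr_gt0//.
have : e^-1 / c <= n%:R by near: n; exact: nbhs_infty_ger.
by rewrite ler_pdivrMr// => h; rewrite (le_trans h)// lerDr.
Unshelve. all: by end_near. Qed.

(** The polynomials (1 - u^n)^k in u = exp (- t), with k close to exp (n x),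
    converge to the indicator of t > x. *)
Let step (x : R) (n : nat) (t : R) : R :=
  (1 - expR (- (n%:R * t))) ^+ (Num.truncn (expR (n%:R * x))).+1.

Let step_bound x n t : 0 <= t -> 0 <= step x n t <= 1.
Proof.
move=> t0; have : expR (- (n%:R * t)) <= 1.
  by rewrite -expR0 ler_expR oppr_le0 mulr_ge0.
have := expR_ge0 (- (n%:R * t)) => h0 h1.
by rewrite /step exprn_ge0 ?exprn_ile1//; lra.
Qed.

Let step_below x t : 0 <= t -> t < x -> step x n t @[n --> \oo] --> (0 : R).
Proof.
move=> t0 tx.
apply: (@squeeze_cvgr _ _ _ _ (cst 0) (fun n => (1 + n%:R * (x - t))^-1)).
- apply: nearW => n; have /andP[-> _] := step_bound x n t0.
  set k := (Num.truncn (expR (n%:R * x))).+1.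
  have kx : expR (n%:R * x) <= k%:R by rewrite ltW// truncnS_gt.
  have y0 := expR_ge0 (- (n%:R * t)).
  have y1 : expR (- (n%:R * t)) <= 1.
    by rewrite -expR0 ler_expR oppr_le0 mulr_ge0.
  rewrite /step -/k (@le_trans _ _ (expR (- expR (- (n%:R * t))) ^+ k))//.
    by rewrite lerXn2r ?nnegrE ?expR_ge0 ?subr_ge0// (le_trans _ (expR_ge1Dx _)).
  have nx : 0 <= n%:R * (x - t) by rewrite mulr_ge0// subr_ge0 ltW.
  rewrite -expRM_natl (le_trans _ (expRN_le nx))// ler_expR mulrN lerN2.
  rewrite (@le_trans _ _ (expR (n%:R * (x - t))))//.
    by rewrite (le_trans _ (expR_ge1Dx _))// lerDr.
  by rewrite mulrBr expRD ler_wpM2r.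
- exact: cvg_cst.
- by apply: cvg_inv_linear; rewrite subr_gt0.
Qed.

Let step_above x t : 0 <= x -> x < t -> step x n t @[n --> \oo] --> (1 : R).
Proof.
move=> x0 xt; have t0 : 0 <= t by rewrite (le_trans x0)// ltW.
apply: (@squeeze_cvgr _ _ _ _ (fun n => 1 - 2 * (1 + n%:R * (t - x))^-1) (cst 1)).
- apply: nearW => n; have /andP[_ ->] := step_bound x n t0; rewrite andbT.
  set k := (Num.truncn (expR (n%:R * x))).+1.
  have kx : k%:R <= 2 * expR (n%:R * x).
    rewrite /k -natr1 mulrDl mul1r lerD//; first by rewrite truncn_le expR_ge0.
    by rewrite -expR0 ler_expR mulr_ge0.
  have y0 := expR_ge0 (- (n%:R * t)).
  have y1 : expR (- (n%:R * t)) <= 1.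
    by rewrite -expR0 ler_expR oppr_le0 mulr_ge0.
  rewrite (le_trans _ (@bernoulli_inequality _ k _)) ?y0// lerD2l lerN2.
  rewrite (@le_trans _ _ (2 * expR (n%:R * x) * expR (- (n%:R * t))))//.
    by rewrite ler_wpM2r.
  have nx : 0 <= n%:R * (t - x) by rewrite mulr_ge0// subr_ge0 ltW.
  rewrite -mulrA -expRD ler_pM2l// (le_trans _ (expRN_le nx))// ler_expR; lra.
- have h : (1 - 2 * (1 + n%:R * (t - x))^-1) @[n --> \oo] --> (1 - 2 * 0 : R).
    apply: cvgB; first exact: cvg_cst.
    apply: cvgM; first exact: cvg_cst.
    by apply: cvg_inv_linear; rewrite subr_gt0.
  by rewrite mulr0 subr0 in h.
- exact: cvg_cst.
Qed.

Variable phi : R -> R.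
Hypotheses (iphi : mu.-integrable D (EFin \o phi))
  (laplace0 : forall m : nat,
     (\int[mu]_(t in D) (expR (- (m%:R * t)) * phi t)%:E = 0)%E).

Let mphi : measurable_fun D phi.
Proof. by apply/measurable_EFinP; exact: measurable_int iphi. Qed.

Let bounded_integrable (f : R -> R) : measurable_fun setT f ->
  (forall t, 0 <= t -> `|f t| <= 1) ->
  mu.-integrable D (EFin \o (fun t => f t * phi t)).
Proof.
move=> mf f1; apply: le_integrable iphi => //.
  apply/measurable_EFinP; apply: measurable_funM => //.
  exact: measurable_funTS.
move=> t /=; rewrite in_itv/= andbT => t0.
by rewrite lee_fin normrM ler_piMl// f1.
Qed.

Let mexp (c : R) : measurable_fun setT (fun t : R => expR (- (c * t))).
Proof. by apply/measurable_EFinP; exact: measurable_expR_linear. Qed.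

Let powers_integrable k (n m : nat) : mu.-integrable D
  (EFin \o (fun t => (1 - expR (- (n%:R * t))) ^+ k * expR (- (m%:R * t)) * phi t)).
Proof.
apply: bounded_integrable => [|t t0].
  apply: measurable_funM; last exact: mexp.
  by apply: measurable_funX; apply: measurable_funB => //; exact: mexp.
have e01 (c : nat) : 0 <= expR (- (c%:R * t)) <= 1.
  by rewrite expR_ge0 -expR0 ler_expR oppr_le0 mulr_ge0.
have /andP[h1 h2] := e01 n; have /andP[h3 h4] := e01 m.
rewrite ger0_norm ?mulr_ge0 ?exprn_ge0 ?subr_ge0//.
by rewrite mulr_ile1 ?exprn_ge0 ?exprn_ile1 ?subr_ge0 ?gerBl.
Qed.

(** A polynomial in exp (- t) is a combination of the exponentials for which the
    transform vanishes; the binomial is expanded one factor at a time. *)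
Let powers0 k (n m : nat) : (\int[mu]_(t in D)
  ((1 - expR (- (n%:R * t))) ^+ k * expR (- (m%:R * t)) * phi t)%:E = 0)%E.
Proof.
elim: k m => [|k ih] m.
  by rewrite -[RHS](laplace0 m); apply: eq_integral => t _; rewrite expr0 mul1r.
transitivity (\int[mu]_(t in D)
   (((1 - expR (- (n%:R * t))) ^+ k * expR (- (m%:R * t)) * phi t)%:E -
    ((1 - expR (- (n%:R * t))) ^+ k * expR (- ((n + m)%:R * t)) * phi t)%:E))%E.
  apply: eq_integral => t _; rewrite -EFinB natrD mulrDl opprD expRD.
  by congr EFin; rewrite exprS; ring.
rewrite integralB//; [|exact: powers_integrable|exact: powers_integrable].
by rewrite !ih subee.
Qed.

Let tail0 (x : R) : 0 <= x ->
  (\int[mu]_(t in D) ((x < t)%R%:R * phi t)%:E = 0)%E.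
Proof.
move=> x0.
pose f n t : \bar R := (step x n t * phi t)%:E.
have [] := @dominated_convergence _ _ _ mu D (measurable_itv _) f
  (fun t => ((x < t)%R%:R * phi t)%:E) (EFin \o (fun t => `|phi t|)).
- move=> n; apply/measurable_EFinP; apply: measurable_funM => //.
  apply: measurable_funTS; apply: measurable_funX.
  by apply: measurable_funB => //; exact: mexp.
- apply/measurable_EFinP; apply: measurable_funM => //.
  apply: measurable_funTS.
  rewrite (_ : (fun t => _) = \1_(`]x, +oo[%classic : set R)).
    exact: measurable_indic.
  apply/funext => t; rewrite indicE.
  have -> // : (t \in `]x, +oo[%classic) = (x < t).
  by apply/idP/idP; rewrite inE/= in_itv/= andbT.
- exists [set x]; split => //; first exact: lebesgue_measure_set1.
  move=> t /= /not_implyP[]; rewrite in_itv/= andbT => t0 nlim.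
  apply: contrapT => /eqP tx; apply: nlim.
  apply: cvg_EFin; first exact: nearW.
  apply: cvgM; last exact: cvg_cst.
  have [xt|xt|] := ltgtP x t.
  + exact: step_above.
  + exact: step_below.
  + by move=> xt; rewrite xt eqxx in tx.
- have := integrable_abse iphi; apply: eq_integrable => //.
- apply: aeW => t n; rewrite /= in_itv/= andbT => t0.
  rewrite lee_fin normrM ler_piMl//.
  by have /andP[h1 h2] := step_bound x n t0; rewrite ger0_norm.
- move=> _ _ lim.
  have lim0 : [sequence (\int[mu]_(t in D) f n t)%E]_n @ \oo --> 0%E.
    apply: cvg_near_cst; apply: nearW => n /=.
    rewrite -[RHS](powers0 (Num.truncn (expR (n%:R * x))).+1 n 0).
    by apply: eq_integral => t _; rewrite /f /step mul0r oppr0 expR0 mulr1.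
  exact: (cvg_unique _ lim lim0).
Qed.

Let indic_integrable (x : R) :
  mu.-integrable D (EFin \o (fun t => (x < t)%R%:R * phi t)).
Proof.
apply: bounded_integrable => [|t _]; last by rewrite normr_nat; case: (x < t).
rewrite (_ : (fun t => _) = \1_(`]x, +oo[%classic : set R)).
  exact: measurable_indic.
apply/funext => t; rewrite indicE.
have -> // : (t \in `]x, +oo[%classic) = (x < t).
by apply/idP/idP; rewrite inE/= in_itv/= andbT.
Qed.

Let interval0 (a b : R) : 0 <= a -> a <= b ->
  (\int[mu]_(t in `]a, b]) (phi t)%:E = 0)%E.
Proof.
move=> a0 ab.
have DI : D `&` `]a, b] = `]a, b]%classic.
  apply/seteqP; split => t /=; rewrite !in_itv/= andbT; first by case.
  by move=> /andP[at_ tb]; rewrite at_ tb (le_trans a0)// ltW.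
rewrite -DI integral_mkcondr.
transitivity (\int[mu]_(t in D)
    (((a < t)%R%:R * phi t)%:E - ((b < t)%R%:R * phi t)%:E))%E.
  apply: eq_integral => t _; rewrite patchE -EFinB.
  have -> : (t \in `]a, b]%classic) = (a < t) && (t <= b).
    by apply/idP/idP; rewrite inE/= in_itv/=.
  case: (ltP a t) => at_; case: (ltP b t) => bt /=; try (congr EFin; ring).
  by exfalso; have := le_lt_trans (le_trans at_ ab) bt; rewrite ltxx.
rewrite integralB//; [|exact: indic_integrable|exact: indic_integrable].
by rewrite !tail0 ?subee// (le_trans a0).
Qed.

(** Otherwise phi would keep a sign and stay away from 0 on an interval to the
    right of t0, against the vanishing of its integrals over intervals. *)
Lemma laplace_eq0 t0 : 0 <= t0 -> phi s @[s --> t0^'+] --> phi t0 -> phi t0 = 0.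
Proof.
move=> t00 rc; apply/eqP/negPn/negP => phi0.
pose e := `|phi t0| / 2.
have e0 : 0 < e by rewrite divr_gt0 ?normr_gt0.
have /cvgrPdist_le/(_ e e0)[delta /= delta0 hd] := rc.
pose sg := Num.sg (phi t0).
pose a := t0 + delta / 4; pose b := t0 + delta / 2.
have ab : a < b by rewrite /a /b; lra.
have a0 : 0 <= a by rewrite /a; lra.
have low t : a < t <= b -> e <= sg * phi t.
  move=> /andP[at_ tb].
  have h : `|phi t0 - phi t| <= e.
    apply: hd => /=; last by rewrite /a in at_; lra.
    by rewrite /a /b in at_ tb *; rewrite ltr_norml; lra.
  rewrite /sg /e.
  have [p0|p0|p0] := ltgtP 0 (phi t0); last by move: phi0; rewrite -p0 eqxx.
    rewrite gtr0_sg// mul1r; move: h; rewrite /e (gtr0_norm p0) ler_norml; lra.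
  rewrite ltr0_sg// mulN1r; move: h; rewrite /e (ltr0_norm p0) ler_norml; lra.
have := interval0 a0 (ltW ab).
have iI : mu.-integrable `]a, b] (EFin \o phi).
  apply: integrableS iphi => // t /=; rewrite !in_itv/= andbT => /andP[at_ _].
  by rewrite (le_trans a0)// ltW.
move=> I0; have : (\int[mu]_(t in `]a, b]) (sg * phi t)%:E = 0)%E.
  by under eq_integral do rewrite EFinM; rewrite integralZl// I0 mule0.
apply/eqP; rewrite gt_eqF//.
apply: (@lt_le_trans _ _ (\int[mu]_(t in `]a, b]) e%:E)%E).
  rewrite integral_cst//= lebesgue_measure_itv/= lte_fin ab -EFinB -EFinM.
  by rewrite lte_fin mulr_gt0// subr_gt0.
apply: ge0_le_integral => //.
- by move=> t _; rewrite lee_fin ltW.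
- apply/measurable_EFinP; apply: measurable_funM => //.
  by apply/measurable_EFinP; exact: measurable_int iI.
Qed.

End laplace_uniqueness.

(** * The Mittag-Leffler function *)

Section mittag_leffler_laplace.
Context {R : realType}.
Local Notation mu := (@lebesgue_measure R).
Local Notation D := (`[(0:R), +oo[%classic).
Variables (alpha lambda : R).
Hypotheses (alpha0 : 0 < alpha) (lambda0 : 0 < lambda).

Let term (j : nat) (t : R) : R :=
  (- (lambda * t `^ alpha)) ^+ j / Gamma (alpha * j%:R + 1).

Let aj0 j : 0 <= alpha * j%:R. Proof. by rewrite mulr_ge0// ltW. Qed.

Let termE j t : term j t = (- lambda) ^+ j / Gamma (alpha * j%:R + 1) * t `^ (alpha * j%:R).
Proof.
by rewrite /term -mulNr exprMn powRrM powR_mulrn ?powR_ge0// mulrAC.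
Qed.

Let norm_termE j t : `|term j t| =
  lambda ^+ j / Gamma (alpha * j%:R + 1) * t `^ (alpha * j%:R).
Proof.
have G0 := Gamma1_gt0 (aj0 j).
rewrite termE !normrM normrX normrN (gtr0_norm lambda0).
by rewrite (ger0_norm (powR_ge0 _ _)) normfV (gtr0_norm G0).
Qed.

Let measurable_term j : measurable_fun setT (term j).
Proof.
rewrite (_ : term j = fun t => (- lambda) ^+ j / Gamma (alpha * j%:R + 1) *
  t `^ (alpha * j%:R)); last by apply/funext => t; rewrite termE.
by apply: measurable_funM => //; exact: measurable_powR.
Qed.

Let powR_split s j : 0 < s -> s `^ (alpha * j%:R + 1) = (s `^ alpha) ^+ j * s.
Proof.
move=> s0; rewrite powRD ?(gt_eqF s0) ?implybT// powRr1 ?ltW//.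
by rewrite powRrM powR_mulrn ?powR_ge0.
Qed.

Let laplace_norm_term j s : 0 < s ->
  (\int[mu]_(t in D) (expR (- (s * t)) * `|term j t|)%:E =
   ((lambda / s `^ alpha) ^+ j / s)%:E)%E.
Proof.
move=> s0; have G0 := Gamma1_gt0 (aj0 j).
transitivity (\int[mu]_(t in D) ((lambda ^+ j / Gamma (alpha * j%:R + 1))%:E *
    (t `^ (alpha * j%:R) * expR (- (s * t)))%:E))%E.
  by apply: eq_integral => t _; rewrite norm_termE -EFinM; congr EFin; ring.
rewrite ge0_integralZl_EFin//.
- rewrite laplace_powR// -EFinM powR_split// expr_div_n; congr EFin.
  by field; rewrite !gt_eqF ?exprn_gt0 ?powR_gt0.
- by move=> t _; rewrite lee_fin mulr_ge0 ?powR_ge0 ?expR_ge0.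
- apply/measurable_EFinP; apply: measurable_funM.
    by apply: measurable_funTS; exact: measurable_powR.
  by apply/measurable_EFinP; exact: measurable_expR_linear.
- by rewrite divr_ge0 ?exprn_ge0 ?ltW.
Qed.

Let s1 : R := (2 * lambda) `^ alpha^-1.

Let s1_gt0 : 0 < s1. Proof. by rewrite powR_gt0// mulr_gt0. Qed.

Let s1E : s1 `^ alpha = 2 * lambda.
Proof. by rewrite /s1 -powRrM mulVf ?gt_eqF// powRr1// mulr_ge0// ltW. Qed.

(** A term of the series is nondecreasing in absolute value, so it is bounded by
    its Laplace transform at a point where these transforms are geometric. *)
Let term_bound j t : 0 <= t ->
  `|term j t| <= expR s1 / s1 * expR (s1 * t) * 2^-1 ^+ j.
Proof.
move=> t0.
have : ((expR (- (s1 * (t + 1))) * `|term j t|)%:E <= (2^-1 ^+ j / s1)%:E)%E.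
  rewrite (_ : 2^-1 = lambda / s1 `^ alpha); last first.
    by rewrite s1E; field; rewrite gt_eqF.
  rewrite -laplace_norm_term//.
  apply: (@le_trans _ _ (\int[mu]_(u in `[t, (t + 1)%R])
      (expR (- (s1 * (t + 1))) * `|term j t|)%:E)%E).
    rewrite integral_cst//= lebesgue_measure_itv/= lte_fin ltrDl ltr01.
    by rewrite -EFinB addrAC subrr add0r mule1.
  have mf : measurable_fun setT (fun u : R => (expR (- (s1 * u)) * `|term j u|)%:E).
    apply/measurable_EFinP; apply: measurable_funM.
      by apply/measurable_EFinP; exact: measurable_expR_linear.
    by apply: measurableT_comp => //; exact: measurable_term.
  apply: (@le_trans _ _ (\int[mu]_(u in `[t, (t + 1)%R])
      (expR (- (s1 * u)) * `|term j u|)%:E)%E).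
    apply: ge0_le_integral => //.
    - exact: measurable_funTS.
    - move=> u /=; rewrite in_itv/= => /andP[tu ut]; rewrite lee_fin.
      rewrite ler_pM ?expR_ge0//; first by rewrite ler_expR lerN2 ler_pM2l.
      rewrite !norm_termE ler_wpM2l//.
        by rewrite divr_ge0 ?exprn_ge0 ?ltW// Gamma1_gt0.
      by apply: ge0_ler_powR; rewrite ?nnegrE// (le_trans t0).
  apply: ge0_subset_integral => //.
  - exact: measurable_funTS.
  - by move=> u /=; rewrite !in_itv/= andbT => /andP[tu _]; exact: le_trans tu.
rewrite lee_fin => h.
have e : expR (- (s1 * (t + 1))) = (expR s1 * expR (s1 * t))^-1.
  by rewrite expRN -expRD; congr (expR _)^-1; ring.
move: h; rewrite e mulrC ler_pdivrMr ?mulr_gt0 ?expR_gt0// => h.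
by apply: (le_trans h); rewrite le_eqVlt; apply/orP; left; apply/eqP; ring.
Qed.

(** The solution of the fractional relaxation equation with rate lambda. *)
Definition relaxation (t : R) : R := mittag_leffler alpha (- (lambda * t `^ alpha)).

Let partial n (t : R) : R := series (term ^~ t) n.

Let geometric_series_bound n : \sum_(j < n) 2^-1 ^+ j <= 2 :> R.
Proof.
elim: n => [|n ih]; first by rewrite big_ord0.
rewrite big_ord_recl/= expr0.
under eq_bigr do rewrite exprS.
rewrite -mulr_sumr; lra.
Qed.

Let C : R := expR s1 / s1.

Let C0 : 0 < C. Proof. by rewrite divr_gt0 ?expR_gt0. Qed.

Let partial_bound n m t : 0 <= t -> (n <= m)%N ->
  `|partial m t - partial n t| <= 2 * C * expR (s1 * t) * 2^-1 ^+ n.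
Proof.
move=> t0 nm; rewrite /partial sub_series_geq//.
rewrite (le_trans (ler_norm_sum _ _ _))//.
rewrite (le_trans (ler_sum _ (fun j _ => term_bound j t0)))//.
rewrite -mulr_sumr -(add0n n) big_addn big_mkord.
under eq_bigr do rewrite exprD.
rewrite -mulr_suml -/C.
have := geometric_series_bound (m - n).
set S := \sum_(_ < _) _ => S2.
rewrite (_ : 2 * C * expR (s1 * t) * 2^-1 ^+ n = C * expR (s1 * t) * (2 * 2^-1 ^+ n)); last by ring.
apply: ler_wpM2l; first by rewrite mulr_ge0 ?expR_ge0// ltW.
by apply: ler_wpM2r => //; exact: exprn_ge0.
Qed.

Let geometric_cvg (c : R) : c * 2^-1 ^+ n @[n --> \oo] --> (0 : R).
Proof.
rewrite -(mulr0 c); apply: cvgM; first exact: cvg_cst.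
by apply: cvg_expr; rewrite ger0_norm ?invr_ge0// invf_lt1// ltr1n.
Qed.

Let partial_cvg t : 0 <= t -> partial n t @[n --> \oo] --> relaxation t.
Proof.
move=> t0; suff : cvgn (series (term ^~ t)) by [].
apply: normed_cvg.
apply: (@series_le_cvg _ _ (geometric (C * expR (s1 * t)) 2^-1)).
- by move=> n; exact: normr_ge0.
- move=> n; rewrite /geometric/= mulr_ge0 ?exprn_ge0// mulr_ge0 ?expR_ge0// ltW//.
- by move=> n; exact: term_bound.
- apply: is_cvg_geometric_series.
  by rewrite ger0_norm ?invr_ge0// invf_lt1// ltr1n.
Qed.

Let relaxation_partial n t : 0 <= t ->
  `|relaxation t - partial n t| <= 2 * C * expR (s1 * t) * 2^-1 ^+ n.
Proof.
move=> t0.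
have h : `|partial m t - partial n t| @[m --> \oo] --> `|relaxation t - partial n t|.
  by apply: cvg_norm; apply: cvgB; [exact: partial_cvg|exact: cvg_cst].
apply: (cvgr_to_le h); near=> m.
by apply: partial_bound => //; near: m; exact: nbhs_infty_ge.
Unshelve. all: by end_near. Qed.

Lemma relaxation0 : relaxation 0 = 1.
Proof.
apply: (cvg_unique _ (partial_cvg (lexx 0))) => //.
apply: cvg_near_cst; near=> n.
have n0 : (0 < n)%N by near: n; exact: nbhs_infty_gt.
rewrite /partial /series/= big_ltn// big_nat_cond big1 ?addr0.
  by rewrite /term expr0 mulr0 add0r Gamma1 invr1 mulr1.
move=> j /andP[/andP[j0 _] _]; rewrite /term powR0 ?gt_eqF// mulr0 oppr0.
by rewrite expr0n gtn_eqF// mul0r.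
Unshelve. all: by end_near. Qed.

Let powR_right_continuous t : 0 <= t -> s `^ alpha @[s --> t^'+] --> t `^ alpha.
Proof.
rewrite le_eqVlt => /predU1P[<-|t0].
  by rewrite powR0 ?gt_eqF//; exact: powR_cvg0.
apply: cvg_at_right_filter.
have /derivable1_diffP/differentiable_continuous : derivable (@powR R ^~ alpha) t 1.
  by apply: derivable_powR; rewrite in_itv/= andbT.
exact.
Qed.

Let partial_right_continuous n t : 0 <= t ->
  partial n s @[s --> t^'+] --> partial n t.
Proof.
move=> t0; rewrite /partial; elim: n => [|j ihn].
  rewrite (_ : (fun s => _) = cst 0); first by rewrite /series/= big_geq//; exact: cvg_cst.
  by apply/funext => s; rewrite /series/= big_geq.
under eq_fun do rewrite seriesSr; rewrite seriesSr; apply: cvgD => //.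
apply: cvgM; last exact: cvg_cst.
have h : - (lambda * s `^ alpha) @[s --> t^'+] --> - (lambda * t `^ alpha).
  by apply: cvgN; apply: cvgM; [exact: cvg_cst|exact: powR_right_continuous].
elim: j {ihn} => [|j ih]; first by rewrite expr0; under eq_fun do rewrite expr0; exact: cvg_cst.
by rewrite exprS; under eq_fun do rewrite exprS; exact: cvgM.
Qed.

Lemma relaxation_right_continuous t : 0 <= t ->
  relaxation s @[s --> t^'+] --> relaxation t.
Proof.
move=> t0; apply/cvgrPdist_le => e e0.
pose B : R := 2 * C * expR (s1 * (t + 1)).
have e3 : 0 < e / 3 by rewrite divr_gt0.
have [N _ hN] : \forall n \near \oo, B * 2^-1 ^+ n <= e / 3.
  by apply: (cvgr_le 0); [exact: geometric_cvg|].
have {}hN := hN N (leqnn N).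
have Bs s : 0 <= s -> s <= t + 1 -> `|relaxation s - partial N s| <= e / 3.
  move=> s0 st; rewrite (le_trans (relaxation_partial N s0))// (le_trans _ hN)//.
  apply: ler_wpM2r; first exact: exprn_ge0.
  apply: ler_wpM2l; first by rewrite mulr_ge0// ltW.
  by rewrite ler_expR ler_pM2l.
near=> s.
have ts : t <= s by near: s; exact: nbhs_right_ge.
have h1 : `|relaxation t - partial N t| <= e / 3 by apply: Bs => //; lra.
have h2 : `|relaxation s - partial N s| <= e / 3.
  apply: Bs; first exact: le_trans ts.
  by near: s; apply: nbhs_right_le; lra.
have h3 : `|partial N t - partial N s| <= e / 3.
  near: s; by move/cvgrPdist_le : (@partial_right_continuous N t t0); apply.
move: h1 h2 h3; rewrite !ler_norml; lra.
Unshelve. all: by end_near. Qed.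

Lemma relaxation_bound t : 0 <= t -> `|relaxation t| <= 2 * C * expR (s1 * t).
Proof.
move=> t0; have := relaxation_partial 0 t0.
by rewrite /partial /series/= big_geq// subr0 expr0 mulr1.
Qed.

Let measurable_partial n : measurable_fun setT (partial n).
Proof. by apply: measurable_sum => j; exact: measurable_term. Qed.

Let majorant s (t : R) : \bar R := ((2 * C)%:E * (expR (- ((s - s1) * t)))%:E)%E.

Let majorant_integrable s : s1 < s -> mu.-integrable D (majorant s).
Proof.
move=> ss; apply: integrableZl => //; apply/integrableP; split.
  exact: measurable_expR_linear.
under eq_integral do rewrite gee0_abs ?lee_fin ?expR_ge0//.
by rewrite integral_expR ?subr_gt0// ltry.
Qed.

Let majorantE s f t : `|f| <= 2 * C * expR (s1 * t) ->
  (`|(expR (- (s * t)) * f)%:E| <= majorant s t)%E.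
Proof.
move=> fb; rewrite /majorant -EFinM lee_fin normrM (ger0_norm (expR_ge0 _)).
rewrite (_ : - ((s - s1) * t) = - (s * t) + s1 * t); last by ring.
by rewrite expRD mulrCA ler_wpM2l ?expR_ge0.
Qed.

Let integrable_expRM s (f : R -> R) : s1 < s -> measurable_fun D f ->
  (forall t, 0 <= t -> `|f t| <= 2 * C * expR (s1 * t)) ->
  mu.-integrable D (fun t => (expR (- (s * t)) * f t)%:E).
Proof.
move=> ss mf fb; apply: le_integrable (majorant_integrable ss) => //.
  apply/measurable_EFinP; apply: measurable_funM => //.
  by apply/measurable_EFinP; exact: measurable_expR_linear.
move=> t /=; rewrite in_itv/= andbT => t0.
by rewrite (le_trans (majorantE _ (fb t t0)))// lee_abs.
Qed.

Let partial0_bound n t : 0 <= t -> `|partial n t| <= 2 * C * expR (s1 * t).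
Proof.
move=> t0; have := partial_bound t0 (leq0n n).
by rewrite {2}/partial /series/= big_geq// subr0 expr0 mulr1.
Qed.

Let term0_bound j t : 0 <= t -> `|term j t| <= 2 * C * expR (s1 * t).
Proof.
move=> t0; rewrite (le_trans (term_bound j t0))// -/C.
have := C0; have e0 := expR_ge0 (s1 * t) => c0.
have h : 2^-1 ^+ j <= 1 :> R by rewrite exprn_ile1// invf_le1// ler1n.
rewrite (@le_trans _ _ (C * expR (s1 * t)))//.
  by rewrite ler_piMr// mulr_ge0// ltW.
have : 0 <= C * expR (s1 * t) by rewrite mulr_ge0// ltW.
lra.
Qed.

Let laplace_partial n s : s1 < s ->
  (\int[mu]_(t in D) (expR (- (s * t)) * partial n t)%:E =
   (series (geometric s^-1 (- (lambda / s `^ alpha))) n)%:E)%E.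
Proof.
move=> ss; have s0 := lt_trans s1_gt0 ss.
elim: n => [|n ih].
  rewrite /series/= big_geq// (eq_integral (cst 0%E)) ?integral0// => t _.
  by rewrite /partial /series/= big_geq// mulr0.
rewrite seriesSr EFinD -ih.
transitivity (\int[mu]_(t in D) ((expR (- (s * t)) * partial n t)%:E +
    (expR (- (s * t)) * term n t)%:E))%E.
  by apply: eq_integral => t _; rewrite -EFinD -mulrDr /partial seriesSr.
have mt : measurable_fun D (term n) by exact: measurable_funTS.
have it := integrable_expRM ss mt (@term0_bound n).
have ip := integrable_expRM ss (measurable_funTS (measurable_partial n))
  (@partial0_bound n).
rewrite integralD//; congr (_ + _)%E.
transitivity (\int[mu]_(t in D) (((-1) ^+ n)%:E *
    (expR (- (s * t)) * `|term n t|)%:E))%E.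
  apply: eq_integral => t _; rewrite -EFinM; congr EFin.
  rewrite norm_termE termE (exprNn lambda); ring.
rewrite integralZl//; last first.
  by apply: integrable_expRM => // [|t t0]; [exact: measurableT_comp|
    rewrite normr_id; exact: term0_bound].
rewrite laplace_norm_term// -EFinM /geometric/= (exprNn (lambda / _)).
by congr EFin; ring.
Qed.

Lemma measurable_relaxation : measurable_fun D relaxation.
Proof.
apply: (measurable_fun_cvg (h := partial)) => [n|t /=].
  exact: measurable_funTS.
by rewrite in_itv/= andbT; exact: partial_cvg.
Qed.

(** The term of order j contributes s^-1 (- lambda / s^alpha)^j, and the series of
    these contributions is geometric once s^alpha exceeds lambda. *)
Lemma relaxation_laplace : exists2 s2 : R, 0 < s2 & forall s, s2 < s ->
  mu.-integrable D (fun t => (expR (- (s * t)) * relaxation t)%:E) /\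
  (\int[mu]_(t in D) (expR (- (s * t)) * relaxation t)%:E =
   (s `^ alpha / s / (s `^ alpha + lambda))%:E)%E.
Proof.
exists s1 => // s ss; have s0 := lt_trans s1_gt0 ss.
have sa : lambda < s `^ alpha.
  have : s1 `^ alpha < s `^ alpha.
    by apply: gt0_ltr_powR; rewrite ?nnegrE ?(ltW s1_gt0) ?(ltW s0).
  by rewrite s1E; have := lambda0; lra.
split; first by apply: integrable_expRM => //;
  [exact: measurable_relaxation|exact: relaxation_bound].
have [] := @dominated_convergence _ _ _ mu D (measurable_itv _)
  (fun n t => (expR (- (s * t)) * partial n t)%:E)
  (fun t => (expR (- (s * t)) * relaxation t)%:E) (majorant s).
- move=> n; apply/measurable_EFinP; apply: measurable_funM.
    by apply/measurable_EFinP; exact: measurable_expR_linear.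
  exact: (measurable_funTS (measurable_partial n)).
- apply/measurable_EFinP; apply: measurable_funM.
    by apply/measurable_EFinP; exact: measurable_expR_linear.
  exact: measurable_relaxation.
- apply: aeW => t /=; rewrite in_itv/= andbT => t0.
  apply: cvg_EFin; first exact: nearW.
  by apply: cvgM; [exact: cvg_cst|exact: partial_cvg].
- exact: majorant_integrable.
- apply: aeW => t n /=; rewrite in_itv/= andbT => t0.
  by apply: majorantE; exact: partial0_bound.
move=> _ _ lim; apply: (cvg_unique _ lim) => //.
rewrite (_ : (fun n => _) = EFin \o
    series (geometric s^-1 (- (lambda / s `^ alpha)))); last first.
  by apply/funext => n; exact: laplace_partial.
apply: cvg_EFin; first exact: nearW.
have sa0 : 0 < s `^ alpha by exact: lt_trans sa.
have -> : s `^ alpha / s / (s `^ alpha + lambda) =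
    s^-1 / (1 - - (lambda / s `^ alpha)).
  have n1 : s `^ alpha + lambda != 0 by rewrite gt_eqF// addr_gt0.
  have n2 : s `^ alpha != 0 by rewrite gt_eqF.
  have n3 : s != 0 by rewrite gt_eqF.
  by field; rewrite ?opprK n1 n2 n3.
have q1 : `|- (lambda / s `^ alpha)| < 1.
  by rewrite normrN gtr0_norm ?divr_gt0// ltr_pdivrMr// mul1r.
exact: (@cvg_geometric_series R s^-1 _ q1).
Qed.

End mittag_leffler_laplace.

(** * The subordinator at an independent exponential time *)

Section survival_functions.
Context {R : realType} {disp : measure_display} {T : measurableType disp}.
Variable Q : probability T R.
Local Notation mu := (@lebesgue_measure R).
Local Notation D := (`[(0:R), +oo[%classic).

Lemma laplace_exchange (s : R) (g : measurableTypeR R * T -> \bar R) :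
  measurable_fun setT g -> (forall p, (0 <= g p)%E) ->
  (\int[mu]_(t in D) ((expR (- (s * t)))%:E * \int[Q]_w g (t, w)) =
   \int[Q]_w \int[mu]_(t in D) ((expR (- (s * t)))%:E * g (t, w)))%E.
Proof.
move=> mg g0.
pose wt (t : R) : \bar R := (expR (- (s * t)) * \1_D t)%:E.
have wt0 t : (0 <= wt t)%E by rewrite lee_fin mulr_ge0 ?expR_ge0.
have mwt : measurable_fun setT wt.
  apply/measurable_EFinP; apply: measurable_funM.
    by apply/measurable_EFinP; exact: measurable_expR_linear.
  exact: measurable_indic.
have wtE (F : R -> \bar R) :
    (\int[mu]_(t in D) ((expR (- (s * t)))%:E * F t) = \int[mu]_t (wt t * F t))%E.
  rewrite integral_mkcond; apply: eq_integral => t _.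
  rewrite patchE /wt indicE; case: (t \in D); first by rewrite mulr1.
  by rewrite mulr0 mul0e.
rewrite wtE.
transitivity (\int[mu]_t \int[Q]_w (wt t * g (t, w)))%E.
  apply: eq_integral => t _; rewrite ge0_integralZl//.
  exact: (measurable_fun_pair2 t mg).
rewrite (@fubini_tonelli _ _ (measurableTypeR R) T R mu Q (fun p => wt p.1 * g p)%E).
- by apply: eq_integral => w _; rewrite wtE.
- apply: emeasurable_funM => //.
  apply: (measurableT_comp (f := wt) (g := fun p : measurableTypeR R * T => p.1)) => //.
  exact: measurable_fst.
- by move=> p; rewrite mule_ge0.
Qed.

(** Fubini on the region between 0 and the graph of Y. *)
Lemma laplace_survival (Y : T -> R) (s : R) : 0 < s ->
  measurable_fun setT Y -> (forall w, 0 <= Y w) ->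
  (\int[mu]_(t in D) ((expR (- (s * t)))%:E * Q [set w | t < Y w]%R) =
   \int[Q]_w ((1 - expR (- (s * Y w))) / s)%:E)%E.
Proof.
move=> s0 mY Y0.
pose S := [set p : measurableTypeR R * T | p.1 < Y p.2].
have mS : measurable S.
  apply: (measurable_strict_sublevel
    (f := fun p : measurableTypeR R * T => p.1%:E) (g := fun p => (Y p.2)%:E)).
    by apply/measurable_EFinP; exact: measurable_fst.
  by apply/measurable_EFinP; apply: (measurableT_comp mY); exact: measurable_snd.
have mg : measurable_fun setT (fun p => (\1_S p : R)%:E).
  by apply/measurable_EFinP; exact: measurable_indic.
have g0 p : (0 <= (\1_S p : R)%:E)%E by rewrite lee_fin.
transitivity (\int[mu]_(t in D) ((expR (- (s * t)))%:E *
    \int[Q]_w (\1_S (t, w))%:E))%E.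
  apply: eq_integral => t _; congr (_ * _)%E.
  rewrite (_ : (fun w => _) = fun w => (\1_[set w | t < Y w] w)%:E).
    rewrite integral_indic ?setIT//.
    by rewrite -[X in measurable X]setTI; exact: measurable_fun_ltr.
  by apply/funext => w; rewrite !indicE; congr (_%:R%:E); apply/idP/idP; rewrite !inE.
rewrite (laplace_exchange s mg g0); apply: eq_integral => w _.
rewrite -integral_expR_itv//.
have DI : D `&` `[0, Y w[ = `[0, Y w[%classic.
  by apply/seteqP; split => t /=; rewrite !in_itv/= andbT; [case|case/andP=> -> ->].
rewrite -DI integral_mkcondr; apply: eq_integral => t; rewrite inE/= in_itv/= andbT => t0.
rewrite patchE indicE.
have -> : ((t, w) \in S) = (t \in `[0, Y w[%classic).
  by apply/idP/idP; rewrite !inE/= in_itv/= t0.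
by case: ifP => _; rewrite ?mule1 ?mule0.
Qed.

End survival_functions.

Section mixture.
Context {R : realType} {disp : measure_display} {T : measurableType disp}.
Variables (alpha lambda : R) (H : R -> T -> R) (Q : probability T R)
  (e Z : T -> \bar R).
Local Notation mu := (@lebesgue_measure R).
Local Notation D := (`[(0:R), +oo[%classic).
Hypotheses (alpha0 : 0 < alpha) (lambda0 : 0 < lambda)
  (sH : stable_subordinator alpha H Q)
  (me : measurable_fun setT e) (e0 : forall w, 0 <= fine (e w))
  (e_tail : forall t, 0 <= t -> Q [set w | (t%:E < e w)%E] = (expR (- (t * lambda)))%:E)
  (mZ : measurable_fun setT Z)
  (Z_mixture : forall A, measurable A ->
     Q (Z @^-1` A) = (\int[Q]_w mixed_law H Q A (e w))%E).

Let survival (t : R) : R := fine (Q [set w | (t%:E < Z w)%E]).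

Let mZt t : measurable [set w | (t%:E < Z w)%E].
Proof. exact: measurable_strict_sublevel. Qed.

Let survivalE t : (survival t)%:E = Q [set w | (t%:E < Z w)%E].
Proof. by rewrite fineK// fin_num_measure. Qed.

Let survival_ge0 t : 0 <= survival t. Proof. by rewrite fine_ge0. Qed.

Let survival_noninc s t : s <= t -> survival t <= survival s.
Proof.
move=> st; rewrite -lee_fin !survivalE le_measure ?inE// => w /=.
by apply: le_lt_trans; rewrite lee_fin.
Qed.

Let survival_right_continuous t : survival s @[s --> t^'+] --> survival t.
Proof.
pose F n := [set w | ((t + n.+1%:R^-1)%:E < Z w)%E].
have UF : \bigcup_n F n = [set w | (t%:E < Z w)%E].
  apply/seteqP; split => [w [n _] /=|w /= tZ].
    by apply: lt_trans; rewrite lte_fin ltrDl.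
  have [z tz zZ] : exists2 z : R, t < z & (z%:E <= Z w)%E.
    case: (Z w) tZ => [z| |//]; first by rewrite lte_fin => tz; exists z.
    by move=> _; exists (t + 1); rewrite ?ltrDl// leey.
  have zt0 : 0 < z - t by rewrite subr_gt0.
  have [N _ /(_ N (leqnn N)) /= hN] := near_infty_natSinv_lt (PosNum zt0).
  exists N => //=; apply: lt_le_trans zZ.
  by rewrite lte_fin -ltrBrDl.
have ndF : nondecreasing_seq F.
  move=> m n mn; apply/subsetPset => w; apply: le_lt_trans.
  by rewrite lee_fin lerD2l lef_pV2 ?posrE// ler_nat ltnS.
have := nondecreasing_cvg_mu (mu := Q) (fun n => mZt _) _ ndF.
rewrite UF => /(_ (mZt t)).
rewrite -[X in _ --> X](survivalE t) (_ : Q \o F = EFin \o (fun n => survival (t + n.+1%:R^-1))); last first.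
  by apply/funext => n; rewrite /= survivalE.
move=> /fine_cvg lim; apply/cvgrPdist_le => eps eps0.
move/cvgrPdist_le : lim => /(_ _ eps0)[N _ /(_ N (leqnn N)) /= hN].
near=> s.
have ts : t <= s by near: s; exact: nbhs_right_ge.
have sN : s <= t + N.+1%:R^-1.
  by near: s; apply: nbhs_right_le; rewrite ltrDl.
have := survival_noninc ts; have := survival_noninc sN.
by move: hN; rewrite !ler_norml; lra.
Unshelve. all: by end_near. Qed.

(** The tails of e tend to 0, so e is almost surely finite. *)
Let fine_tail t : 0 <= t ->
  Q [set w | t < fine (e w)] = (expR (- (t * lambda)))%:E.
Proof.
move=> t0; rewrite -e_tail//.
have me_oo : measurable (e @^-1` [set +oo%E]).
  by rewrite -[X in measurable X]setTI; exact: me.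
have Qoo : Q (e @^-1` [set +oo%E]) = 0%E.
  apply/eqP; rewrite eq_le measure_ge0 andbT; apply/lee_addgt0Pr => x x0.
  rewrite add0e; pose n := Num.truncn (- ln x / lambda).
  apply: (@le_trans _ _ (Q [set w | (n.+1%:R%:E < e w)%E])).
    apply: le_measure; rewrite ?inE//; first exact: measurable_strict_sublevel.
    by move=> w /= ->; rewrite ltry.
  rewrite e_tail// lee_fin -[leRHS]lnK ?posrE// ler_expR lerNl.
  by rewrite -ler_pdivrMr// ltW// truncnS_gt.
apply: ae_eq_probability; first 2 last.
- (* The value of fine at +oo is 0, so the two tails differ there. *)
  exists (e @^-1` [set +oo%E]); split => // w /= h; apply: contrapT => eoo.
  apply: h; case: (e w) eoo (e0 w) => [r|//|]; first by rewrite lte_fin.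
  by rewrite /= => _ _; split => //; rewrite ltNge t0.
- by rewrite -[X in measurable X]setTI; apply: measurable_fun_ltr => //;
    exact: measurableT_comp.
- exact: measurable_strict_sublevel.
Qed.

Let laplace_exponential s : 0 < s ->
  (\int[Q]_w ((1 - expR (- (s * fine (e w)))) / s)%:E = ((s + lambda)^-1)%:E)%E.
Proof.
move=> s0; rewrite -laplace_survival//; last exact: measurableT_comp.
rewrite -integral_expR ?addr_gt0//; apply: eq_integral => t.
rewrite inE/= in_itv/= andbT => t0; rewrite fine_tail// -EFinM -expRD.
by congr (expR _)%:E; ring.
Qed.

Let law_tail t u : 0 <= u ->
  (subordinator_law H Q `]t, +oo[ u)%:E = Q [set w | t < H u w].
Proof.
move=> u0; rewrite (subordinator_lawE sH)//; congr (Q _).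
by apply/seteqP; split => w /=; rewrite in_itv/= andbT.
Qed.

(** The Laplace exponent of H replaces the rate s by s^alpha. *)
Let laplace_subordinator s u : 0 < s -> 0 <= u ->
  (\int[mu]_(t in D) ((expR (- (s * t)))%:E *
     (subordinator_law H Q `]t, +oo[ u)%:E) =
   ((1 - expR (- (s `^ alpha * u))) / s)%:E)%E.
Proof.
move=> s0 u0; have mHu := subordinator_measurable sH u0.
have Hu0 w : 0 <= H u w.
  by rewrite -(subordinator_start sH w) (subordinator_nondecreasing sH).
under eq_integral do rewrite law_tail//.
rewrite laplace_survival//.
have mE : measurable_fun setT (fun w => expR (- (s * H u w))).
  apply: (measurableT_comp (@measurable_expR R)); apply: measurable_funN.
  exact: measurable_funM.
have E1 w : expR (- (s * H u w)) <= 1.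
  by rewrite -expR0 ler_expR oppr_le0 mulr_ge0// ltW.
have iE : Q.-integrable setT (fun w => (expR (- (s * H u w)))%:E).
  apply: (le_integrable measurableT (g := EFin \o cst 1)).
  - exact/measurable_EFinP.
  - by move=> w _; rewrite /= lee_fin ger0_norm ?expR_ge0// normr1.
  - exact: finite_measure_integrable_cst.
under eq_integral do rewrite mulrC EFinM.
rewrite ge0_integralZl_EFin//; first last.
- by rewrite invr_ge0 ltW.
- by apply/measurable_EFinP; exact: measurable_funB.
- by move=> w _; rewrite lee_fin subr_ge0.
rewrite [RHS]EFinM muleC; congr (_ * _)%E.
rewrite integralB_EFin//; last exact: finite_measure_integrable_cst.
rewrite EFinB; congr (_ - _)%E.
  by transitivity (1%:E * Q setT)%E; [exact: integral_cst|rewrite probability_setT mule1].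
have := subordinator_laplace sH (ltW s0) u0; rewrite /Rintegral mulrC => <-.
by rewrite fineK//; exact: integrable_fin_num.
Qed.

Let tail_law t w : mixed_law H Q `]t%:E, +oo%E]%classic (e w) =
  (subordinator_law H Q `]t, +oo[ (fine (e w)))%:E.
Proof.
rewrite /mixed_law; congr (subordinator_law _ _ _ _)%:E.
by apply/seteqP; split => y /=; rewrite !in_itv/= ?andbT ?lte_fin ?leey ?andbT.
Qed.

Let g (p : measurableTypeR R * T) : \bar R :=
  (subordinator_law H Q `]p.1, +oo[ (fine (e p.2)))%:E.

Let measurable_g : measurable_fun setT g.
Proof.
pose S := [set q : (measurableTypeR R * T) * T |
  (q.1.1%:E < (H (Num.max 0 (fine (e q.1.2))) q.2)%:E)%E].
have mS : measurable S.
  apply: measurable_strict_sublevel; apply/measurable_EFinP.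
    apply: (measurableT_comp (f := fst : measurableTypeR R * T -> _)); last exact: measurable_fst.
    exact: measurable_fst.
  apply: (measurableT_comp (f := fun p : measurableTypeR R * T => H (Num.max 0 p.1) p.2)
    (g := fun q : (measurableTypeR R * T) * T => (fine (e q.1.2), q.2))).
    exact: (subordinator_jointly_measurableT sH).
  apply: measurable_fun_pair; last exact: measurable_snd.
  apply: (measurableT_comp (@fine_measurable R setT measurableT)).
  apply: (measurableT_comp me); apply: (measurableT_comp (f := snd : measurableTypeR R * T -> _)).
    exact: measurable_snd.
  exact: measurable_fst.
have := measurable_fun_xsection Q mS.
apply: eq_measurable_fun => -[t w] _; rewrite /g /= law_tail//.
congr (Q _); apply/seteqP; split => w' /=.
  by move/xsectionP; rewrite /S/= lte_fin max_r.
by move=> h; apply/xsectionP; rewrite /S/= lte_fin max_r.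
Qed.

Let survival_g t : (survival t)%:E = (\int[Q]_w g (t, w))%E.
Proof.
rewrite survivalE.
rewrite (_ : mkset _ = Z @^-1` `]t%:E, +oo%E]%classic); last first.
  by apply/seteqP; split => w /=; rewrite in_itv/= leey andbT.
rewrite Z_mixture; last exact: emeasurable_itv.
by apply: eq_integral => w _; rewrite tail_law.
Qed.

Let laplace_survival_Z s : 0 < s ->
  (\int[mu]_(t in D) (expR (- (s * t)) * survival t)%:E =
   (s `^ alpha / s / (s `^ alpha + lambda))%:E)%E.
Proof.
move=> s0; have sa0 : 0 < s `^ alpha by rewrite powR_gt0.
under eq_integral do rewrite EFinM survival_g.
rewrite (laplace_exchange Q s measurable_g); last first.
  by move=> p; rewrite lee_fin subordinator_law_ge0.
under eq_integral do rewrite (laplace_subordinator s0 (e0 _)).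
transitivity (\int[Q]_w ((s `^ alpha / s)%:E *
    ((1 - expR (- (s `^ alpha * fine (e w)))) / s `^ alpha)%:E))%E.
  apply: eq_integral => w _; rewrite -EFinM; congr _%:E.
  by field; rewrite !gt_eqF.
rewrite ge0_integralZl_EFin//; first last.
- by rewrite divr_ge0 ?ltW.
- apply/measurable_EFinP; apply: measurable_funM => //; apply: measurable_funB => //.
  apply: (measurableT_comp (@measurable_expR R)); apply: measurable_funN.
  by apply: measurable_funM => //; exact: measurableT_comp.
- move=> w _; rewrite lee_fin; apply: divr_ge0; last exact: ltW.
  rewrite subr_ge0 -expR0 ler_expR oppr_le0.
  by rewrite mulr_ge0// ltW.
by rewrite laplace_exponential// -EFinM.
Qed.

Let measurable_survival : measurable_fun D survival.
Proof. by apply: nonincreasing_measurable => // s t _ _; exact: survival_noninc. Qed.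

(** The transforms agree for s > s2; multiplying by exp (- (s2 + 1) t) moves all
    the transforms at nonnegative integers into this range. *)
Lemma mixture_survival t : 0 <= t ->
  Q [set w | (t%:E < Z w)%E] = (mittag_leffler alpha (- (lambda * t `^ alpha)))%:E.
Proof.
move=> t0; rewrite -survivalE; congr _%:E; apply/eqP.
rewrite -[X in _ == X]/(relaxation alpha lambda t) -subr_eq0.
have [s2 s2_gt0 laplace_relaxation] := relaxation_laplace alpha0 lambda0.
pose s0 := s2 + 1; have s0_gt0 : 0 < s0 by rewrite addr_gt0.
pose phi t := expR (- (s0 * t)) * (survival t - relaxation alpha lambda t).
have cE : continuous (fun t : R => expR (- (s0 * t))).
  move=> u; apply: continuous_comp; last exact: continuous_expR.
  by apply: cvgN; apply: cvgM; [exact: cvg_cst|exact: cvg_id].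
have iS s : 0 < s -> mu.-integrable D (fun t => (expR (- (s * t)) * survival t)%:E).
  move=> s_gt0; apply/integrableP; split.
    apply/measurable_EFinP; apply: measurable_funM => //.
    by apply/measurable_EFinP; exact: measurable_expR_linear.
  under eq_integral do rewrite abse_EFin ger0_norm ?mulr_ge0 ?expR_ge0//.
  by rewrite laplace_survival_Z// ltry.
have phi_s s u : expR (- (s * u)) * phi u =
    expR (- ((s + s0) * u)) * survival u - expR (- ((s + s0) * u)) * relaxation alpha lambda u.
  have -> : expR (- ((s + s0) * u)) = expR (- (s * u)) * expR (- (s0 * u)).
    by rewrite -expRD; congr expR; ring.
  by rewrite /phi; ring.
have s_s2 (s : R) : 0 <= s -> s2 < s + s0 /\ 0 < s + s0 by rewrite /s0; lra.
have iphi : mu.-integrable D (EFin \o phi).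
  have [h1 h2] := s_s2 _ (lexx 0).
  have := @integrableB _ _ R mu D (measurable_itv _) _ _ (iS _ h2) (laplace_relaxation _ h1).1.
  apply: eq_integrable => // u _; rewrite /= -EFinB -phi_s mul0r oppr0 expR0 mul1r.
  by [].
have phi0 : phi t = 0.
  apply: (laplace_eq0 iphi) => //.
    move=> m; have [h1 h2] := s_s2 _ (ler0n R m).
    under eq_integral do rewrite phi_s EFinB.
    rewrite integralB//; [|exact: iS|exact: (laplace_relaxation _ h1).1].
    by rewrite laplace_survival_Z// (laplace_relaxation _ h1).2 subee.
  apply: cvgM; first by apply: cvg_at_right_filter; exact: cE.
  apply: cvgB; first exact: survival_right_continuous.
  exact: relaxation_right_continuous.
by move/eqP: phi0; rewrite mulf_eq0 gt_eqF ?expR_gt0.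
Qed.

Lemma mixture_mittag_leffler : mittag_leffler_rv Q alpha lambda Z.
Proof.
split => //; last exact: mixture_survival.
have : Q [set w | (0%:E < Z w)%E] = 1%E.
  rewrite mixture_survival//.
  exact: congr1 (relaxation0 alpha0 lambda0).
move=> Z1; exists (~` [set w | (0%:E < Z w)%E]); split => //.
- by apply: measurableC.
- rewrite probability_setC//.
  by rewrite [X in (_ - X)%E]Z1 subee.
Qed.

End mixture.

(** * Proof of the theorem *)

Section tails.
Context {R : realType} {disp : measure_display} {T : measurableType disp}.

(** The rays are a pi-system generating the Borel sets of the extended line;
    the whole space is added to it because the rays miss -oo. *)
Lemma law_determined_by_tails (Q : probability T R) (Y Z : T -> \bar R) :
  measurable_fun setT Y -> measurable_fun setT Z ->
  (forall t : R, Q [set w | (t%:E < Y w)%E] = Q [set w | (t%:E < Z w)%E]) ->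
  forall A, measurable A -> Q (Y @^-1` A) = Q (Z @^-1` A).
Proof.
move=> mY mZ tails A mA.
pose Y' : {mfun T >-> \bar R} := HB.pack Y (isMeasurableFun.Build _ _ _ _ _ mY).
pose Z' : {mfun T >-> \bar R} := HB.pack Z (isMeasurableFun.Build _ _ _ _ _ mZ).
pose rays : set (set (\bar R)) := [set B | B = setT \/ exists t : R, B = `]t%:E, +oo[%classic].
have genE : @measurable _ (\bar R) = <<s rays >>.
  transitivity (<<s @ErealGenOInfty.G R >>); first exact: (ErealGenOInfty.measurableE R).
  apply/seteqP; split.
    by apply: sub_sigma_algebra2 => _ [t ->]; right; exists t.
  apply: smallest_sub; first exact: smallest_sigma_algebra.
  move=> B [->|[t ->]]; first exact: (@measurableT _ (g_sigma_algebraType _)).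
  by apply: sub_sigma_algebra; exists t.
apply: (@measure_unique _ R _ rays (fun=> setT) genE _ _ _
  (distribution Q Y') (distribution Q Z')) => //.
- move=> B C [->|[s ->]] [->|[t ->]]; rewrite ?setTI ?setIT.
  + by left.
  + by right; exists t.
  + by right; exists s.
  + right; exists (Num.max s t); apply/seteqP; split => y /=.
      rewrite !in_itv/= !andbT => -[sy ty].
      by case: (leP s t) => _.
    rewrite !in_itv/= !andbT => sty.
    by split; apply: le_lt_trans sty; rewrite lee_fin le_max lexx ?orbT.
- by move=> _; left.
- by rewrite bigcup_const.
- move=> _ [->|[t ->]]; first by [].
  have := tails t; rewrite /distribution/= /pushforward.
  by congr (Q _ = Q _); apply/seteqP; split => w /=; rewrite in_itv/= andbT.
- by move=> _; apply: (le_lt_trans (probability_le1 _ measurableT)); rewrite ltry.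
Qed.

End tails.

Theorem theorem6p2 (R : realType) (d : nat) (hd : (1 < d)%N)
    (eta sigma c alpha eps : R)
    (heta : 0 < eta) (hsigma : 0 < sigma) (hc : 0 < c)
    (halpha0 : 0 < alpha) (halpha1 : alpha < 1) (heps : 0 < eps)
    (Omega : set 'rV[R]_d) (hOmega : bounded_smooth_domain Omega)
    (disp : measure_display) (T : measurableType disp)
    (P : 'rV[R]_d -> probability T R)
    (X : R -> T -> 'rV[R]_d) (gamma H : R -> T -> R)
    (hX : reflecting_brownian_motion Omega P X)
    (hgamma : forall x, closure Omega x ->
       boundary_local_time Omega X gamma (P x))
    (hH : forall x, closure Omega x ->
       independent_subordinator X alpha H (P x))
    (n : 'rV[R]_d -> {measure set (excursion_space Omega) -> \bar R})
    (hn : ito_excursion_measure P X gamma n)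
    (hnE : forall x, bdry Omega x ->
       (0 < n x (exiting_excursions Omega eps) < +oo)%E)
    (x : nat -> 'rV[R]_d) (Q : probability T R)
    (hQ : law_given_starts sigma eta X gamma Omega eps P x Q)
    (hgammaQ : boundary_local_time Omega X gamma Q)
    (hHQ : independent_subordinator X alpha H Q) :
  let e := holding_time sigma eta X gamma Omega eps in
  let ebar := bar_holding_time sigma eta c X gamma H Omega eps in
  let He := subordinated_holding_time sigma eta X gamma H Omega eps in
  [/\ {ae Q, forall w, ebar 0%N w = He 0%N w},
      (forall i : nat, (0 < i)%N -> same_law Q (ebar i) (He i)) &
      independent_seq Q ebar]
  /\
  (forall nE : R,
     (forall z, bdry Omega z -> n z (exiting_excursions Omega eps) = nE%:E) ->
     (forall z, bdry Omega z -> forall t : R, 0 <= t ->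
        P z [set w | (t%:E < e 0%N w)%E] =
        (expR (- (t * (sigma / eta) * nE)))%:E) ->
     [/\ independent_seq Q ebar,
         (forall i j : nat, forall A, measurable A ->
            Q (ebar i @^-1` A) = Q (ebar j @^-1` A)) &
         exists2 kappa : R, 0 < kappa &
           forall i, mittag_leffler_rv Q alpha kappa (ebar i)]).
Proof.
move=> e ebar He.
have [oOmega _ _ _ _] := hOmega.
have bx := given_boundary hQ.
have b0 : bdry Omega !=set0 by exists (x 0%N); exact: bx.
have cX := rbm_continuous hX; have clX := rbm_closure hX.
have mX t j (t0 : 0 <= t) := rbm_measurable hX j t0.
have starts i : {ae Q, forall w, (visit_start Omega eps (X ^~ w) i < +oo)%E /\
    bdry Omega (X (fine (visit_start Omega eps (X ^~ w) i)) w)}.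
  by apply: filterS (given_starts hQ i) => w [? ->]; split => //; exact: bx.
have inde : independent_seq Q e := given_independent hQ.
have indbar : independent_seq Q ebar.
  exact: (bar_holding_times_independent c heta hsigma heps oOmega b0 cX clX mX hgammaQ hHQ starts inde).
split.
  split => //.
  - exact: (bar_holding_time0 c heta hsigma heps oOmega b0 cX clX hgammaQ hHQ starts).
  - move=> i _.
    exact: (bar_holding_time_same_law c heta hsigma heps oOmega b0 cX clX mX hgammaQ hHQ starts inde).
move=> nE nE_E tail.
pose lambda := sigma / eta * nE.
have lambda0 : 0 < lambda.
  have := hnE _ (bx 0%N); rewrite nE_E// lte_fin => /andP[nE0 _].
  by rewrite mulr_gt0// divr_gt0.
have e_tail i t : 0 <= t ->
    Q [set w | (t%:E < e i w)%E] = (expR (- (t * lambda)))%:E.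
  move=> t0; rewrite (given_holding_law hQ i t0) mulrA -(tail _ (bx i))//.
  congr (P _ _); apply/seteqP; split => w /=;
    by rewrite /e /holding_time /= (local_time_start hgammaQ) sube0.
have e0 i w : 0 <= fine (e i w).
  by have [ew|?] := holding_time_ge0 eps heta hsigma hgammaQ i w; [rewrite /e ew|exact: fine_ge0].
have ML i : mittag_leffler_rv Q alpha lambda (ebar i).
  apply: (mixture_mittag_leffler halpha0 lambda0 hHQ.1 (inde.1 i) (e0 i) (e_tail i) (indbar.1 i)).
  exact: (bar_holding_time_mixture c heta hsigma heps oOmega b0 cX clX mX hgammaQ hHQ starts inde i).
split => //; last by exists lambda.
move=> i j; apply: law_determined_by_tails; [exact: indbar.1|exact: indbar.1|].
move=> t; have [t0|t0] := leP 0 t.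
  have [_ _ ->//] := ML i; by have [_ _ ->] := ML j.
have ebar0 k w : (t%:E < ebar k w)%E by apply: lt_le_trans (measure_ge0 _ _); rewrite lte_fin.
by congr (Q _); apply/seteqP; split => w _ /=; exact: ebar0.
Qed.
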